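(* Let $a\in\mathbb{R}$ and let $L^a=x^2\frac{\partial^2}{\partial x^2}+x\frac{\partial}{\partial x}-a^2x^2$ on $\mathbb{R}^+=(0,\infty)$. For every $u_0\in C_0^\infty(\mathbb{R}^+)$, the heat Cauchy problem for the Bessel operator $$L^a u(t,x)=\frac{\partial}{\partial t}u(t,x),\quad (t,x)\in\mathbb{R}^+\times\mathbb{R}^+,\qquad u(0,x)=u_0(x),$$ has the unique solution given by $$u(t,x)=\int_0^\infty K_a(t,x,x')\,u_0(x')\,\frac{dx'}{x'},$$ with $$K_a(t,x,x')=\frac{1}{4\sqrt{\pi}\,t^{3/2}}\int_{\{s>0:\ \cosh^2(s/2)\geq\frac{(x+x')^2}{4xx'}\}} s\,e^{-\frac{s^2}{4t}}\,J_0\!\left(|a|\sqrt{4xx'\cosh^2(s/2)-(x+x')^2}\right)ds,$$ where $J_0$ is the Bessel function of the first kind of order $0$.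
   Context: $C_0^\infty(\mathbb{R}^+)$ denotes the smooth compactly supported functions on $(0,\infty)$. The operator $L^a$ acts in the variable $x$. The initial condition is understood as the limit as $t\to0^+$.
   Formalization: Uniqueness is claimed only among classical solutions with |u(t,x)| ≤ A exp(B (ln x)^2) on each strip 0<t≤T, since without a growth condition it fails (Tychonoff's null solutions, e.g. a=0); the formula is proved to lie in this class. Here u_0 is real-valued. *)

(* Defs.v *)
From HB Require Import structures.
From mathcomp Require Import all_boot all_order all_algebra.
From mathcomp Require Import all_classical all_reals all_analysis.

Set Implicit Arguments.
Unset Strict Implicit.
Unset Printing Implicit Defensive.

Import Order.TTheory GRing.Theory Num.Theory.
Import numFieldNormedType.Exports.

Local Open Scope ring_scope.
Local Open Scope classical_set_scope.

Definition cosh {R : realType} (x : R) : R := (expR x + expR (- x)) / 2.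

(* J_0(z) = sum_k (-1)^k / (k!)^2 * (z / 2)^(2k) *)
Definition besselJ0_coeff {R : realType} (z : R) : R^nat :=
  fun k => (-1) ^+ k / (k`!%:R ^+ 2) * (z / 2) ^+ k.*2.

Definition besselJ0 {R : realType} (z : R) : R :=
  limn (series (besselJ0_coeff z)).

(* Functions on (0, +oo) are represented by functions on R whose values outside
   (0, +oo) are irrelevant; at x > 0 the iterated derivatives only depend on
   the restriction to (0, +oo). *)
Definition smooth_compact_support {R : realType} (f : R -> R) : Prop :=
  (forall (n : nat) (x : R), 0 < x -> derivable (derive1n n f) x 1) /\
  (exists K : set R, [/\ compact K, K `<=` `]0, +oo[ &
     forall x : R, 0 < x -> ~ K x -> f x = 0]).

Definition besselL {R : realType} (a : R) (f : R -> R) (x : R) : R :=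
  x ^+ 2 * derive1n 2 f x + x * derive1 f x - a ^+ 2 * x ^+ 2 * f x.

Definition continuous_quadrant {R : realType} (f : R -> R -> R) : Prop :=
  forall t x : R, 0 < t -> 0 < x ->
    {for (t, x), continuous (fun p : R * R => f p.1 p.2)}.

(* u is of class C^1 in t and C^2 in x on (0, +oo) x (0, +oo). *)
Definition C12 {R : realType} (u : R -> R -> R) : Prop :=
  (forall t x : R, 0 < t -> 0 < x ->
     [/\ derivable (fun t' => u t' x) t 1,
         derivable (u t) x 1 &
         derivable (derive1 (u t)) x 1]) /\
  [/\ continuous_quadrant u,
      continuous_quadrant (fun t x => derive1 (fun t' => u t' x) t),
      continuous_quadrant (fun t x => derive1 (u t) x) &
      continuous_quadrant (fun t x => derive1n 2 (u t) x)].

Definition heat_cauchy_solution {R : realType} (a : R) (u0 : R -> R)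
    (u : R -> R -> R) : Prop :=
  [/\ C12 u,
      forall t x : R, 0 < t -> 0 < x ->
        besselL a (u t) x = derive1 (fun t' => u t' x) t &
      forall x : R, 0 < x -> u t x @[t --> 0^'+] --> u0 x].

(* Tychonoff's uniqueness class: with y = ln x, besselL a becomes
   d^2/dy^2 - a^2 exp(2 y) on the real line, and the bound below is
   |u| <= A exp(B y^2) on each strip 0 < t <= T. Uniqueness fails without a
   growth condition, already for a = 0. *)
Definition tychonoff_growth {R : realType} (u : R -> R -> R) : Prop :=
  forall T : R, 0 < T -> exists A B : R,
    forall t x : R, 0 < t <= T -> 0 < x ->
      `|u t x| <= A * expR (B * ln x ^+ 2).

Definition heat_kernel {R : realType} (a t x x' : R) : R :=
  1 / (4 * Num.sqrt pi * t `^ (3 / 2)) *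
  \int[lebesgue_measure]_(s in
      [set s : R | 0 < s /\ (x + x') ^+ 2 / (4 * x * x') <= cosh (s / 2) ^+ 2])
    (s * expR (- (s ^+ 2 / (4 * t))) *
     besselJ0 (`|a| *
       Num.sqrt (4 * x * x' * cosh (s / 2) ^+ 2 - (x + x') ^+ 2))).

Definition heat_formula {R : realType} (a : R) (u0 : R -> R) (t x : R) : R :=
  \int[lebesgue_measure]_(x' in `]0, +oo[) (heat_kernel a t x x' * u0 x' / x').

(* Main.v *)
(* Write b_nu(z) = sum_k (-z/4)^k / (k! (k+nu)!), so that J_0(z) = b_0(z^2),
   b_nu' = - b_(nu+1) / 4 and |b_nu| <= 1 on z >= 0.

   Existence. The integrand of the kernel is odd in s, hence the integral over
   s >= |ln(x/x')| equals the one over s >= ln(x/x'). Putting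
   r = s - ln(x/x') makes the domain r >= 0 independent of x and the integrand
   smooth in (t, x) up to its boundary. The functions
   s^i (e^r - 1)^j exp(-s^2/4t) b_nu(zeta), where zeta is the square of the
   argument of J_0, span a space stable under the derivatives in t and x, and
   they are O(e^-r) locally uniformly, so one may differentiate under the
   integral. By Bessel's equation the heat operator applied to the integrand is
   a total r-derivative that vanishes at both ends.

   Initial condition. For a = 0 the kernel is the Gaussian in ln x - ln x';
   as |b_0(zeta) - 1| <= zeta, the difference from that case is O(sqrt t).

   Uniqueness. In the variable y = ln x the difference z of two solutions
   satisfies z_t = z_yy - V z with V >= 0 and z = 0 at t = 0. The energy, the
   integral over |y| <= N of z^2 (1 - y^2/N^2)^2 exp(-theta(t) y^2), with theta
   increasing and dominating the growth of z, tends to 0 as t -> 0 and has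
   derivative O(1/N); N -> oo gives z = 0 on a strip of fixed height, and strips
   are stacked. *)
Require Import Defs.
From mathcomp Require Import all_boot all_order all_algebra.
From mathcomp Require Import ring lra.
From mathcomp Require Import all_classical all_reals all_analysis.
From mathcomp Require Import measurable_realfun.
Import Order.TTheory GRing.Theory Num.Theory.
Import numFieldNormedType.Exports.
Local Open Scope ring_scope.
Local Open Scope classical_set_scope.

Set Implicit Arguments.
Unset Strict Implicit.

(** J_0 of a square root is not visibly smooth where the root vanishes, which happens at the lower
    end of the s-integral; b_0 is entire, so the difficulty disappears. The endpoint |ln (x / x')|
    itself has a corner at x = x', which oddness removes. Since zeta >= - a^2 x'^2 and x' stays in a
    compact set, b_nu is still bounded there. The sharp bound is kept for the unshifted form, in the
    initial condition and the growth estimate.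

    For uniqueness, exp(- theta y^2) is a supersolution of the backward heat equation only if theta'
    >= 4 theta^2, which no positive theta satisfies for all time. So theta runs linearly from q to 2
    q, with slope 4 (2 q)^2 = 16 q^2, during a time 1 / (16 q). As q = 2 B + 1 depends only on the
    growth exponent up to the final time, all strips have the same height and finitely many
    suffice. *)

Lemma is_derive_continuous {R : realType} (f : R -> R) (x l : R) :
  is_derive x 1 f l -> {for x, continuous f}.
Proof.
by case=> df _; apply: differentiable_continuous; apply/derivable1_diffP.
Qed.

(** * Bessel-Clifford functions *)

Section bessel_clifford.
Context {R : realType}.
Implicit Types (nu k n : nat) (z : R).

Definition bessel_clifford_coeff nu k : R :=
  (- 4^-1) ^+ k / (k`!%:R * (k + nu)`!%:R).

Definition bessel_clifford nu z : R :=
  limn (pseries (bessel_clifford_coeff nu) z).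

Let c := bessel_clifford_coeff.
Let b := bessel_clifford.

Lemma factR_neq0 n : n`!%:R != 0 :> R.
Proof. by rewrite pnatr_eq0 -lt0n fact_gt0. Qed.

(** Since (k + nu)! >= 1, the terms are dominated by those of the exponential series at |z| / 4. *)
Lemma is_cvg_bessel_clifford nu z :
  cvgn (pseries (bessel_clifford_coeff nu) z).
Proof.
apply: normed_cvg.
apply: (@series_le_cvg _ _ (exp_coeff (`|z| / 4))) => [n|n|n|].
- exact: normr_ge0.
- by apply: exp_coeff_ge0; rewrite divr_ge0.
- rewrite /= /bessel_clifford_coeff exp_coeffE !normrM normfV normrX normrN.
  rewrite (ger0_norm (_ : 0 <= 4^-1))// normrX normrM !normr_nat exprMn invfM.
  have hk : (n`!%:R^-1 : R) * (n + nu)`!%:R^-1 <= n`!%:R^-1.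
    by rewrite ler_piMr// invf_le1// ?ltr0n ?fact_gt0// ler1n fact_gt0.
  have h4 : (0 : R) <= 4^-1 ^+ n * `|z| ^+ n by rewrite mulr_ge0// exprn_ge0.
  have := ler_wpM2l h4 hk; lra.
- exact: is_cvg_series_exp_coeff.
Qed.

Lemma pseries_diffs_bessel_clifford nu :
  pseries_diffs (c nu) = (fun k => - 4^-1 * c nu.+1 k).
Proof.
apply/funext => k; rewrite /pseries_diffs /c /bessel_clifford_coeff.
rewrite addSnnS factS natrM exprS.
field; by rewrite !factR_neq0 nat1r pnatr_eq0.
Qed.

Lemma pseries_scale (d : R^nat) (r : R) z :
  pseries (fun k => r * d k) z = (fun n => r * pseries d z n).
Proof.
apply/funext => n; rewrite /pseries /series /= big_distrr /=.
by apply: eq_bigr => i _; rewrite mulrA.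
Qed.

(** Termwise differentiation needs convergence of the series and of its first two formal derivatives
    at a point beyond |z|, here |z| + 1. Formal differentiation only raises the order and multiplies
    by -1/4, so all three are instances of the same convergence. *)
Lemma is_derive_bessel_clifford nu z :
  is_derive z 1 (bessel_clifford nu) (- 4^-1 * bessel_clifford nu.+1 z).
Proof.
have E (r : R) (d : nat) x :
    cvgn (pseries (fun k => r * c d k) x) /\
    limn (pseries (fun k => r * c d k) x) = r * b d x.
  have h : pseries (fun k => r * c d k) x @ \oo --> r * b d x.
    rewrite pseries_scale; apply: cvgM; first exact: cvg_cst.
    exact: is_cvg_bessel_clifford.
  by split; [apply/cvg_ex; exists (r * b d x)|apply/cvg_lim].
have dd : pseries_diffs (pseries_diffs (c nu)) =
    (fun k => 4^-1 ^+ 2 * c nu.+2 k).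
  apply/funext => k; rewrite pseries_diffs_bessel_clifford /pseries_diffs.
  have := congr1 (fun f => f k) (pseries_diffs_bessel_clifford nu.+1).
  rewrite /pseries_diffs => h.
  by rewrite mulrCA h; ring.
have dc := pseries_diffs_bessel_clifford nu.
rewrite -[X in is_derive _ _ _ X]((E (- 4^-1) nu.+1 z).2) -dc.
apply: (@pseries_snd_diffs _ (c nu) (`|z| + 1) z).
- exact: is_cvg_bessel_clifford.
- by rewrite dc; exact: (E _ _ _).1.
- by rewrite dd; exact: (E _ _ _).1.
- by rewrite (ger0_norm (addr_ge0 (normr_ge0 z) ler01)) ltrDl.
Qed.

Lemma continuous_bessel_clifford nu : continuous (bessel_clifford nu).
Proof.
by move=> z; exact: is_derive_continuous (is_derive_bessel_clifford nu z).
Qed.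

Lemma bessel_clifford0 nu : bessel_clifford nu 0 = nu`!%:R^-1.
Proof.
apply/cvg_lim => //; rewrite -(cvg_shiftS _) /=.
rewrite (_ : (fun n => _) = cst (nu`!%:R^-1)); first exact: cvg_cst.
apply/funext => n; rewrite /pseries /series /= big_nat_recl// big1.
  by rewrite /bessel_clifford_coeff !expr0 fact0 !mul1r addr0 mulr1.
by move=> i _; rewrite exprS mul0r mulr0.
Qed.

(* The power series form of Bessel's equation. *)
Lemma bessel_clifford_rec nu z :
  z / 4 * bessel_clifford nu.+2 z - nu.+1%:R * bessel_clifford nu.+1 z
    + bessel_clifford nu z = 0.
Proof.
(* The relation already holds between partial sums: the factor z in front of order [nu.+2] accounts
   for the shorter sum on the right. It remains to let n tend to infinity. *)
have key n : pseries (c nu) z n.+1 - nu.+1%:R * pseries (c nu.+1) z n.+1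
    = - (z / 4) * pseries (c nu.+2) z n.
  rewrite /pseries /series /=; elim: n => [|n IH].
    rewrite !big_nat1 big_nil /c /bessel_clifford_coeff !add0n !expr0 fact0.
    by rewrite [nu.+1`!]factS natrM; field; rewrite !factR_neq0 !nat1r !pnatr_eq0.
  rewrite [in LHS]big_nat_recr// [X in _ - _ * X]big_nat_recr//=.
  rewrite [in RHS]big_nat_recr//= !mulrDr -IH /c /bessel_clifford_coeff.
  rewrite !addSn !addnS !factS !natrM !exprS.
  rewrite -!natr1 !natrD.
  field; rewrite !factR_neq0 natr1 pnatr_eq0 andbT /=.
  have h3 : (n%:R + nu%:R + 1 + 1 != 0 :> R) by rewrite -natrD !natr1 pnatr_eq0.
  have h2 : (n%:R + nu%:R + 1 != 0 :> R) by rewrite -natrD !natr1 pnatr_eq0.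
  by rewrite h2 h3.
have cv d : pseries (c d) z @ \oo --> b d z by exact: is_cvg_bessel_clifford.
have cvS d : (fun n => pseries (c d) z n.+1) @ \oo --> b d z.
  by rewrite (cvg_shiftS (pseries (c d) z)); exact: cv.
have L : (fun n => pseries (c nu) z n.+1 - nu.+1%:R * pseries (c nu.+1) z n.+1)
    @ \oo --> b nu z - nu.+1%:R * b nu.+1 z.
  apply: cvgB; first exact: cvS.
  by apply: cvgM; [exact: cvg_cst|exact: cvS].
have L' : (fun n => pseries (c nu) z n.+1 - nu.+1%:R * pseries (c nu.+1) z n.+1)
    @ \oo --> - (z / 4) * b nu.+2 z.
  under eq_fun do rewrite key.
  by apply: cvgM; [exact: cvg_cst|exact: cv].
have e : b nu z - nu.+1%:R * b nu.+1 z = - (z / 4) * b nu.+2 z.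
  exact: (cvg_unique _ L L').
rewrite /b in e; lra.
Qed.

(* The energy b_nu^2 + z b_(nu+1)^2 / 4 is nonincreasing in z >= 0. *)
Lemma bessel_clifford_le1 nu z : 0 <= z -> `|bessel_clifford nu z| <= 1.
Proof.
move=> z0.
pose E (x : R) : R := b nu x ^+ 2 + x / 4 * b nu.+1 x ^+ 2.
pose E' (x : R) : R := - ((2 * nu + 1)%:R / 4 * b nu.+1 x ^+ 2).
have dE (x : R) : is_derive x 1 E (E' x).
  have h0 := is_derive_bessel_clifford nu x.
  have h1 := is_derive_bessel_clifford nu.+1 x.
  rewrite /E /E' /b.
  apply: is_derive_eq; rewrite /GRing.scale /=.
  have := bessel_clifford_rec nu x; rewrite natrD natrM -(natr1 nu) => h.
  (* Eliminating order [nu] by the recurrence cancels the mixed product of orders [nu.+1] and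
     [nu.+2]; a nonpositive multiple of a square remains. *)
  have -> : bessel_clifford nu x = (nu%:R + 1) * bessel_clifford nu.+1 x -
    x / 4 * bessel_clifford nu.+2 x by lra.
  by field.
have := @MVT_segment _ E E' 0 z z0 (fun x _ => dE x).
case.
  by apply: continuous_subspaceT => x; exact: is_derive_continuous (dE x).
move=> x xI e.
have : E z <= E 0.
  rewrite -subr_le0 e subr0 mulr_le0_ge0//.
  by rewrite /E' oppr_le0 mulr_ge0// ?sqr_ge0// divr_ge0.
rewrite /E mul0r mul0r addr0 /b bessel_clifford0 => h.
have h1 : bessel_clifford nu z ^+ 2 <= 1.
  apply: le_trans (le_trans h _).
    by rewrite lerDl mulr_ge0// ?sqr_ge0// divr_ge0.
  by rewrite expr_le1// invf_le1 ?ler1n ?ltr0n ?fact_gt0.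
by rewrite -real_normK ?num_real// expr_le1 in h1.
Qed.

(** For z < 0 the function grows like a modified Bessel function, so a bound can hold only on
    half-lines. Continuity handles the segment [m, 0], the energy bound the rest. *)
Lemma bessel_clifford_bounded nu (m : R) :
  exists C : R, forall z, m <= z -> `|bessel_clifford nu z| <= C.
Proof.
have [m0|m0] := leP 0 m.
  by exists 1 => z mz; apply: bessel_clifford_le1; exact: le_trans mz.
have [|x _ h] := @EVT_max R (fun z => `|bessel_clifford nu z|) m 0 (ltW m0).
  apply: continuous_subspaceT => x; apply: continuous_comp.
    exact: continuous_bessel_clifford.
  exact: norm_continuous.
exists (Num.max 1 `|bessel_clifford nu x|) => z mz.
rewrite le_max; have [z0|z0] := leP 0 z.
  by rewrite bessel_clifford_le1.
by rewrite h ?orbT// in_itv/= mz ltW.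
Qed.

Lemma bessel_clifford_sub1_le z : 0 <= z -> `|bessel_clifford 0 z - 1| <= z.
Proof.
move=> z0.
have [||x xI e] := @MVT_segment _ (bessel_clifford 0)
    (fun x => - 4^-1 * bessel_clifford 1 x) 0 z z0.
- by move=> x _; exact: is_derive_bessel_clifford.
- by apply: continuous_subspaceT => x; exact: continuous_bessel_clifford.
rewrite bessel_clifford0 invr1 subr0 in e; rewrite e normrM (ger0_norm z0).
have x0 : 0 <= x by move: xI; rewrite in_itv /= => /andP[].
rewrite ler_piMl// normrM normrN (ger0_norm (_ : 0 <= 4^-1))//.
have := bessel_clifford_le1 1 x0; lra.
Qed.

Lemma besselJ0E z : besselJ0 z = bessel_clifford 0 (z ^+ 2).
Proof.
rewrite /besselJ0 /bessel_clifford; congr (limn _).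
apply/funext => n; apply: eq_bigr => k _ /=.
rewrite /besselJ0_coeff /bessel_clifford_coeff addn0 -exprM mul2n exprMn.
have -> : (- 4^-1 : R) ^+ k = (-1) ^+ k * 2^-1 ^+ k.*2.
  by rewrite -mul2n exprM -exprMn; congr (_ ^+ _); field.
by field; rewrite factR_neq0.
Qed.

End bessel_clifford.

(** * Continuity and differentiation under the integral sign *)

Section under_integral.
Context {R : realType} {d : measure_display} {Y : measurableType d}.
Variables (mu : {measure set Y -> \bar R}) (B : set Y).
Hypothesis mB : measurable B.

Lemma integrable_dominated (f G : Y -> R) :
  measurable_fun B f -> mu.-integrable B (EFin \o G) ->
  (forall y, B y -> `|f y| <= G y) -> mu.-integrable B (EFin \o f).
Proof.
move=> mf iG fG; apply: (le_integrable mB _ _ iG).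
  exact/measurable_EFinP.
move=> y By /=; rewrite lee_fin.
exact: le_trans (fG _ By) (ler_norm _).
Qed.

(** Dominated convergence is sequential. If continuity failed, there would be points p_n in the
    balls of radius 1 / (n + 1), chosen where the domination holds, whose integrals stay at distance
    e from the expected limit. *)
Lemma continuous_under_integral {V : pseudoMetricType R} (F : V -> Y -> R) (p0 : V)
    (G : Y -> R) :
  mu.-integrable B (EFin \o G) ->
  (forall p, measurable_fun B (F p)) ->
  (\forall p \near p0, forall y, B y -> `|F p y| <= G y) ->
  (forall y, B y -> F p y @[p --> p0] --> F p0 y) ->
  {for p0, continuous (fun p => \int[mu]_(y in B) F p y)}.
Proof.
move=> iG mF domF cF; apply/cvgrPdist_lt => e e0; apply: contrapT => nnear.
have H n : exists p, [/\ ball p0 n.+1%:R^-1 p,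
    forall y, B y -> `|F p y| <= G y &
    e <= `|\int[mu]_(y in B) F p0 y - \int[mu]_(y in B) F p y| ].
  apply: contrapT => nex; apply: nnear.
  have hb : \forall p \near p0, ball p0 n.+1%:R^-1 p.
    exact: nbhsx_ballx.
  near=> p; rewrite ltNge; apply/negP => ep; apply: nex; exists p; split.
  - by near: p.
  - by near: p.
  - exact: ep.
have [p_ Hp] := choice H.
have pp0 : p_ n @[n --> \oo] --> p0.
  apply/cvg_ballP => eps eps0; near=> n.
  have [+ _ _] := Hp n; apply: le_ball.
  rewrite invf_ple ?posrE// (le_trans (ltW (truncnS_gt _)))//.
  rewrite ler_nat ltnS; near: n; exact: nbhs_infty_ge.
have c : \int[mu]_(y in B) F (p_ n) y @[n --> \oo] --> \int[mu]_(y in B) F p0 y.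
  have iF0 : mu.-integrable B (EFin \o F p0).
    apply: (integrable_dominated (mF _) iG); exact: nbhs_singleton domF.
  apply: fine_cvg; rewrite /Rintegral fineK; last exact: integrable_fin_num.
  apply: (@dominated_cvg _ _ _ mu _ mB
    (fun n y => (F (p_ n) y)%:E) _ (EFin \o G)) => //=.
  - by move=> n; exact/measurable_EFinP.
  - move=> y By; apply: cvg_EFin; first exact: nearW.
    exact: (cvg_comp _ _ pp0 (cF y By)).
  - move=> n y By; rewrite lee_fin.
    by have [_ + _] := Hp n; exact.
move/cvgrPdist_lt : c => /(_ _ e0) [N _ /(_ N (leqnn N)) /=].
by rewrite ltNge; have [_ _ ->] := Hp N.
Unshelve. all: by end_near. Qed.

Lemma is_derive_under_integral (f df : R -> Y -> R) (G : Y -> R) (a e : R) :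
  0 < e ->
  mu.-integrable B (EFin \o G) ->
  (forall x, `|x - a| < e -> mu.-integrable B (EFin \o f x)) ->
  (forall x y, `|x - a| < e -> B y -> is_derive x 1 (f ^~ y) (df x y)) ->
  (forall x y, `|x - a| < e -> B y -> `|df x y| <= G y) ->
  is_derive a 1 (fun x => \int[mu]_(y in B) f x y) (\int[mu]_(y in B) df a y).
Proof.
move=> e0 iG intf ddf dfG.
have Ie x : `]a - e, a + e[ x -> `|x - a| < e.
  by rewrite /= in_itv /= ltr_distl.
have Ia : `]a - e, a + e[ a by rewrite /= in_itv/= ltrBlDr !ltrDl e0.
(* The majorant must be nonnegative everywhere, while the hypotheses force this only on [B]; hence
   the norm. *)
pose G' y := `|G y|.
have iG' : mu.-integrable B (EFin \o G').
  apply: (@integrable_dominated _ _ _ (integrable_norm iG)).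
    by case/integrableP : iG => /measurable_EFinP mG _; exact: measurableT_comp.
  by move=> y _ /=; rewrite normr_id.
have dE x y : `]a - e, a + e[ x -> B y -> partial1of2 f x y = df x y.
  by move=> /Ie xI By; rewrite partial1of2E; have /(_ xI By) [_ ->] := ddf x y.
have hd x y : `]a - e, a + e[ x -> B y -> derivable (f ^~ y) x 1.
  by move=> /Ie xI By; have /(_ xI By) [] := ddf x y.
have hG x y : `]a - e, a + e[ x -> B y -> `|partial1of2 f x y| <= G' y.
  move=> xI By; rewrite dE// /G'.
  exact: le_trans (dfG _ _ (Ie _ xI) By) (ler_norm _).
have G0 y : 0 <= G' y by exact: normr_ge0.
have intf' x : `]a - e, a + e[ x -> mu.-integrable B (EFin \o f x).
  by move=> /Ie; exact: intf.
apply: DeriveDef.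
  exact: (derivable_under_integral mB Ia intf' hd G0 iG' hG).
rewrite -derive1E (differentiation_under_integral mB Ia intf' hd G0 iG' hG).
apply: eq_Rintegral => y; rewrite inE => By; exact: dE.
Qed.

End under_integral.

(** * A family of kernels stable under differentiation *)

Section moment_kernel.
Context {R : realType}.
Variable a : R.
Implicit Types (i j nu : nat) (t x r : R) (w : R * R).

(* A point of the integration domain is [w = (x', r)], where
   [r = s - ln (x / x')] and [s] is the variable of the kernel formula. *)
Definition shifted_s x w : R := ln x - ln w.1 + w.2.

(** This is a^2 (2 x x' cosh s - x^2 - x'^2), the square of the argument of J_0, after substituting
    e^s = (x / x') e^r. It vanishes at r = 0. *)
Definition bessel_arg x w : R :=
  a ^+ 2 * (x ^+ 2 * (expR w.2 - 1) - w.1 ^+ 2 * (1 - expR (- w.2))).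

(* This family is stable under differentiation in t and in x. *)
Definition moment_kernel i j nu t x w : R :=
  shifted_s x w ^+ i * (expR w.2 - 1) ^+ j *
  expR (- (shifted_s x w ^+ 2 / (4 * t))) * bessel_clifford nu (bessel_arg x w).

Lemma measurable_shifted_s x : measurable_fun setT (shifted_s x).
Proof.
apply: measurable_funD => //; apply: measurable_funB => //.
by apply: measurableT_comp => //; exact: measurable_ln.
Qed.

Lemma measurable_bessel_arg x : measurable_fun setT (bessel_arg x).
Proof.
apply: measurable_funM => //; apply: measurable_funB.
  apply: measurable_funM => //; apply: measurable_funB => //.
  exact: measurableT_comp.
apply: measurable_funM; first exact: measurable_funX.
apply: measurable_funB => //; apply: measurableT_comp => //.
exact: measurableT_comp.
Qed.

Lemma measurable_moment_kernel i j nu t x :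
  measurable_fun setT (moment_kernel i j nu t x).
Proof.
apply: measurable_funM; last first.
  apply: measurableT_comp; last exact: measurable_bessel_arg.
  by apply: continuous_measurable_fun; exact: continuous_bessel_clifford.
apply: measurable_funM; last first.
  apply: measurableT_comp => //; apply: measurableT_comp => //.
  apply: measurable_funM => //.
  by apply: measurable_funX; exact: measurable_shifted_s.
apply: measurable_funM.
  by apply: measurable_funX; exact: measurable_shifted_s.
apply: measurable_funX; apply: measurable_funB => //.
exact: measurableT_comp.
Qed.

Lemma continuous_moment_kernel i j nu t x w : 0 < t -> 0 < x ->
  moment_kernel i j nu p.1 p.2 w @[p --> (t, x)] --> moment_kernel i j nu t x w.
Proof.
move=> t0 x0; rewrite /moment_kernel.
have c1 : p.1 @[p --> (t, x)] --> t by exact: cvg_fst.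
have c2 : p.2 @[p --> (t, x)] --> x by exact: cvg_snd.
have cs : shifted_s p.2 w @[p --> (t, x)] --> shifted_s x w.
  apply: cvgD; last exact: cvg_cst.
  apply: cvgB; last exact: cvg_cst.
  exact: (cvg_comp _ _ c2 (continuous_ln x0)).
have cX n (f : R * R -> R) (l : R) : f p @[p --> (t, x)] --> l ->
    f p ^+ n @[p --> (t, x)] --> l ^+ n.
  by move=> fl; exact: (cvg_comp _ _ fl (@exprn_continuous R n l)).
apply: cvgM; last first.
  have cb : bessel_arg p.2 w @[p --> (t, x)] --> bessel_arg x w.
    apply: cvgM; first exact: cvg_cst.
    apply: cvgB; last exact: cvg_cst.
    by apply: cvgM; [exact: cX|exact: cvg_cst].
  exact: (cvg_comp _ _ cb (@continuous_bessel_clifford R nu (bessel_arg x w))).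
apply: cvgM.
  by apply: cvgM; [exact: cX|exact: cvg_cst].
have ce : - (shifted_s p.2 w ^+ 2 / (4 * p.1)) @[p --> (t, x)] -->
    - (shifted_s x w ^+ 2 / (4 * t)).
  apply: cvgN; apply: cvgM; first exact: cX.
  apply: cvgV; first by rewrite mulf_neq0 ?gt_eqF.
  by apply: cvgM; [exact: cvg_cst|exact: c1].
exact: (cvg_comp _ _ ce (@continuous_expR R _)).
Qed.

(** Completing the square gives s^2 / (4 t) >= L s - L^2 t for every L, and s >= r - c. The powers
    of s and of e^r - 1 cost at most e^(i (c + r)) and e^(j r), so L = i + j + 1 leaves exactly
    e^(-r). The Bessel factor is bounded because its argument is at least - a^2 M^2. *)
Lemma moment_kernel_bound i j nu (T c M : R) : 0 < M ->
  exists C : R, forall t x w, 0 < t <= T -> 0 < w.1 <= M ->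
    `|ln x - ln w.1| <= c -> 0 <= w.2 ->
    `|moment_kernel i j nu t x w| <= C * expR (- w.2).
Proof.
move=> M0.
have [C hC] := bessel_clifford_bounded nu (- (a ^+ 2 * M ^+ 2)).
pose L : R := (i + j + 1)%:R.
exists (C * expR (i%:R * c + L * c + L ^+ 2 * T)).
move=> t x [x' r] /= /andP[t0 tT] /andP[x'0 x'M] hc r0.
rewrite /moment_kernel /= !normrM.
have er1 : 1 <= expR r by rewrite -expR0 ler_expR.
have b1 : `|bessel_clifford nu (bessel_arg x (x', r))| <= C.
  apply: hC; rewrite /bessel_arg /= -mulrN ler_wpM2l ?sqr_ge0//.
  have h1 : 0 <= x ^+ 2 * (expR r - 1) by rewrite mulr_ge0 ?sqr_ge0// subr_ge0.
  have h2 : x' ^+ 2 * (1 - expR (- r)) <= M ^+ 2 * 1.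
    apply: ler_pM; rewrite ?sqr_ge0//.
    - by rewrite subr_ge0 -expR0 ler_expR oppr_le0.
    - by rewrite lerXn2r// nnegrE ltW// (lt_le_trans x'0).
  lra.
set s := shifted_s x (x', r).
have sr : r - c <= s by move: hc; rewrite /s /shifted_s /= ler_norml; lra.
have s1 : `|s| <= c + r.
  rewrite /s /shifted_s /= (le_trans (ler_normD _ _))// (ger0_norm r0); lra.
have s2 : `|s ^+ i| <= expR (i%:R * (c + r)).
  rewrite normrX expRM_natl lerXn2r ?nnegrE ?expR_ge0//.
  apply: le_trans s1 _; apply: le_trans (expR_ge1Dx _); lra.
have s3 : `|(expR r - 1) ^+ j| <= expR (j%:R * r).
  rewrite normrX expRM_natl lerXn2r ?nnegrE ?expR_ge0//.
  by rewrite ger0_norm ?subr_ge0// gerBl.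
have s4 : `|expR (- (s ^+ 2 / (4 * t)))| <= expR (L ^+ 2 * T - L * (r - c)).
  rewrite ger0_norm ?expR_ge0// ler_expR.
  have L0 : 0 <= L by [].
  have h1 : 0 <= (s - 2 * L * t) ^+ 2 / (4 * t).
    by rewrite mulr_ge0 ?sqr_ge0// invr_ge0 mulr_ge0// ltW.
  have -> : s ^+ 2 / (4 * t) =
      (s - 2 * L * t) ^+ 2 / (4 * t) + L * s - L ^+ 2 * t.
    by field; rewrite gt_eqF.
  have h2 : L ^+ 2 * t <= L ^+ 2 * T by rewrite ler_wpM2l ?sqr_ge0.
  have h3 : L * (r - c) <= L * s by rewrite ler_wpM2l.
  lra.
apply: (@le_trans _ _ (expR (i%:R * (c + r)) * expR (j%:R * r) *
    expR (L ^+ 2 * T - L * (r - c)) * C)).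
  by rewrite !ler_pM// ?mulr_ge0// ?normr_ge0.
rewrite -!expRD mulrC -mulrA -expRD le_eqVlt; apply/orP; left; apply/eqP.
by congr (_ * expR _); rewrite /L !natrD; ring.
Qed.

Lemma is_derive_expR_comp (g : R -> R) (y dg : R) :
  is_derive y 1 g dg -> is_derive y 1 (fun y => expR (g y)) (expR (g y) * dg).
Proof. by move=> hg; exact: (is_derive1_comp (is_derive_expR (g y)) hg). Qed.

Lemma is_derive_expRN (r : R) : is_derive r 1 (fun r => expR (- r)) (- expR (- r)).
Proof.
have h : is_derive r 1 (fun r : R => - r) (-1) by apply: is_derive_eq.
by have := is_derive_expR_comp h; rewrite mulrN1.
Qed.

(** Stated for arbitrary inner functions [s], [A], [z] so that the derivatives in x and in r are
    both instances. When an exponent is 0, the truncated predecessor is harmless because its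
    coefficient is 0. *)
Lemma is_derive_moment_kernel_gen i j nu t (s A z : R -> R) (y ds dA dz : R) :
  t != 0 -> is_derive y 1 s ds -> is_derive y 1 A dA -> is_derive y 1 z dz ->
  is_derive y 1 (fun y => s y ^+ i * A y ^+ j *
      expR (- (s y ^+ 2 / (4 * t))) * bessel_clifford nu (z y))
    (expR (- (s y ^+ 2 / (4 * t))) *
     ((i%:R * s y ^+ i.-1 * ds * A y ^+ j + s y ^+ i * (j%:R * A y ^+ j.-1 * dA)
       - s y ^+ i * A y ^+ j * (s y * ds / (2 * t))) * bessel_clifford nu (z y)
      - s y ^+ i * A y ^+ j * (4^-1 * bessel_clifford nu.+1 (z y) * dz))).
Proof.
move=> t0 hs hA hz.
have hE : is_derive y 1 (fun y => expR (- (s y ^+ 2 / (4 * t))))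
    (expR (- (s y ^+ 2 / (4 * t))) * (- (s y * ds / (2 * t)))).
  apply: is_derive_expR_comp; apply: is_derive_eq; rewrite /GRing.scale /=.
  by field.
have hB : is_derive y 1 (fun y => bessel_clifford nu (z y))
    (- 4^-1 * bessel_clifford nu.+1 (z y) * dz).
  exact: (is_derive1_comp (is_derive_bessel_clifford nu (z y)) hz).
rewrite (_ : (fun y => _) = s ^+ i * A ^+ j *
  (fun y => expR (- (s y ^+ 2 / (4 * t)))) * (fun y => bessel_clifford nu (z y)));
  last by apply/funext => u; rewrite !fctE.
apply: is_derive_eq; rewrite /GRing.scale /= !fctE.
by field.
Qed.

Lemma is_derive_moment_kernel_t i j nu t x w : 0 < t ->
  is_derive t 1 (fun t => moment_kernel i j nu t x w)
    (moment_kernel i.+2 j nu t x w / (4 * t ^+ 2)).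
Proof.
move=> t0; rewrite /moment_kernel; set s := shifted_s x w.
set b := bessel_clifford _ _; set A := expR w.2 - 1.
have hE : is_derive t 1 (fun t : R => expR (- (s ^+ 2 / (4 * t))))
    (expR (- (s ^+ 2 / (4 * t))) * (s ^+ 2 / (4 * t ^+ 2))).
  apply: is_derive_expR_comp.
  have hV : is_derive t 1 (fun t : R => (4 * t)^-1) (- (4 * t) ^- 2 * 4).
    apply: is_deriveV; first by rewrite mulf_neq0// gt_eqF.
    by apply: is_derive_eq; rewrite /GRing.scale /=; ring.
  apply: is_derive_eq; rewrite /GRing.scale /=.
  by field; rewrite gt_eqF.
apply: is_derive_eq; rewrite /GRing.scale /= !exprS.
by field; rewrite gt_eqF.
Qed.

(** In x, the derivative of s is 1 / x and that of the argument is 2 a^2 x (e^r - 1); the latter is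
    why [j] and [nu] rise together. *)
Lemma is_derive_moment_kernel_x i j nu t x w : 0 < t -> 0 < x ->
  is_derive x 1 (fun x => moment_kernel i j nu t x w)
    (x^-1 * (i%:R * moment_kernel i.-1 j nu t x w
             - moment_kernel i.+1 j nu t x w / (2 * t))
     - a ^+ 2 * x / 2 * moment_kernel i j.+1 nu.+1 t x w).
Proof.
move=> t0 x0.
have hs : is_derive x 1 (fun x => shifted_s x w) x^-1.
  rewrite /shifted_s; have := is_derive1_ln x0 => h.
  by apply: is_derive_eq; ring.
have hA : is_derive x 1 (fun _ : R => expR w.2 - 1) 0 by apply: is_derive_cst.
have hz : is_derive x 1 (fun x => bessel_arg x w)
    (a ^+ 2 * 2 * x * (expR w.2 - 1)).
  by rewrite /bessel_arg; apply: is_derive_eq; rewrite /GRing.scale /=; ring.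
have t0' : t != 0 by rewrite gt_eqF.
apply: is_derive_eq; first exact: (is_derive_moment_kernel_gen i j nu t0' hs hA hz).
rewrite /moment_kernel !exprS.
set s := shifted_s x w; set b := bessel_clifford _ _.
set E := expR _; set A := expR w.2 - 1; set b' := bessel_clifford nu.+1 _.
by field; rewrite !gt_eqF.
Qed.

(** The term x'^2 e^(-r) leads out of the family, so the result is left explicit. It serves for
    continuity in r and for the one combination where that term can be eliminated. *)
Lemma is_derive_moment_kernel_r_gen i j nu t x (x' r : R) : 0 < t ->
  is_derive r 1 (fun r => moment_kernel i j nu t x (x', r))
    (expR (- (shifted_s x (x', r) ^+ 2 / (4 * t))) *
     ((i%:R * shifted_s x (x', r) ^+ i.-1 * (expR r - 1) ^+ j
       + shifted_s x (x', r) ^+ i * (j%:R * (expR r - 1) ^+ j.-1 * expR r)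
       - shifted_s x (x', r) ^+ i * (expR r - 1) ^+ j
         * (shifted_s x (x', r) / (2 * t)))
      * bessel_clifford nu (bessel_arg x (x', r))
      - shifted_s x (x', r) ^+ i * (expR r - 1) ^+ j
        * (4^-1 * bessel_clifford nu.+1 (bessel_arg x (x', r))
           * (a ^+ 2 * (x ^+ 2 * expR r - x' ^+ 2 * expR (- r)))))).
Proof.
move=> t0.
have hs : is_derive r 1 (fun r => shifted_s x (x', r)) 1.
  by rewrite /shifted_s /=; apply: is_derive_eq; ring.
have hA : is_derive r 1 (fun r : R => expR r - 1) (expR r).
  by apply: is_derive_eq; ring.
have hN := is_derive_expRN r.
have hz : is_derive r 1 (fun r => bessel_arg x (x', r))
    (a ^+ 2 * (x ^+ 2 * expR r - x' ^+ 2 * expR (- r))).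
  by rewrite /bessel_arg /=; apply: is_derive_eq; rewrite /GRing.scale /=; ring.
have t0' : t != 0 by rewrite gt_eqF.
have := is_derive_moment_kernel_gen i j nu t0' hs hA hz.
by rewrite !mulr1.
Qed.

(* By Bessel's equation the r-derivative of the (1, 1, 1) term is the
   combination by which the (1, 0, 0) moment misses the heat equation. *)
Lemma is_derive_moment_kernel_r t x (x' r : R) : 0 < t ->
  is_derive r 1 (fun r => moment_kernel 1 1 1 t x (x', r))
    (moment_kernel 0 1 1 t x (x', r) - moment_kernel 2 1 1 t x (x', r) / (2 * t)
     + moment_kernel 1 1 1 t x (x', r)
     - a ^+ 2 * x ^+ 2 / 4 * moment_kernel 1 2 2 t x (x', r)
     + moment_kernel 1 0 0 t x (x', r)).
Proof.
move=> t0.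
apply: (is_derive_eq (is_derive_moment_kernel_r_gen 1 1 1 x x' r t0)).
rewrite /moment_kernel [(x', r).2]/=.
set s := shifted_s x (x', r); set z := bessel_arg x (x', r); set G := expR (- _).
have B := bessel_clifford_rec 0 z.
have er : expR (- r) = (expR r)^-1 by rewrite expRN.
have er0 : expR r != 0 by rewrite gt_eqF ?expR_gt0.
(* The factor e^r - 1 coming from j = 1 turns the stray e^(-r) into the argument [z] itself, which
   is the coefficient that Bessel's equation absorbs. *)
have hz' : (expR r - 1) * (a ^+ 2 * (x ^+ 2 * expR r - x' ^+ 2 * expR (- r))) =
    a ^+ 2 * x ^+ 2 * (expR r - 1) ^+ 2 + z.
  by rewrite /z /bessel_arg /= er; field.
have -> : bessel_clifford 0 z = bessel_clifford 1 z - z / 4 * bessel_clifford 2 z.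
  lra.
have hz2 : z = (expR r - 1) * (a ^+ 2 * (x ^+ 2 * expR r - x' ^+ 2 * expR (- r)))
  - a ^+ 2 * x ^+ 2 * (expR r - 1) ^+ 2 by lra.
move: (bessel_clifford 1 z) (bessel_clifford 2 z) => b1 b2.
rewrite hz2; rewrite !(expr0, expr1, expr2).
by field; rewrite gt_eqF.
Qed.

End moment_kernel.

(** * Moments: the kernels integrated against a compactly supported weight *)

Section moments.
Context {R : realType}.
Notation mu := (@lebesgue_measure R).
Notation mu2 := (mu \x mu)%E.

Lemma integral_expRN : (\int[mu]_(r in `[0%R, +oo[) (expR (- r))%:E = 1)%E.
Proof.
have dF (x : R) : is_derive x 1 (fun r : R => - expR (- r)) (expR (- x)).
  by have h := is_derive_expRN x; apply: is_derive_eq; rewrite opprK.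
rewrite (@ge0_continuous_FTC2y _ _ (fun r => - expR (- r)) 0 0).
- by rewrite oppr0 expR0 EFinN oppeK add0e.
- by move=> x _; exact: expR_ge0.
- by apply: continuous_subspaceT => x; exact: is_derive_continuous (is_derive_expRN x).
- rewrite -oppr0; apply: cvgN; exact: cvgr_expR.
- by move=> x _; have [] := dF x.
- by apply: cvg_at_right_filter; exact: is_derive_continuous (dF 0).
- by move=> x _; rewrite derive1E; have [_ ->] := dF x.
Qed.

Lemma measurable_indic_itv (i : interval R) (d : measure_display)
    (T : measurableType d) (f : T -> R) :
  measurable_fun setT f -> measurable_fun setT (fun w => \1_[set` i] (f w) : R).
Proof.
move=> mf; apply: (measurableT_comp (f := (\1_[set` i] : R -> R)) _ mf).
exact: measurable_indic.
Qed.

(** Up to a constant, the common integrable majorant of all weighted kernels: compact support in x',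
    exponential decay in r. *)
Definition dominating (m M : R) (w : R * R) : R :=
  \1_`[m, M] w.1 * (\1_`[0, +oo[ w.2 * expR (- w.2)).

Lemma measurable_dominating m M : measurable_fun setT (dominating m M).
Proof.
apply: measurable_funM.
  exact: measurable_indic_itv.
apply: measurable_funM.
  exact: measurable_indic_itv.
apply: measurableT_comp => //; exact: measurableT_comp.
Qed.

Lemma dominating_ge0 m M w : 0 <= dominating m M w.
Proof. by rewrite /dominating !mulr_ge0 ?expR_ge0// indicE. Qed.

Lemma integrable_dominating m M : mu2.-integrable setT (EFin \o dominating m M).
Proof.
apply/integrable12ltyP.
  by apply/measurable_EFinP; exact: measurable_dominating.
rewrite (eq_integral (fun x : measurableTypeR R => (\1_`[m, M] x : R)%:E)); last first.
  move=> x _; rewrite /=.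
  rewrite (eq_integral (fun y : measurableTypeR R => ((\1_`[m, M] x : R)%:E *
     (\1_`[0%R, +oo[ y * expR (- y) : R)%:E)%E)); last first.
    by move=> y _; rewrite ger0_norm ?dominating_ge0// -EFinM.
  rewrite ge0_integralZl//=; last first.
    apply/measurable_EFinP; apply: measurable_funM; first exact: measurable_indic.
    by apply: measurableT_comp.
  rewrite (_ : (\int[mu]_y _)%E = 1%E) ?mule1//.
  rewrite -integral_expRN [RHS]integral_mkcond; apply: eq_integral => y _.
  by rewrite patchE indicE; case: ifPn => _; rewrite ?mul1r ?mul0r.
rewrite integral_indic// setIT /=.
by rewrite lebesgue_measure_itv /=; case: ifP => // _; rewrite ltry.
Qed.

Lemma norm_ln_le (p q x : R) : 0 < p -> p <= x <= q -> `|ln x| <= `|ln p| + `|ln q|.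
Proof.
move=> p0 /andP[px xq].
have x0 : 0 < x by exact: lt_le_trans px.
have h1 : ln p <= ln x by rewrite ler_ln ?posrE.
have h2 : ln x <= ln q by rewrite ler_ln ?posrE// (lt_le_trans x0).
have := ler_norm (ln q); have := ler_norm (- ln p); rewrite normrN => h3 h4.
have := normr_ge0 (ln q); have := normr_ge0 (ln p) => h5 h6.
rewrite ler_norml; lra.
Qed.

Variables (a m M U : R) (u : R -> R).
Hypothesis m0 : 0 < m.
Hypothesis mM : m <= M.
Hypothesis measu : measurable_fun setT u.
Hypothesis uU : forall x, `|u x| <= U.
Hypothesis u0 : forall x, ~ (m <= x <= M) -> u x = 0.
Implicit Types (i j nu : nat) (t x : R) (w : R * R).

(** The range r >= 0 is an indicator and the range of x' is the support of [u], so every integral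
    runs over the whole plane. *)
Definition weighted_kernel i j nu t x w : R :=
  u w.1 * \1_`[0, +oo[ w.2 * moment_kernel a i j nu t x w.

Definition moment i j nu t x : R := \int[mu2]_w weighted_kernel i j nu t x w.

Lemma measurable_weighted_kernel i j nu t x :
  measurable_fun setT (weighted_kernel i j nu t x).
Proof.
apply: measurable_funM; last exact: measurable_moment_kernel.
apply: measurable_funM; first exact: measurableT_comp.
exact: measurable_indic_itv.
Qed.

Lemma weighted_kernel_bound i j nu (T p q : R) : 0 < p -> exists2 C : R, 0 <= C &
  forall t x w, 0 < t <= T -> p <= x <= q ->
    `|weighted_kernel i j nu t x w| <= C * dominating m M w.
Proof.
(* [c] bounds |ln x - ln x'| for x in [p, q] and x' in [m, M], which makes the constant uniform on a
   whole range of (t, x). *)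
move=> p0; set c := `|ln p| + `|ln q| + (`|ln m| + `|ln M|).
have M0 : 0 < M by exact: lt_le_trans mM.
have [C hC] := moment_kernel_bound a i j nu T c M0.
exists (U * `|C|).
  by rewrite mulr_ge0// (le_trans _ (uU 0)).
move=> t x [x' r] tT xpq; rewrite /weighted_kernel /dominating /= !indicE.
have [r0|] := boolP (r \in `[0, +oo[); last first.
  by rewrite !(mulr0, mul0r) normr0.
have [xI|] := boolP (x' \in `[m, M]); last first.
  by rewrite notin_setE /= in_itv /= => xI; rewrite u0// !mul0r normr0 mulr0.
rewrite !inE /= !in_itv /= andbT in r0 xI.
rewrite !mul1r mulr1 normrM -mulrA ler_pM//.
apply: le_trans (hC _ _ _ _ _ _ _) _ => //=.
- by case/andP: xI => mx ->; rewrite (lt_le_trans m0).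
- apply: (le_trans (ler_normB _ _)).
  by rewrite lerD// norm_ln_le.
- by rewrite ler_wpM2r ?expR_ge0// ler_norm.
Qed.

Lemma integrable_weighted_kernel i j nu t x : 0 < t -> 0 < x ->
  mu2.-integrable setT (EFin \o weighted_kernel i j nu t x).
Proof.
move=> t0 x0; have [C C0 hC] := weighted_kernel_bound i j nu t x x0.
apply: (@integrable_dominated R _ _ mu2 setT measurableT _
  (fun w => C * dominating m M w)).
- exact: measurable_weighted_kernel.
- exact: (integrableZl measurableT C (integrable_dominating m M)).
- by move=> w _; apply: hC; rewrite ?t0 ?lexx.
Qed.

Lemma continuous_moment i j nu t x : 0 < t -> 0 < x ->
  {for (t, x), continuous (fun p : R * R => moment i j nu p.1 p.2)}.
Proof.
move=> t0 x0.
have x20 : 0 < x / 2 by rewrite divr_gt0.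
have [C C0 hC] := weighted_kernel_bound i j nu (t * 2) (x * 2) x20.
apply: (@continuous_under_integral R _ _ mu2 setT measurableT _ (fun p w =>
  weighted_kernel i j nu p.1 p.2 w) (t, x) (fun w => C * dominating m M w)).
- exact: (integrableZl measurableT C (integrable_dominating m M)).
- by move=> p; exact: measurable_weighted_kernel.
- near=> p => w _; apply: hC.
    apply/andP; split.
      by near: p; apply: (cvgr_gt _ (@cvg_fst _ _ _ _ _)).
    by near: p; apply: (cvgr_le _ (@cvg_fst _ _ _ _ _)); rewrite ltr_pMr ?ltr1n.
  apply/andP; split.
    by near: p; apply: (cvgr_ge _ (@cvg_snd _ _ _ _ _)); rewrite ltr_pdivrMr// ltr_pMr ?ltr1n.
  by near: p; apply: (cvgr_le _ (@cvg_snd _ _ _ _ _)); rewrite ltr_pMr ?ltr1n.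
- move=> w _; apply: cvgM; first exact: cvg_cst.
  exact: continuous_moment_kernel.
Unshelve. all: by end_near. Qed.

Lemma is_derive_moment_t i j nu t x : 0 < t -> 0 < x ->
  is_derive t 1 (fun t => moment i j nu t x)
    (moment i.+2 j nu t x / (4 * t ^+ 2)).
Proof.
move=> t0 x0.
have [C C0 hC] := weighted_kernel_bound i.+2 j nu (t * 2) x x0.
have e0 : 0 < t / 2 by rewrite divr_gt0.
have near_t t' : `|t' - t| < t / 2 -> 0 < t' <= t * 2 /\ t / 2 <= t'.
  rewrite ltr_distl => /andP[h1 h2]; split; last lra.
  by apply/andP; split; lra.
rewrite -[X in is_derive _ _ _ X]RintegralZr//; last exact: integrable_weighted_kernel.
apply: (@is_derive_under_integral R _ _ mu2 setT measurableT
  (fun t w => weighted_kernel i j nu t x w)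
  (fun t w => weighted_kernel i.+2 j nu t x w / (4 * t ^+ 2))
  (* For t' >= t / 2 the factor 1 / (4 t'^2) is at most 1 / t^2. *)
  (fun w => t ^- 2 * C * dominating m M w) _ _ e0).
- exact: (integrableZl measurableT _ (integrable_dominating m M)).
- move=> t' /near_t[/andP[t'0 _] _]; exact: integrable_weighted_kernel.
- move=> t' w /near_t[/andP[t'0 _] _] _.
  have h := is_derive_moment_kernel_t a i j nu x w t'0.
  rewrite /weighted_kernel; apply: is_derive_eq.
  by rewrite /GRing.scale /=; field; rewrite gt_eqF.
- move=> t' w /near_t[t'T tt'] _; rewrite normrM mulrC -mulrA.
  apply: ler_pM => //; last by apply: hC; rewrite // lexx.
  rewrite ger0_norm; last by rewrite invr_ge0 mulr_ge0 ?sqr_ge0.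
  have t'0 : 0 < t' by case/andP: t'T.
  rewrite lef_pV2 ?posrE ?mulr_gt0 ?exprn_gt0//.
  have : 0 <= (t' - t / 2) * (t' + t / 2).
    by rewrite mulr_ge0 ?subr_ge0// addr_ge0 ?(ltW e0)// ltW.
  lra.
Qed.

Lemma is_derive_moment_x i j nu t x : 0 < t -> 0 < x ->
  is_derive x 1 (fun x => moment i j nu t x)
    (x^-1 * (i%:R * moment i.-1 j nu t x - moment i.+1 j nu t x / (2 * t))
     - a ^+ 2 * x / 2 * moment i j.+1 nu.+1 t x).
Proof.
move=> t0 x0.
have e0 : 0 < x / 2 by rewrite divr_gt0.
have tt : 0 < t <= t by rewrite t0 lexx.
have [C1 C10 hC1] := weighted_kernel_bound i.-1 j nu t (x * 2) e0.
have [C2 C20 hC2] := weighted_kernel_bound i.+1 j nu t (x * 2) e0.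
have [C3 C30 hC3] := weighted_kernel_bound i j.+1 nu.+1 t (x * 2) e0.
have near_x x' : `|x' - x| < x / 2 -> [/\ 0 < x', x / 2 <= x' <= x * 2 & x' <= x * 2].
  rewrite ltr_distl => /andP[h1 h2]; split; [lra| |lra].
  by apply/andP; split; lra.
have -> : x^-1 * (i%:R * moment i.-1 j nu t x - moment i.+1 j nu t x / (2 * t))
     - a ^+ 2 * x / 2 * moment i j.+1 nu.+1 t x =
  \int[mu2]_w (x^-1 * (i%:R * weighted_kernel i.-1 j nu t x w
      - weighted_kernel i.+1 j nu t x w / (2 * t))
     - a ^+ 2 * x / 2 * weighted_kernel i j.+1 nu.+1 t x w).
  have H i' j' nu' := integrable_weighted_kernel i' j' nu' t0 x0.
  have Z (k : R) f : mu2.-integrable setT (EFin \o f) ->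
    mu2.-integrable setT (EFin \o (fun w => k * f w)).
    by move=> hf; exact: (integrableZl measurableT k hf).
  have Zr (k : R) f : mu2.-integrable setT (EFin \o f) ->
    mu2.-integrable setT (EFin \o (fun w => f w * k)).
    by move=> hf; exact: (integrableZr measurableT k hf).
  have B f g : mu2.-integrable setT (EFin \o f) -> mu2.-integrable setT (EFin \o g) ->
    mu2.-integrable setT (EFin \o (fun w => f w - g w)).
    by move=> hf hg; exact: (integrableB measurableT hf hg).
  rewrite RintegralB ?RintegralZl ?RintegralB ?RintegralZl ?RintegralZr//;
    first [exact: (H _ _ _) | exact: (Z _ _ (H _ _ _)) | exact: (Zr _ _ (H _ _ _))
      | exact: (B _ _ (Z _ _ (H _ _ _)) (Zr _ _ (H _ _ _)))
      | exact: (Z _ _ (B _ _ (Z _ _ (H _ _ _)) (Zr _ _ (H _ _ _)))) ].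
(* On the window x / 2 <= x' <= 2 x the coefficient 1 / x' is largest at the left end and a^2 x' / 2
   at the right end. *)
set D := (x / 2)^-1 * (i%:R * C1 + C2 / (2 * t)) + a ^+ 2 * (x * 2) / 2 * C3.
apply: (@is_derive_under_integral R _ _ mu2 setT measurableT
  (fun x w => weighted_kernel i j nu t x w)
  (fun x w => x^-1 * (i%:R * weighted_kernel i.-1 j nu t x w
      - weighted_kernel i.+1 j nu t x w / (2 * t))
     - a ^+ 2 * x / 2 * weighted_kernel i j.+1 nu.+1 t x w)
  (fun w => D * dominating m M w) _ _ e0).
- exact: (integrableZl measurableT _ (integrable_dominating m M)).
- by move=> x' /near_x[x'0 _ _]; exact: integrable_weighted_kernel.
- move=> x' w /near_x[x'0 _ _] _.
  have h := is_derive_moment_kernel_x a i j nu w t0 x'0.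
  rewrite /weighted_kernel; apply: is_derive_eq.
  by rewrite /GRing.scale /=; field; rewrite !gt_eqF.
- move=> x' w /near_x[x'0 x'I x'2] _; rewrite /D [leRHS]mulrDl.
  have d0 := dominating_ge0 m M w.
  apply: (le_trans (ler_normB _ _)); rewrite lerD//.
    rewrite normrM -mulrA; apply: ler_pM => //.
      rewrite ger0_norm; last by rewrite invr_ge0 ltW.
      by rewrite lef_pV2 ?posrE//; case/andP: x'I.
    rewrite [leRHS]mulrDl; apply: (le_trans (ler_normB _ _)); rewrite lerD//.
      by rewrite normrM normr_nat -mulrA ler_wpM2l// hC1.
    rewrite normrM mulrAC (ger0_norm (_ : 0 <= (2 * t)^-1)); last first.
      by rewrite invr_ge0 mulr_ge0 // ltW.
    by rewrite ler_wpM2r ?invr_ge0 ?mulr_ge0 ?(ltW t0)// hC2.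
  rewrite normrM -[X in _ <= X]mulrA; apply: ler_pM => //; last by rewrite hC3.
  rewrite ger0_norm; last by rewrite divr_ge0 // mulr_ge0 ?sqr_ge0 // ltW.
  by rewrite ler_wpM2r// ler_wpM2l// sqr_ge0.
Qed.

End moments.

(** * The fundamental theorem of calculus on a half-line *)

Section integral_half_line.
Context {R : realType}.
Notation mu := (@lebesgue_measure R).

Lemma integrable_expRN (C : R) :
  mu.-integrable `[0, +oo[ (EFin \o (fun r => C * expR (- r))).
Proof.
suff h : mu.-integrable `[0, +oo[ (EFin \o (fun r : R => expR (- r))).
  by apply: (integrableZl _ C h); exact: measurable_itv.
apply/integrableP; split.
  by apply/measurable_EFinP; apply: measurable_funTS; apply: measurableT_comp.
rewrite (eq_integral (fun r : measurableTypeR R => (expR (- r))%:E)).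
  by rewrite integral_expRN ltry.
by move=> r _; rewrite /= ger0_norm ?expR_ge0.
Qed.

(** For a nonnegative integrand the fundamental theorem applies directly. Adding C e^(-r) to [f],
    and - C e^(-r) to its primitive, makes the integrand nonnegative; the added integral is C and is
    subtracted at the end. *)
Lemma integral_derive_half_line (F f : R -> R) (C : R) :
  (forall r : R, is_derive r 1 F (f r)) -> continuous f ->
  (forall r, 0 <= r -> `|f r| <= C * expR (- r)) ->
  (forall r, 0 <= r -> `|F r| <= C * expR (- r)) ->
  (\int[mu]_(r in `[0%R, +oo[) (f r)%:E = (- F 0)%:E)%E.
Proof.
move=> dF cf hf hF.
have mf : measurable_fun (`[0, +oo[ : set R) f.
  by apply: measurable_funTS; exact: continuous_measurable_fun.
have iC := integrable_expRN C.
have if_ : mu.-integrable `[0, +oo[ (EFin \o f).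
  apply: (@integrable_dominated _ _ _ mu _ _ f _ _ iC) => //.
  move=> r /=.
  by rewrite in_itv /= andbT; exact: hf.
have dG (r : R) : is_derive r 1 (fun r => F r - C * expR (- r)) (f r + C * expR (- r)).
  have h := is_derive_expRN r; have h2 := dF r.
  by apply: is_derive_eq; rewrite /GRing.scale /=; ring.
have eC : (\int[mu]_(r in `[0%R, +oo[) (C * expR (- r))%:E = C%:E)%E.
  under eq_integral do rewrite EFinM.
  rewrite integralZl//; first by rewrite integral_expRN mule1.
  apply: eq_integrable (integrable_expRN 1) => // r _ /=.
  by rewrite mul1r.
have cE : expR (- r) @[r --> +oo] --> (0 : R) by exact: cvgr_expR.
have cCE : C * expR (- r) @[r --> +oo] --> (0 : R).
  by rewrite -(mulr0 C); apply: cvgM => //; exact: cvg_cst.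
have F0 : F r @[r --> +oo] --> (0 : R).
  apply: norm_cvg0.
  apply: (@squeeze_cvgr _ _ _ _ (cst 0) (fun r => C * expR (- r))) => //; last first.
    exact: cvg_cst.
  near=> r; rewrite normr_ge0 hF//=; near: r; exact: nbhs_pinfty_ge.
have e : (\int[mu]_(r in `[0%R, +oo[) (f r + C * expR (- r))%:E =
    (C - F 0)%:E)%E.
  rewrite (@ge0_continuous_FTC2y _ _ (fun r => F r - C * expR (- r)) 0 0).
  - by rewrite oppr0 expR0 mulr1 -EFinB sub0r opprB.
  - by move=> r r0; have := hf r r0; rewrite ler_norml; lra.
  - apply: continuous_subspaceT => r; apply: cvgD; first exact: cf.
    apply: cvgM; first exact: cvg_cst.
    exact: is_derive_continuous (is_derive_expRN r).
  - by rewrite -[X in _ --> X](subr0 0); exact: cvgB.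
  - by move=> x _; have [] := dG x.
  - by apply: cvg_at_right_filter; exact: is_derive_continuous (dG 0).
  - by move=> x _; rewrite derive1E; have [_ ->] := dG x.
have := integralD_EFin _ if_ iC.
rewrite /= e eC => /(_ (measurable_itv _)) h.
have fin : (\int[mu]_(r in `[0%R, +oo[) (f r)%:E)%E \is a fin_num.
  exact: integrable_fin_num.
rewrite -(fineK fin) -EFinD in h *; congr EFin.
case: h => h; lra.
Unshelve. all: by end_near. Qed.

End integral_half_line.

(** * The heat equation *)

Section heat_moment.
Context {R : realType}.
Notation mu := (@lebesgue_measure R).
Notation mu2 := (mu \x mu)%E.
Variables (a m M U : R) (u : R -> R).
Hypothesis m0 : 0 < m.
Hypothesis mM : m <= M.
Hypothesis measu : measurable_fun setT u.
Hypothesis uU : forall x, `|u x| <= U.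
Hypothesis u0 : forall x, ~ (m <= x <= M) -> u x = 0.
Implicit Types (i j nu : nat) (t x : R).

Local Notation I := (moment a u).
Local Notation E := (moment_kernel a).
Local Notation W := (weighted_kernel a u).

Lemma continuous_moment_kernel_r i j nu t x x' : 0 < t ->
  continuous (fun r => moment_kernel a i j nu t x (x', r)).
Proof.
by move=> t0 r; exact: is_derive_continuous (is_derive_moment_kernel_r_gen _ _ _ _ _ _ _ t0).
Qed.

(** By Fubini the r-integral is taken first, at fixed x'. The primitive is the (1, 1, 1) kernel,
    whose factor e^r - 1 kills the boundary term at r = 0. *)
Lemma moment_heat_rel t x : 0 < t -> 0 < x ->
  I 0 1 1 t x - I 2 1 1 t x / (2 * t) + I 1 1 1 t x
    - a ^+ 2 * x ^+ 2 / 4 * I 1 2 2 t x + I 1 0 0 t x = 0.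
Proof.
move=> t0 x0.
pose f x' r := E 0 1 1 t x (x', r) - E 2 1 1 t x (x', r) / (2 * t)
     + E 1 1 1 t x (x', r)
     - a ^+ 2 * x ^+ 2 / 4 * E 1 2 2 t x (x', r)
     + E 1 0 0 t x (x', r).
have H i' j' nu' : mu2.-integrable setT (EFin \o W i' j' nu' t x).
  exact: (integrable_weighted_kernel a m0 mM measu uU u0).
have Z (k : R) g : mu2.-integrable setT (EFin \o g) ->
  mu2.-integrable setT (EFin \o (fun w => k * g w)).
  by move=> hf; exact: (integrableZl measurableT k hf).
have Zr (k : R) g : mu2.-integrable setT (EFin \o g) ->
  mu2.-integrable setT (EFin \o (fun w => g w * k)).
  by move=> hf; exact: (integrableZr measurableT k hf).
have D g h : mu2.-integrable setT (EFin \o g) -> mu2.-integrable setT (EFin \o h) ->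
  mu2.-integrable setT (EFin \o (fun w => g w + h w)).
  by move=> hf hg; exact: (integrableD measurableT hf hg).
have B g h : mu2.-integrable setT (EFin \o g) -> mu2.-integrable setT (EFin \o h) ->
  mu2.-integrable setT (EFin \o (fun w => g w - h w)).
  by move=> hf hg; exact: (integrableB measurableT hf hg).
have I1 := B _ _ (H 0 1 1)%N (Zr (2 * t)^-1 _ (H 2 1 1)%N).
have I2 := D _ _ I1 (H 1 1 1)%N.
have Z3 := Z (a ^+ 2 * x ^+ 2 / 4) _ (H 1 2 2)%N.
have I3 := B _ _ I2 Z3.
have I4 := D _ _ I3 (H 1 0 0)%N.
rewrite /moment; suff : \int[mu2]_w (W 0 1 1 t x w - W 2 1 1 t x w / (2 * t) + W 1 1 1 t x w
      - a ^+ 2 * x ^+ 2 / 4 * W 1 2 2 t x w + W 1 0 0 t x w) = 0.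
  have I5 := Zr (2 * t)^-1 _ (H 2 1 1)%N.
  by rewrite RintegralD// RintegralB// RintegralD// RintegralB// RintegralZr//
    RintegralZl.
rewrite /Rintegral -(integral12_prod_meas1 I4) integral0_eq// => x' _.
rewrite /fubini_F /=.
have -> : (\int[mu]_y (W 0 1 1 t x (x', y) - W 2 1 1 t x (x', y) / (2 * t) + W 1 1 1 t x (x', y)
      - a ^+ 2 * x ^+ 2 / 4 * W 1 2 2 t x (x', y) + W 1 0 0 t x (x', y))%:E)%E =
    (\int[mu]_(y in `[0%R, +oo[) (u x' * f x' y)%:E)%E.
  rewrite [RHS]integral_mkcond; apply: eq_integral => y _.
  rewrite patchE /weighted_kernel /f /= indicE; case: ifPn => _.
    by rewrite !mulr1; congr EFin; ring.
  by rewrite /= !(mulr0, mul0r, subr0, addr0).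
have [xI|xI] := pselect (m <= x' <= M); last first.
  by rewrite u0//; apply: integral0_eq => y _; rewrite mul0r.
have tt : 0 < t <= t by rewrite t0 lexx.
have x'0 : 0 < x' <= M.
  by case/andP: xI => mx ->; rewrite (lt_le_trans m0).
have M0 : 0 < M by case/andP: x'0; exact: lt_le_trans.
pose c := `|ln x - ln x'|.
have bnd i j nu : exists2 C : R, 0 <= C &
    forall r, 0 <= r -> `|E i j nu t x (x', r)| <= C * expR (- r).
  have [C hC] := moment_kernel_bound a i j nu t c M0.
  exists `|C| => // r r0; apply: le_trans (hC _ _ (x', r) tt x'0 (lexx _) r0) _.
  by rewrite ler_wpM2r ?expR_ge0// ler_norm.
have [C1 C10 hC1] := bnd 0%N 1%N 1%N.
have [C2 C20 hC2] := bnd 2%N 1%N 1%N.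
have [C3 C30 hC3] := bnd 1%N 1%N 1%N.
have [C4 C40 hC4] := bnd 1%N 2%N 2%N.
have [C5 C50 hC5] := bnd 1%N 0%N 0%N.
have t20 : 0 <= (2 * t)^-1 by rewrite invr_ge0 mulr_ge0// ltW.
have k0 : 0 <= a ^+ 2 * x ^+ 2 / 4 by rewrite divr_ge0// mulr_ge0 ?sqr_ge0.
(* One constant must serve for the primitive, bounded by [C3], and for its derivative, bounded by
   the sum of all five contributions. *)
pose C := C3 + (C1 + C2 / (2 * t) + a ^+ 2 * x ^+ 2 / 4 * C4 + C5).
have CC3 : C3 <= C.
  by rewrite /C lerDl !addr_ge0// mulr_ge0.
have dF (r : R) : is_derive r 1 (fun r => u x' * E 1 1 1 t x (x', r)) (u x' * f x' r).
  have h := is_derive_moment_kernel_r a x x' r t0.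
  by apply: is_derive_eq.
have cf : continuous (fun r => u x' * f x' r).
  have cE i j nu := @continuous_moment_kernel_r i j nu t x x' t0.
  move=> r; apply: cvgM; first exact: cvg_cst.
  apply: cvgD; last exact: cE.
  apply: cvgB; last by apply: cvgM; [exact: cvg_cst|exact: cE].
  apply: cvgD; last exact: cE.
  by apply: cvgB; [exact: cE|apply: cvgM; [exact: cE|exact: cvg_cst]].
rewrite (integral_derive_half_line dF cf (C := `|u x'| * C)).
- by rewrite /moment_kernel expR0 subrr expr1 !(mulr0, mul0r) oppr0.
- move=> r r0; rewrite normrM -mulrA ler_wpM2l// /f.
  set e := expR (- r).
  have -> : C * e = C1 * e + C2 * e / (2 * t) + C3 * e
      + a ^+ 2 * x ^+ 2 / 4 * (C4 * e) + C5 * e by rewrite /C; ring.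
  apply: le_trans (ler_normD _ _) _; rewrite lerD ?hC5//.
  apply: le_trans (ler_normB _ _) _; rewrite lerD//; last first.
    by rewrite normrM (ger0_norm k0) ler_wpM2l// hC4.
  apply: le_trans (ler_normD _ _) _; rewrite lerD ?hC3//.
  apply: le_trans (ler_normB _ _) _; rewrite lerD ?hC1//.
  by rewrite normrM (ger0_norm t20) ler_wpM2r// hC2.
- move=> r r0; rewrite normrM -mulrA ler_wpM2l//.
  by apply: le_trans (hC3 _ r0) _; rewrite ler_wpM2r ?expR_ge0.
Qed.

Definition heat_const t : R := 1 / (4 * Num.sqrt pi * t `^ (3 / 2)).

Lemma is_derive_heat_const t : 0 < t ->
  is_derive t 1 heat_const (- (3 / (2 * t)) * heat_const t).
Proof.
move=> t0; have h := is_derive1_powR (3 / 2) t0.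
have p0 : t `^ (3 / 2) != 0 by rewrite gt_eqF// powR_gt0.
have s0 : Num.sqrt pi != 0 :> R by rewrite gt_eqF// sqrtr_gt0 pi_gt0.
have d0 : 4 * Num.sqrt pi * t `^ (3 / 2) != 0 by rewrite !mulf_neq0.
have hV : is_derive t 1 (fun t => (4 * Num.sqrt pi * t `^ (3 / 2))^-1)
    (- (4 * Num.sqrt pi * t `^ (3 / 2)) ^- 2 *
      (4 * Num.sqrt pi * (3 / 2 * t `^ (3 / 2 - 1)))).
  exact: (is_deriveV (f := fun t => 4 * Num.sqrt pi * t `^ (3 / 2)) d0).
have e : t `^ (3 / 2 - 1) = t `^ (3 / 2) / t.
  by rewrite powRB ?powRr1 ?ltW//; apply/implyP => _; rewrite gt_eqF.
rewrite /heat_const; apply: is_derive_eq; rewrite /GRing.scale /= e.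
by field; rewrite s0 p0 gt_eqF.
Qed.

Definition heat_moment t x := heat_const t * I 1 0 0 t x.

Definition heat_moment_t t x :=
  heat_const t * (I 3 0 0 t x / (4 * t ^+ 2) - 3 / (2 * t) * I 1 0 0 t x).

Definition heat_moment_x t x :=
  heat_const t * (x^-1 * (I 0 0 0 t x - I 2 0 0 t x / (2 * t))
                  - a ^+ 2 * x / 2 * I 1 1 1 t x).

(** [dI0], [dI2] and [dI1] are the x-derivatives of the moments (0, 0, 0), (2, 0, 0) and (1, 1, 1)
    that occur in [heat_moment_x]. *)
Definition heat_moment_xx t x :=
  let b := a ^+ 2 * x / 2 in
  let dI0 := x^-1 * (- I 1 0 0 t x / (2 * t)) - b * I 0 1 1 t x in
  let dI2 := x^-1 * (2 * I 1 0 0 t x - I 3 0 0 t x / (2 * t)) - b * I 2 1 1 t x in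
  let dI1 := x^-1 * (I 0 1 1 t x - I 2 1 1 t x / (2 * t)) - b * I 1 2 2 t x in
  heat_const t * (- x ^- 2 * (I 0 0 0 t x - I 2 0 0 t x / (2 * t))
    + x^-1 * (dI0 - dI2 / (2 * t)) - a ^+ 2 / 2 * I 1 1 1 t x - b * dI1).

Lemma is_derive_heat_moment_t t x : 0 < t -> 0 < x ->
  is_derive t 1 (fun t => heat_moment t x) (heat_moment_t t x).
Proof.
move=> t0 x0; have h := is_derive_heat_const t0.
have h1 := is_derive_moment_t a m0 mM measu uU u0 1 0 0 t0 x0.
rewrite /heat_moment /heat_moment_t; apply: is_derive_eq.
by rewrite /GRing.scale /=; field; rewrite gt_eqF.
Qed.

Lemma is_derive_heat_moment_x t x : 0 < t -> 0 < x ->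
  is_derive x 1 (heat_moment t) (heat_moment_x t x).
Proof.
move=> t0 x0; have h1 := is_derive_moment_x a m0 mM measu uU u0 1 0 0 t0 x0.
rewrite /heat_moment /heat_moment_x; apply: is_derive_eq.
rewrite /GRing.scale /=.
move: (I 0 0 0 t x) (I 2 0 0 t x) (I 1 1 1 t x) (heat_const t) => i000 i200 i111 k.
by field; rewrite !gt_eqF.
Qed.

Lemma is_derive_heat_moment_xx t x : 0 < t -> 0 < x ->
  is_derive x 1 (heat_moment_x t) (heat_moment_xx t x).
Proof.
move=> t0 x0.
have h0 := is_derive_moment_x a m0 mM measu uU u0 0 0 0 t0 x0.
have h1 := is_derive_moment_x a m0 mM measu uU u0 1 1 1 t0 x0.
have h2 := is_derive_moment_x a m0 mM measu uU u0 2 0 0 t0 x0.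
have hV : is_derive x 1 (fun x : R => x^-1) (- x ^- 2).
  have := @is_deriveV R id x 1 1; rewrite /GRing.scale /= mulr1; apply.
  by rewrite gt_eqF.
rewrite /heat_moment_x /heat_moment_xx /=; apply: is_derive_eq.
rewrite /GRing.scale /=.
move: (I 0 0 0 t x) (I 2 0 0 t x) (I 3 0 0 t x) => i000 i200 i300.
move: (I 0 1 1 t x) (I 2 1 1 t x) (I 1 1 1 t x) => i011 i211 i111.
move: (I 1 2 2 t x) (I 1 0 0 t x) (heat_const t) => i122 i100 k.
by field; rewrite !gt_eqF.
Qed.

(** The two sides differ by exactly - a^2 x^2 times [heat_const t] times the combination that
    vanishes by [moment_heat_rel]; everything else cancels. *)
Lemma heat_moment_eq t x : 0 < t -> 0 < x ->
  x ^+ 2 * heat_moment_xx t x + x * heat_moment_x t x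
    - a ^+ 2 * x ^+ 2 * heat_moment t x = heat_moment_t t x.
Proof.
move=> t0 x0; have := moment_heat_rel t0 x0.
rewrite /heat_moment_xx /heat_moment_x /heat_moment /heat_moment_t.
move: (I 0 0 0 t x) (I 2 0 0 t x) (I 3 0 0 t x) => i000 i200 i300.
move: (I 0 1 1 t x) (I 2 1 1 t x) (I 1 1 1 t x) => i011 i211 i111.
move: (I 1 2 2 t x) (I 1 0 0 t x) (heat_const t) => i122 i100 c /= h.
have -> : i100 = - (i011 - i211 / (2 * t) + i111 - a ^+ 2 * x ^+ 2 / 4 * i122).
  by lra.
by field; rewrite !gt_eqF.
Qed.

(** Keeps the function as a visible argument, so that continuity goals can be decomposed by matching
    on its body. *)
Definition continuous_at_pair (q : R * R) (f : R * R -> R) : Prop :=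
  {for q, continuous f}.

Lemma continuous_heat_moment :
  [/\ continuous_quadrant heat_moment, continuous_quadrant heat_moment_t,
      continuous_quadrant heat_moment_x & continuous_quadrant heat_moment_xx].
Proof.
have main (t x : R) : 0 < t -> 0 < x ->
  [/\ continuous_at_pair (t, x) (fun p => heat_moment p.1 p.2),
      continuous_at_pair (t, x) (fun p => heat_moment_t p.1 p.2),
      continuous_at_pair (t, x) (fun p => heat_moment_x p.1 p.2) &
      continuous_at_pair (t, x) (fun p => heat_moment_xx p.1 p.2)].
  move=> t0 x0.
  have cI i j nu : continuous_at_pair (t, x) (fun p => I i j nu p.1 p.2).
    exact: (continuous_moment m0 mM measu uU u0 t0 x0).
  have c1 : continuous_at_pair (t, x) (fun p => p.1) by exact: cvg_fst.
  have c2 : continuous_at_pair (t, x) (fun p => p.2) by exact: cvg_snd.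
  have cK (k : R) : continuous_at_pair (t, x) (fun _ => k) by exact: cvg_cst.
  have cM (f g : R * R -> R) : continuous_at_pair (t, x) f ->
      continuous_at_pair (t, x) g -> continuous_at_pair (t, x) (fun p => f p * g p).
    by move=> cf cg; exact: cvgM.
  have cD (f g : R * R -> R) : continuous_at_pair (t, x) f ->
      continuous_at_pair (t, x) g -> continuous_at_pair (t, x) (fun p => f p + g p).
    by move=> cf cg; exact: cvgD.
  have cN (f : R * R -> R) : continuous_at_pair (t, x) f ->
      continuous_at_pair (t, x) (fun p => - f p).
    by move=> cf; exact: cvgN.
  have cV (f : R * R -> R) : continuous_at_pair (t, x) f -> f (t, x) != 0 ->
      continuous_at_pair (t, x) (fun p => (f p)^-1).
    by move=> cf f0; exact: cvgV.
  have cX : continuous_at_pair (t, x) (fun p => p.2^-1).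
    by apply: (cV _ c2); rewrite gt_eqF.
  have cX2 : continuous_at_pair (t, x) (fun p => p.2 ^- 2).
    by apply: (cV _ (cM _ _ c2 c2)); rewrite mulf_neq0 ?gt_eqF.
  have cT : continuous_at_pair (t, x) (fun p => (2 * p.1)^-1).
    by apply: (cV _ (cM _ _ (cK 2) c1)); rewrite mulf_neq0 ?gt_eqF.
  have cT2 : continuous_at_pair (t, x) (fun p => (4 * p.1 ^+ 2)^-1).
    apply: (cV _ (cM _ _ (cK 4) (cM _ _ c1 c1))).
    by rewrite !mulf_neq0 ?gt_eqF.
  have cC : continuous_at_pair (t, x) (fun p => heat_const p.1).
    exact: (cvg_comp _ _ c1 (is_derive_continuous (is_derive_heat_const t0))).
  rewrite /heat_moment /heat_moment_t /heat_moment_x /heat_moment_xx.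
  move: (moment a u) heat_const cI cC => J k cI cC.
  split; repeat lazymatch goal with
    | |- continuous_at_pair _ (fun p => (@?f p + @?g p)%R) => apply (cD f g)
    | |- continuous_at_pair _ (fun p => (@?f p * @?g p)%R) => apply (cM f g)
    | |- continuous_at_pair _ (fun p => (- @?f p)%R) => apply (cN f)
    end; first [exact: cI | exact: cC | exact: cX | exact: cX2 | exact: cT
      | exact: cT2 | exact: c2 | exact: cK].
split => t x t0 x0; have [c1 c2 c3 c4] := main t x t0 x0;
  [exact: c1|exact: c2|exact: c3|exact: c4].
Qed.

End heat_moment.

(** * Membership in [C12] from explicit partial derivatives *)

Section C12_intro.
Context {R : realType}.

Lemma near_gt0 (t : R) : 0 < t -> \forall t' \near t, 0 < t'.
Proof. by move=> t0; exact: (cvgr_gt t (@cvg_id _ _)). Qed.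

Lemma near_quadrant (t x : R) : 0 < t -> 0 < x ->
  \forall p \near (t, x), 0 < p.1 /\ 0 < p.2.
Proof.
move=> t0 x0; near=> p; split; near: p.
  by exact: (cvgr_gt t (@cvg_fst _ _ _ _ _)).
by exact: (cvgr_gt x (@cvg_snd _ _ _ _ _)).
Unshelve. all: by end_near. Qed.

Lemma eq_continuous_quadrant (f g : R -> R -> R) :
  (forall t x : R, 0 < t -> 0 < x -> f t x = g t x) ->
  continuous_quadrant f -> continuous_quadrant g.
Proof.
move=> fg cf t x t0 x0; rewrite /prop_for /continuous_at /= -fg//.
apply: cvg_trans (cf t x t0 x0); apply: near_eq_cvg.
by near do rewrite fg//; near=> p; have [] : 0 < p.1 /\ 0 < p.2 by near: p; exact: near_quadrant.
Unshelve. all: by end_near. Qed.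

(** [derive1 (u t)] is known to equal [ux t] only for positive x. This is a neighbourhood of each
    such point, which suffices to transfer the second derivative and the continuity. *)
Lemma C12_intro (u ut ux uxx : R -> R -> R) :
  (forall t x : R, 0 < t -> 0 < x ->
    [/\ is_derive t 1 (fun t' => u t' x) (ut t x), is_derive x 1 (u t) (ux t x) &
        is_derive x 1 (ux t) (uxx t x)]) ->
  continuous_quadrant u -> continuous_quadrant ut -> continuous_quadrant ux ->
  continuous_quadrant uxx ->
  C12 u /\ forall t x : R, 0 < t -> 0 < x ->
    [/\ derive1 (fun t' => u t' x) t = ut t x, derive1 (u t) x = ux t x &
        derive1n 2 (u t) x = uxx t x].
Proof.
move=> d cu cut cux cuxx.
have E1 (t x : R) : 0 < t -> 0 < x -> derive1 (u t) x = ux t x.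
  by move=> t0 x0; rewrite derive1E; have [_ [_ ->] _] := d t x t0 x0.
have D2 (t x : R) : 0 < t -> 0 < x -> is_derive x 1 (derive1 (u t)) (uxx t x).
  move=> t0 x0; have [_ _] := d t x t0 x0; apply: near_eq_is_derive.
  by near=> y; rewrite E1//; near: y; exact: near_gt0.
have E2 (t x : R) : 0 < t -> 0 < x -> derive1n 2 (u t) x = uxx t x.
  move=> t0 x0; rewrite derive1nS derive1E.
  by have [_ e] := D2 t x t0 x0.
have Et (t x : R) : 0 < t -> 0 < x -> derive1 (fun t' => u t' x) t = ut t x.
  by move=> t0 x0; rewrite derive1E; have [[_ ->] _ _] := d t x t0 x0.
split; last by move=> t x t0 x0; split; [exact: Et|exact: E1|exact: E2].
split; last split.
- move=> t x t0 x0; have [[d1 _] [d2 _] _] := d t x t0 x0.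
  by have [d3 _] := D2 t x t0 x0; split; [exact: d1|exact: d2|exact: d3].
- exact: cu.
- by apply: eq_continuous_quadrant cut => t x t0 x0; rewrite Et.
- by apply: eq_continuous_quadrant cux => t x t0 x0; rewrite E1.
- by apply: eq_continuous_quadrant cuxx => t x t0 x0; rewrite E2.
Unshelve. all: by end_near. Qed.

End C12_intro.

(** * The kernel formula *)

Section shift.
Context {R : realType}.
Notation mu := (@lebesgue_measure R).

Lemma ge0_integral_shift (f : R -> R) (c : R) : continuous f -> (forall x, 0 <= f x) ->
  (\int[mu]_(s in `[c, +oo[) (f s)%:E = \int[mu]_(r in `[0%R, +oo[) (f (c + r))%:E)%E.
Proof.
move=> cf f0.
have dF (r : R) : is_derive r 1 (fun r => c + r) 1.
  by apply: is_derive_eq; ring.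
have dF1 : (fun r => c + r)^`() = cst (1 : R).
  by apply/funext => r; rewrite derive1E; have [_ ->] := dF r.
have e0 : c = c + 0 by rewrite addr0.
rewrite {1}e0 (@increasing_ge0_integration_by_substitutiony _ (fun r => c + r) f 0).
- by apply: eq_integral => r _; rewrite !fctE dF1 mulr1.
- by move=> x y _ _; rewrite ltrD2l.
- by rewrite dF1 => x _; exact: cvg_cst.
- by rewrite dF1; exact: is_cvg_cst.
- by rewrite dF1; exact: is_cvg_cst.
- split; first by move=> x _; have [] := dF x.
  by apply: cvg_at_right_filter; exact: is_derive_continuous (dF 0).
- exact: cvg_addrl.
- by apply: continuous_subspaceT.
- by move=> x _; exact: f0.
Qed.

(** No integrability is assumed: the positive and negative parts are continuous and nonnegative, and
    each is shifted separately. *)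
Lemma integral_shift (f : R -> R) (c : R) : continuous f ->
  (\int[mu]_(s in `[c, +oo[) (f s)%:E = \int[mu]_(r in `[0%R, +oo[) (f (c + r))%:E)%E.
Proof.
move=> cf.
have cmax (g : R -> R) : continuous g -> continuous (fun s => Num.max (g s) 0).
  by move=> cg s; apply: continuous_max; [exact: cg|exact: cvg_cst].
have cN : continuous (fun s => - f s) by move=> s; apply: cvgN; exact: cf.
rewrite integralE [RHS]integralE; congr (_ - _)%E.
- have e (g : measurableTypeR R -> R) (D : set (measurableTypeR R)) :
      (\int[mu]_(s in D) (fun s => (g s)%:E)^\+ s =
       \int[mu]_(s in D) (Num.max (g s) 0)%:E)%E.
    by apply: eq_integral => s _; rewrite funeposE EFin_max.
  rewrite !e; apply: (ge0_integral_shift c (cmax _ cf)) => s.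
  by rewrite le_max lexx orbT.
- have e (g : measurableTypeR R -> R) (D : set (measurableTypeR R)) :
      (\int[mu]_(s in D) (fun s => (g s)%:E)^\- s =
       \int[mu]_(s in D) (Num.max (- g s) 0)%:E)%E.
    by apply: eq_integral => s _; rewrite funenegE EFin_max.
  rewrite !e; apply: (ge0_integral_shift c (cmax _ cN)) => s.
  by rewrite le_max lexx orbT.
Qed.

Lemma integrable_shift (f : R -> R) (c : R) : continuous f ->
  mu.-integrable `[0, +oo[ (EFin \o (fun r => f (c + r))) ->
  mu.-integrable `[c, +oo[ (EFin \o f).
Proof.
move=> cf /integrableP[_ h]; apply/integrableP; split.
  apply/measurable_EFinP; apply: measurable_funTS.
  exact: continuous_measurable_fun.
have cn : continuous (fun s => `|f s|).
  by move=> s; apply: cvg_norm; exact: cf.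
by rewrite (ge0_integral_shift c cn).
Qed.

Lemma Rintegral_odd_itv (f : R -> R) (c : R) : continuous f ->
  (forall s, f (- s) = - f s) -> 0 <= c -> \int[mu]_(s in `[- c, c]) f s = 0.
Proof.
move=> cf oddf c0.
have h : - c <= c by rewrite ge0_cp.
have := @integration_by_substitution_oppr _ f (- c) c h (continuous_subspaceT cf).
rewrite opprK => /(congr1 fine); rewrite -![fine _]/(Rintegral mu _ _).
rewrite (_ : f \o -%R = (fun s => -1 * f s)); last first.
  by apply/funext => s; rewrite /= oddf mulN1r.
rewrite RintegralZl//; last first.
  by apply: continuous_compact_integrable; [exact: segment_compact|exact: continuous_subspaceT].
rewrite mulN1r /Rintegral; lra.
Qed.

(** For c < 0 the two half-lines differ by the symmetric segment from c to - c, up to an endpoint,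
    and an odd function integrates to 0 there. This is how the absolute value leaves the endpoint
    |ln x - ln x'|. *)
Lemma Rintegral_odd_half_line (f : R -> R) (c : R) : continuous f ->
  (forall s, f (- s) = - f s) ->
  mu.-integrable `[c, +oo[ (EFin \o f) ->
  \int[mu]_(s in `[`|c|, +oo[) f s = \int[mu]_(s in `[c, +oo[) f s.
Proof.
move=> cf oddf if_; have [c0|c0] := leP 0 c; first by rewrite ger0_norm.
rewrite ltr0_norm//.
have cc : c <= - c by lra.
have := @Rintegral_itvB _ f (BLeft c) +oo%O (- c) if_.
rewrite !bnd_simp => /(_ cc isT).
rewrite -{2}(opprK c) Rintegral_odd_itv// ?subr0; last by lra.
move=> ->; rewrite Rintegral_itv_obnd_cbnd//.
apply: integrableS if_ => //; apply: subset_itvr; rewrite bnd_simp; lra.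
Qed.

End shift.

(** * The kernel as an integral over a half-line *)

Section kernel_formula.
Context {R : realType}.
Notation mu := (@lebesgue_measure R).
Implicit Types (a t x : R).

(** The square of the argument of J_0 without the half angle; in this form it is visibly even in
    s. *)
Definition kernel_arg a x x' s : R :=
  a ^+ 2 * (x * x' * (expR s + expR (- s)) - x ^+ 2 - x' ^+ 2).

Definition kernel_integrand a t x x' s : R :=
  s * expR (- (s ^+ 2 / (4 * t))) * bessel_clifford 0 (kernel_arg a x x' s).

Lemma ltr_expR_add_expRN (p q : R) : 0 <= p -> p < q ->
  expR p + expR (- p) < expR q + expR (- q).
Proof.
move=> p0 pq; rewrite !expRN.
have p1 : 1 <= expR p by rewrite -expR0 ler_expR.
have pq' : expR p < expR q by rewrite ltr_expR.
have q0 := expR_gt0 q; have p0' := expR_gt0 p.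
rewrite -subr_gt0.
have -> : expR q + (expR q)^-1 - (expR p + (expR p)^-1) =
  (expR q - expR p) * (expR p * expR q - 1) / (expR p * expR q).
  by field; rewrite !gt_eqF.
rewrite divr_gt0 ?mulr_gt0 ?subr_gt0//.
by rewrite (lt_le_trans (le_lt_trans p1 pq'))// ler_peMl// ltW.
Qed.

Lemma ler_expR_add_expRN (p q : R) : 0 <= q ->
  (expR p + expR (- p) <= expR q + expR (- q)) = (`|p| <= q).
Proof.
move=> q0.
have -> : expR p + expR (- p) = expR `|p| + expR (- `|p|).
  have [p0|p0] := leP 0 p; first by rewrite ger0_norm.
  by rewrite ltr0_norm// opprK addrC.
apply/idP/idP => [h|].
  by rewrite leNgt; apply/negP => /(ltr_expR_add_expRN q0); rewrite ltNge h.
rewrite le_eqVlt => /predU1P[->//|pq].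
by apply/ltW/ltr_expR_add_expRN.
Qed.

Lemma sqr_cosh_half s : 4 * cosh (s / 2) ^+ 2 = expR s + expR (- s) + 2 :> R.
Proof.
have h (z : R) : expR z = expR (z / 2) ^+ 2.
  by rewrite -expRM_natl; congr expR; field.
rewrite /cosh (h s) (h (- s)) mulNr expRN.
by field; rewrite gt_eqF ?expR_gt0.
Qed.

(** Multiplied by 4, the left side is x / x' + x' / x + 2 and the right side e^s + e^(-s) + 2. So
    the values of cosh at ln x - ln x' and at s are compared, and cosh is even and increasing on s
    >= 0. *)
Lemma kernel_domain x x' s : 0 < x -> 0 < x' -> 0 <= s ->
  ((x + x') ^+ 2 / (4 * x * x') <= cosh (s / 2) ^+ 2) = (`|ln x - ln x'| <= s).
Proof.
move=> x0 x'0 s0; rewrite -(ler_expR_add_expRN _ s0).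
rewrite opprB !expRB !lnK ?posrE//.
rewrite -(ler_pM2l (_ : 0 < 4 :> R))// sqr_cosh_half.
have -> : 4 * ((x + x') ^+ 2 / (4 * x * x')) = x / x' + x' / x + 2.
  by field; rewrite !gt_eqF.
by rewrite lerD2r.
Qed.

Lemma kernel_argE a x x' s : kernel_arg a x x' s =
  a ^+ 2 * (4 * x * x' * cosh (s / 2) ^+ 2 - (x + x') ^+ 2).
Proof.
have -> : 4 * x * x' * cosh (s / 2) ^+ 2 = x * x' * (4 * cosh (s / 2) ^+ 2) by ring.
by rewrite sqr_cosh_half /kernel_arg; ring.
Qed.

Lemma kernel_arg_ge0 a x x' s : 0 < x -> 0 < x' -> `|ln x - ln x'| <= s ->
  0 <= kernel_arg a x x' s.
Proof.
move=> x0 x'0 hs; have s0 : 0 <= s by exact: le_trans hs.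
rewrite kernel_argE mulr_ge0 ?sqr_ge0// subr_ge0.
have := hs; rewrite -(kernel_domain x0 x'0 s0) ler_pdivrMr ?mulr_gt0//.
by rewrite mulrC.
Qed.

Lemma continuous_kernel_integrand a t x x' : continuous (kernel_integrand a t x x').
Proof.
move=> s; apply: cvgM.
  apply: cvgM; first exact: cvg_id.
  apply: continuous_comp; last exact: continuous_expR.
  apply: cvgN; apply: cvgM; last exact: cvg_cst.
  exact: exprn_continuous.
apply: continuous_comp; last exact: continuous_bessel_clifford.
apply: cvgM; first exact: cvg_cst.
apply: cvgB; last exact: cvg_cst.
apply: cvgB; last exact: cvg_cst.
apply: cvgM; first exact: cvg_cst.
apply: cvgD; first exact: continuous_expR.
exact: is_derive_continuous (is_derive_expRN s).
Qed.

(** The constraint s > 0 alters the half-line s >= |ln x - ln x'| only for x = x', and then by a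
    null set. On the domain the radicand is nonnegative, so squaring undoes the root. *)
Lemma heat_kernelE a t x x' : 0 < x -> 0 < x' ->
  heat_kernel a t x x' = heat_const t *
    \int[mu]_(s in `[`|ln x - ln x'|, +oo[) kernel_integrand a t x x' s.
Proof.
move=> x0 x'0; rewrite /heat_kernel -/(heat_const t); congr (_ * _).
set S := [set s : R | _].
set eta := `|ln x - ln x'|.
have SE : S = `]0, +oo[ `&` `[eta, +oo[.
  apply/seteqP; split => s /=; rewrite !in_itv /= !andbT => -[s0 h]; split => //.
    by rewrite /eta -kernel_domain// ltW.
  by rewrite kernel_domain// ltW.
transitivity (\int[mu]_(s in S) kernel_integrand a t x x' s).
  apply: eq_Rintegral => s; rewrite inE => -[s0 h].
  rewrite /kernel_integrand besselJ0E kernel_argE exprMn real_normK ?num_real//.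
  rewrite sqr_sqrtr// subr_ge0.
  by move: h; rewrite ler_pdivrMr ?mulr_gt0// mulrC.
have mk (D : set (measurableTypeR R)) :
    measurable_fun D (EFin \o kernel_integrand a t x x').
  apply/measurable_EFinP; apply: measurable_funTS.
  by apply: continuous_measurable_fun; exact: continuous_kernel_integrand.
have : 0 <= eta by exact: normr_ge0.
rewrite le_eqVlt => /predU1P[eta0|eta0].
  rewrite SE -eta0 (_ : _ `&` _ = `]0, +oo[%classic); last first.
    by apply/setIidPl; apply: subset_itvr; rewrite bnd_simp.
  by rewrite /Rintegral integral_itv_obnd_cbnd; last exact: mk.
congr Rintegral; rewrite SE; apply/setIidPr; apply: subset_itvr.
by rewrite bnd_simp.
Qed.

Lemma moment_kernel_integrand a t x x' r : 0 < x -> 0 < x' ->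
  moment_kernel a 1 0 0 t x (x', r) = kernel_integrand a t x x' (ln x - ln x' + r).
Proof.
move=> x0 x'0; rewrite /moment_kernel /kernel_integrand /shifted_s expr0 expr1 mulr1.
congr (_ * bessel_clifford 0 _); rewrite /bessel_arg /kernel_arg /= opprD opprB.
rewrite !expRD !expRN !lnK ?posrE//.
by field; rewrite !gt_eqF// expR_gt0.
Qed.

Lemma integrable_moment_kernel_r a i j nu t x x' : 0 < t -> 0 < x' ->
  mu.-integrable `[0, +oo[ (EFin \o (fun r => moment_kernel a i j nu t x (x', r))).
Proof.
move=> t0 x'0.
have [C hC] := moment_kernel_bound a i j nu t `|ln x - ln x'| x'0.
apply: (@integrable_dominated _ _ _ mu _ _ _ _ _ (integrable_expRN C)) => //.
  apply: measurable_funTS; apply: continuous_measurable_fun.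
  exact: continuous_moment_kernel_r.
move=> r /=; rewrite in_itv /= andbT => r0.
by apply: (hC t x (x', r)) => //=; rewrite ?t0 ?x'0 /=.
Qed.

Lemma kernel_integrand_half_line a t x x' : 0 < t -> 0 < x -> 0 < x' ->
  mu.-integrable `[`|ln x - ln x'|, +oo[ (EFin \o kernel_integrand a t x x') /\
  \int[mu]_(s in `[`|ln x - ln x'|, +oo[) kernel_integrand a t x x' s =
  \int[mu]_(r in `[0, +oo[) moment_kernel a 1 0 0 t x (x', r).
Proof.
move=> t0 x0 x'0; have cf := @continuous_kernel_integrand a t x x'.
set eta := ln x - ln x'.
have e : (fun r => moment_kernel a 1 0 0 t x (x', r)) =
    (fun r => kernel_integrand a t x x' (eta + r)).
  by apply/funext => r; exact: moment_kernel_integrand.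
have h : mu.-integrable `[eta, +oo[ (EFin \o kernel_integrand a t x x').
  apply: (integrable_shift cf); rewrite -e; exact: integrable_moment_kernel_r.
split.
  apply: integrableS h => //; apply: subset_itvr.
  by rewrite bnd_simp ler_norm.
rewrite Rintegral_odd_half_line//; last first.
  by move=> s; rewrite /kernel_integrand /kernel_arg sqrrN opprK (addrC (expR (- s))) !mulNr.
by rewrite e /Rintegral (integral_shift eta cf).
Qed.

End kernel_formula.

(** * The solution formula as a double integral *)

Section heat_formula.
Context {R : realType}.
Notation mu := (@lebesgue_measure R).
Notation mu2 := (mu \x mu)%E.

(** The prescribed interior point [x] is for the initial condition, which is proved strictly inside
    [m, M]. *)
Lemma compact_pos_bounds (K : set R) (x : R) : compact K -> K `<=` `]0, +oo[ ->
  0 < x -> exists m M : R, [/\ 0 < m, m < x, x < M & K `<=` `[m, M]].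
Proof.
move=> cK K0 x0.
have [[k Kk]|Ke] := pselect (exists k, K k); last first.
  exists (x / 2), (x * 2); split; [lra|lra|lra|].
  by move=> k Kk; exfalso; apply: Ke; exists k.
have cid : {within K, continuous (@id R)} by apply: continuous_subspaceT => y; exact: cvg_id.
have K_neq0 : K !=set0 by exists k.
have [p Kp hp] := compact_EVT_min K_neq0 cK cid.
have [q Kq hq] := compact_EVT_max K_neq0 cK cid.
have p0 : 0 < p by move: Kp; rewrite inE => /K0; rewrite /= in_itv /= andbT.
exists (Num.min p x / 2), (Num.max q x + 1).
have mp : Num.min p x <= p by rewrite ge_min lexx.
have mx : Num.min p x <= x by rewrite ge_min lexx orbT.
have qM : q <= Num.max q x by rewrite le_max lexx.
have xM : x <= Num.max q x by rewrite le_max lexx orbT.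
have mn0 : 0 < Num.min p x by rewrite lt_min p0.
split; [lra|lra|lra|] => y Ky; rewrite /= in_itv /=.
have := hp y (mem_set Ky); have := hq y (mem_set Ky) => /= h1 h2.
by apply/andP; split; lra.
Qed.

Variables (a m M : R) (f : R -> R).
Hypothesis m0 : 0 < m.
Hypothesis mM : m < M.
Hypothesis f0 : forall x, 0 < x -> ~ (m <= x <= M) -> f x = 0.
Hypothesis cf : forall x, 0 < x -> {for x, continuous f}.

(** Carries the density 1 / x' of the measure. Cutting to [m, M] discards the arbitrary values of
    [f] off the positive axis and makes the weight bounded and measurable on the whole line. *)
Definition log_weight : R -> R := (fun x => f x / x) \_ `[m, M].

Lemma continuous_div_id x : 0 < x -> {for x, continuous (fun x => f x / x)}.
Proof.
move=> x0; apply: cvgM; first exact: cf.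
by apply: cvgV; [rewrite gt_eqF|exact: cvg_id].
Qed.

Lemma measurable_log_weight : measurable_fun setT log_weight.
Proof.
apply/(measurable_restrictT _ _).1 => //.
apply: subspace_continuous_measurable_fun => //.
apply: continuous_in_subspaceT => x; rewrite inE /= in_itv /= => /andP[mx _].
by apply: continuous_div_id; exact: lt_le_trans mx.
Qed.

Lemma log_weight_bounded : exists U : R, forall x, `|log_weight x| <= U.
Proof.
have [|c _ hc] := @EVT_max R (fun x => `|f x / x|) m M (ltW mM).
  apply: continuous_in_subspaceT => x; rewrite inE /= in_itv /= => /andP[mx _].
  by apply: cvg_norm; apply: continuous_div_id; exact: lt_le_trans mx.
exists `|f c / c| => x; rewrite /log_weight patchE.
by case: ifPn => [|_]; rewrite ?inE ?normr0// => /hc.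
Qed.

Lemma log_weight0 x : ~ (m <= x <= M) -> log_weight x = 0.
Proof.
by move=> h; rewrite /log_weight patchE; case: ifPn => //; rewrite inE /= in_itv.
Qed.

Lemma log_weightE x : m <= x <= M -> log_weight x = f x / x.
Proof.
move=> h; rewrite /log_weight patchE; case: ifPn => //.
by rewrite notin_setE /= in_itv /= h.
Qed.

Lemma integral_weighted_kernel t x x' : 0 < t -> 0 < x ->
  (\int[mu]_r (weighted_kernel a log_weight 1 0 0 t x (x', r))%:E =
   (log_weight x' * \int[mu]_(r in `[0%R, +oo[) moment_kernel a 1 0 0 t x (x', r))%:E)%E.
Proof.
move=> t0 x0.
have [xI|xI] := pselect (m <= x' <= M); last first.
  rewrite log_weight0// mul0r integral0_eq// => r _.
  by rewrite /weighted_kernel /= log_weight0// !mul0r.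
have x'0 : 0 < x' by case/andP: xI => mx _; exact: lt_le_trans mx.
have h := @integrable_moment_kernel_r _ a 1 0 0 t x x' t0 x'0.
rewrite EFinM /Rintegral fineK; last exact: integrable_fin_num.
rewrite -integralZl// integral_mkcond; apply: eq_integral => r _.
rewrite patchE /weighted_kernel /= indicE -EFinM; case: ifPn => _.
  by rewrite mulr1.
by rewrite mulr0 mul0r.
Qed.

(** For each x' in the support the kernel is an inner r-integral, so Fubini yields both the double
    integral and the measurability and integrability in x', which the definition of the kernel does
    not show. *)
Lemma heat_formula_moment t x : 0 < t -> 0 < x ->
  [/\ mu.-integrable setT (EFin \o (fun x' => heat_kernel a t x x' * log_weight x')),
   heat_formula a f t x = \int[mu]_x' (heat_kernel a t x x' * log_weight x') &
   heat_formula a f t x = heat_moment a log_weight t x].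
Proof.
move=> t0 x0; have [U hU] := log_weight_bounded.
have iW := integrable_weighted_kernel a m0 (ltW mM) measurable_log_weight hU
  log_weight0 1 0 0 t0 x0.
pose g x' := log_weight x' *
  \int[mu]_(r in `[0%R, +oo[) moment_kernel a 1 0 0 t x (x', r).
have ig : mu.-integrable setT (EFin \o g).
  apply: eq_integrable (integrable_fubini_F iW) => // x' _.
  by rewrite /fubini_F /= integral_weighted_kernel.
have gE x' : heat_kernel a t x x' * log_weight x' = heat_const t * g x'.
  have [xI|xI] := pselect (m <= x' <= M); last first.
    by rewrite /g log_weight0// !(mul0r, mulr0).
  have x'0 : 0 < x' by case/andP: xI => mx _; exact: lt_le_trans mx.
  rewrite heat_kernelE//.
  by have [_ ->] := kernel_integrand_half_line a t0 x0 x'0; rewrite /g; ring.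
have iK : mu.-integrable setT (EFin \o (fun x' => heat_kernel a t x x' * log_weight x')).
  rewrite (_ : (fun x' => _) = (fun x' => heat_const t * g x')); last exact/funext.
  exact: (integrableZl measurableT (heat_const t) ig).
have e : heat_formula a f t x = \int[mu]_x' (heat_kernel a t x x' * log_weight x').
  rewrite /heat_formula Rintegral_mkcond; apply: eq_Rintegral => x' _.
  rewrite patchE; case: ifPn; rewrite ?notin_setE ?inE /= in_itv /= andbT.
    move=> x'0; have [xI|xI] := pselect (m <= x' <= M).
      by rewrite log_weightE// mulrA.
    by rewrite log_weight0// f0// !(mulr0, mul0r).
  move=> /negP; rewrite -leNgt => x'0.
  by rewrite log_weight0 ?mulr0// => /andP[/(lt_le_trans m0)]; rewrite ltNge x'0.
split => //; rewrite e /heat_moment.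
under eq_Rintegral do rewrite gE.
rewrite RintegralZl//; congr (_ * _).
rewrite /moment /Rintegral -(integral12_prod_meas1 iW); congr fine.
by apply: eq_integral => x' _; rewrite /fubini_F /= integral_weighted_kernel.
Qed.

End heat_formula.

(** * The initial condition *)

Section gauss.
Context {R : realType}.
Notation mu := (@lebesgue_measure R).
Implicit Types t y s e : R.

Lemma is_derive_gauss t s : 0 < t ->
  is_derive s 1 (fun s => - (2 * t) * expR (- (s ^+ 2 / (4 * t))))
    (s * expR (- (s ^+ 2 / (4 * t)))).
Proof.
move=> t0.
have h : is_derive s 1 (fun s => - (s ^+ 2 / (4 * t))) (- (s / (2 * t))).
  by apply: is_derive_eq; rewrite /GRing.scale /=; field; rewrite gt_eqF.
have h' := is_derive_expR_comp h.
by apply: is_derive_eq; rewrite /GRing.scale /=; field; rewrite gt_eqF.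
Qed.

Lemma continuous_gauss t : 0 < t -> continuous (fun s => expR (- (s ^+ 2 / (4 * t)))).
Proof.
move=> t0 s; apply: continuous_comp; last exact: continuous_expR.
apply: cvgN; apply: cvgM; last exact: cvg_cst.
exact: exprn_continuous.
Qed.

Lemma continuous_linear_gauss t : 0 < t ->
  continuous (fun s => s * expR (- (s ^+ 2 / (4 * t)))).
Proof.
by move=> t0 s; apply: cvgM; [exact: cvg_id|exact: (continuous_gauss t0)].
Qed.

Lemma integral_linear_gauss t e : 0 < t -> 0 <= e ->
  (\int[mu]_(s in `[e, +oo[) (s * expR (- (s ^+ 2 / (4 * t))))%:E =
    (2 * t * expR (- (e ^+ 2 / (4 * t))))%:E)%E.
Proof.
move=> t0 e0.
have dF s := is_derive_gauss s t0.
rewrite (@ge0_continuous_FTC2y _ _ (fun s => - (2 * t) * expR (- (s ^+ 2 / (4 * t)))) e 0).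
- by rewrite -EFinB sub0r mulNr opprK.
- by move=> s es; rewrite mulr_ge0 ?expR_ge0// (le_trans e0).
- by apply: continuous_subspaceT; exact: continuous_linear_gauss.
- rewrite -(mulr0 (- (2 * t))); apply: cvgM; first exact: cvg_cst.
  apply: (@squeeze_cvgr _ _ _ _ (cst 0) (fun s => expR (- s))).
  + near=> s; rewrite expR_ge0/= ler_expR lerN2.
    have s4 : 4 * t <= s by near: s; apply: nbhs_pinfty_ge; exact: num_real.
    rewrite ler_pdivlMr ?mulr_gt0// expr2 ler_wpM2l//.
  + exact: cvg_cst.
  + exact: cvgr_expR.
- by move=> s _; have [] := dF s.
- by apply: cvg_at_right_filter; exact: is_derive_continuous (dF e).
- by move=> s _; rewrite derive1E; have [_ ->] := dF s.
Unshelve. all: by end_near. Qed.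

Lemma integrable_linear_gauss t e : 0 < t -> 0 <= e ->
  mu.-integrable `[e, +oo[ (EFin \o (fun s => s * expR (- (s ^+ 2 / (4 * t))))).
Proof.
move=> t0 e0; apply/integrableP; split.
  apply/measurable_EFinP; apply: measurable_funTS.
  by apply: continuous_measurable_fun; exact: continuous_linear_gauss.
rewrite (eq_integral (fun s : measurableTypeR R => (s * expR (- (s ^+ 2 / (4 * t))))%:E)).
  by rewrite integral_linear_gauss// ltry.
move=> s; rewrite inE /= in_itv /= andbT => es.
by rewrite ger0_norm// mulr_ge0 ?expR_ge0// (le_trans e0).
Qed.

Lemma Rintegral_gauss_bound (h : R -> R) (A t e : R) : 0 < t -> 0 <= e ->
  mu.-integrable `[e, +oo[ (EFin \o h) ->
  (forall s, e <= s -> `|h s| <= A * (s * expR (- (s ^+ 2 / (4 * t))))) ->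
  `|\int[mu]_(s in `[e, +oo[) h s| <= A * (2 * t * expR (- (e ^+ 2 / (4 * t)))).
Proof.
move=> t0 e0 ih hA; have ig := integrable_linear_gauss t0 e0.
apply: le_trans (le_normr_Rintegral _ ih) _ => //.
have -> : A * (2 * t * expR (- (e ^+ 2 / (4 * t)))) =
    \int[mu]_(s in `[e, +oo[) (A * (s * expR (- (s ^+ 2 / (4 * t))))).
  by rewrite RintegralZl// /Rintegral integral_linear_gauss.
apply: le_Rintegral => //.
- exact: (integrable_norm ih).
- by apply: (integrableZl _ A ig); exact: measurable_itv.
- by move=> s; rewrite /= in_itv /= andbT; exact: hA.
Qed.

(* The heat kernel of the case a = 0, in the variable y = ln x - ln x'. *)
Definition heat_gauss t y : R := heat_const t * (2 * t * expR (- (y ^+ 2 / (4 * t)))).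

Lemma heat_constE t : 0 < t -> heat_const t = (4 * Num.sqrt pi * (t * Num.sqrt t))^-1.
Proof.
move=> t0; rewrite /heat_const mul1r.
have -> : (3 / 2 : R) = 1 + 2^-1 by field.
rewrite powRD; last by apply/implyP => _; rewrite gt_eqF.
by rewrite powRr1 ?ltW// powR12_sqrt ?ltW.
Qed.

Lemma heat_const_gt0 t : 0 < t -> 0 < heat_const t.
Proof.
by move=> t0; rewrite heat_constE// invr_gt0 !mulr_gt0// sqrtr_gt0 ?pi_gt0.
Qed.

(** The true ratio is 2^(3/2). Doubling t is the price for absorbing a factor s e^s into the
    Gaussian. *)
Lemma heat_const_double t : 0 < t -> heat_const t <= 4 * heat_const (2 * t).
Proof.
move=> t0; have t20 : 0 < 2 * t by rewrite mulr_gt0.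
have st : 0 < Num.sqrt t by rewrite sqrtr_gt0.
have sp : 0 < Num.sqrt pi :> R by rewrite sqrtr_gt0 pi_gt0.
have s2 : Num.sqrt 2 <= 2 :> R.
  have -> : (2 : R) = Num.sqrt (2 ^+ 2) by rewrite sqrtr_sqr ger0_norm.
  by rewrite ler_wsqrtr// sqrtr_sqr ger0_norm// expr2; lra.
have s20 : 0 < Num.sqrt 2 :> R by rewrite sqrtr_gt0.
rewrite !heat_constE// sqrtrM// -subr_ge0.
have -> : 4 * (4 * Num.sqrt pi * (2 * t * (Num.sqrt 2 * Num.sqrt t)))^-1 -
    (4 * Num.sqrt pi * (t * Num.sqrt t))^-1 =
    (2 - Num.sqrt 2) / (4 * Num.sqrt pi * (t * Num.sqrt t) * Num.sqrt 2).
  by field; rewrite !gt_eqF.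
by rewrite divr_ge0 ?subr_ge0// !mulr_ge0 ?ltW.
Qed.

(** The prefactor simplifies to 1 / (2 sqrt (pi t)): this is the normal density of variance 2 t,
    hence of total mass 1. *)
Lemma heat_gaussE t y z : 0 < t ->
  heat_gauss t (y - z) = normal_pdf y (Num.sqrt (2 * t)) z.
Proof.
move=> t0; have t20 : 0 < 2 * t by rewrite mulr_gt0.
have s0 : Num.sqrt (2 * t) != 0 by rewrite gt_eqF// sqrtr_gt0.
have st : 0 < Num.sqrt t by rewrite sqrtr_gt0.
have sp : 0 < Num.sqrt pi :> R by rewrite sqrtr_gt0 pi_gt0.
rewrite normal_pdfE//= /normal_peak /normal_fun sqr_sqrtr ?ltW//.
have -> : 2 * t * pi *+ 2 = 2 ^+ 2 * (pi * t) by rewrite mulr2n; ring.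
rewrite sqrtrM ?sqr_ge0// sqrtr_sqr ger0_norm// sqrtrM ?pi_ge0//.
rewrite /heat_gauss heat_constE// mulrA.
congr (_ * expR _).
  by field; rewrite !gt_eqF.
by rewrite mulr2n; field; rewrite !gt_eqF ?addr_gt0.
Qed.

Lemma continuous_heat_gauss t : 0 < t -> continuous (heat_gauss t).
Proof.
move=> t0 y; apply: cvgM; first exact: cvg_cst.
by apply: cvgM; [exact: cvg_cst|exact: (continuous_gauss t0)].
Qed.

Lemma heat_gauss_ge0 t y : 0 < t -> 0 <= heat_gauss t y.
Proof.
move=> t0; rewrite /heat_gauss mulr_ge0 ?(ltW (heat_const_gt0 t0))//.
by rewrite !mulr_ge0 ?expR_ge0// ltW.
Qed.

Lemma integrable_heat_gauss t y : 0 < t ->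
  mu.-integrable setT (EFin \o (fun z => heat_gauss t (y - z))).
Proof.
move=> t0; have s0 : Num.sqrt (2 * t) != 0 by rewrite gt_eqF// sqrtr_gt0 mulr_gt0.
apply: eq_integrable (integrable_normal_pdf y (Num.sqrt (2 * t))) => // z _ /=.
by rewrite heat_gaussE.
Qed.

Lemma Rintegral_heat_gauss t y : 0 < t -> \int[mu]_z heat_gauss t (y - z) = 1.
Proof.
move=> t0; have s0 : Num.sqrt (2 * t) != 0 by rewrite gt_eqF// sqrtr_gt0 mulr_gt0.
under eq_Rintegral do rewrite heat_gaussE//.
by rewrite /Rintegral integral_normal_pdf.
Qed.

(** Put s = p sqrt t; one factor sqrt t comes out and, as t <= 1, s <= p. With p <= e^p it remains
    to see 2 p - p^2 / 4 <= 8 - p^2 / 8, that is (p - 8)^2 >= 0: this is where the 8 comes from. *)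
Lemma expR_linear_gauss t s : 0 < t <= 1 -> 0 <= s ->
  s * expR s * expR (- (s ^+ 2 / (4 * t))) <=
    expR 8 * Num.sqrt t * expR (- (s ^+ 2 / (4 * (2 * t)))).
Proof.
move=> /andP[t0 t1] s0.
set q := Num.sqrt t.
have q0 : 0 < q by rewrite sqrtr_gt0.
have q2 : q ^+ 2 = t by rewrite sqr_sqrtr// ltW.
have q1 : q <= 1 by rewrite -(expr_le1 (n := 2))// ?q2// ltW.
have [p sE p0] : exists2 p, s = q * p & 0 <= p.
  by exists (s / q); [field; rewrite gt_eqF|rewrite divr_ge0// ltW].
have sp : s <= p by rewrite sE ler_piMl.
have pe : p <= expR p by apply: le_trans (expR_ge1Dx p); rewrite lerDr.
have -> : s ^+ 2 / (4 * t) = p ^+ 2 / 4 by rewrite sE -q2; field; rewrite gt_eqF.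
have -> : s ^+ 2 / (4 * (2 * t)) = p ^+ 2 / 8 by rewrite sE -q2; field; rewrite gt_eqF.
rewrite {1}sE (mulrC (expR 8)) -!mulrA ler_pM2l//.
apply: (@le_trans _ _ (expR p * (expR p * expR (- (p ^+ 2 / 4))))).
  rewrite ler_pM ?mulr_ge0 ?expR_ge0// expr2 mulrA.
  by rewrite ler_wpM2r ?expR_ge0// ler_expR.
rewrite -!expRD ler_expR.
have := sqr_ge0 (p - 8); lra.
Qed.

Lemma Rintegral_ln_subst (G : R -> R) (m M : R) : 0 < m -> m < M -> continuous G ->
  \int[mu]_(x in `[m, M]) (G (ln x) / x) = \int[mu]_(y in `[ln m, ln M]) G y.
Proof.
move=> m0 mM cG.
have M0 : 0 < M by exact: lt_trans mM.
have dln x : 0 < x -> (@ln R)^`() x = x^-1.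
  by move=> x0; rewrite derive1E; have [_ ->] := is_derive1_ln x0.
have pos x : x \in `]m, M[%R -> 0 < x.
  by rewrite in_itv /= => /andP[mx _]; exact: lt_trans mx.
have cV (x : R) : 0 < x -> y^-1 @[y --> x] --> x^-1.
  by move=> x0; apply: cvgV; [rewrite gt_eqF|exact: cvg_id].
rewrite /Rintegral (@integration_by_substitution_increasing _ (@ln R) G m M (ltW mM)).
- congr fine; apply: eq_integral => x; rewrite inE /= in_itv /= => /andP[mx _].
  by rewrite !fctE dln// (lt_le_trans m0).
- move=> x y; rewrite !in_itv /= => /andP[mx _] /andP[my _] xy.
  by rewrite ltr_ln ?posrE// (lt_le_trans m0).
- move=> x xI; have x0 := pos x xI.
  rewrite /continuous_at dln//; apply: cvg_trans (cV x x0).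
  apply: near_eq_cvg; near=> y.
  have y0 : 0 < y by near: y; exact: near_gt0.
  by rewrite dln.
- apply/cvg_ex; exists m^-1; apply: cvg_trans (cvg_at_right_filter (cV m m0)).
  apply: near_eq_cvg; near=> y.
  have y0 : 0 < y by apply: (lt_trans m0); near: y; exact: nbhs_right_gt.
  by rewrite dln.
- apply/cvg_ex; exists M^-1; apply: cvg_trans (cvg_at_left_filter (cV M M0)).
  apply: near_eq_cvg; near=> y.
  have y0 : 0 < y by near: y; exact: nbhs_left_gt.
  by rewrite dln.
- split.
  + by move=> x xI; have [] := is_derive1_ln (pos x xI).
  + by apply: cvg_at_right_filter; exact: continuous_ln.
  + by apply: cvg_at_left_filter; exact: continuous_ln.
- exact: continuous_subspaceT.
Unshelve. all: by end_near. Qed.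

End gauss.

(** * Gaussian domination and convergence as t tends to 0 *)

Section initial_condition.
Context {R : realType}.
Notation mu := (@lebesgue_measure R).

Lemma lipschitz_itv (f df : R -> R) (m M : R) : m <= M ->
  (forall x, m <= x <= M -> is_derive x 1 f (df x)) ->
  (forall x, m <= x <= M -> {for x, continuous df}) ->
  exists2 L : R, 0 <= L &
    forall x y, m <= x <= M -> m <= y <= M -> `|f x - f y| <= L * `|x - y|.
Proof.
move=> mM hdf cdf.
have [|c _ hc] := @EVT_max R (fun x => `|df x|) m M mM.
  apply: continuous_in_subspaceT => x; rewrite inE /= in_itv /= => xI.
  by apply: cvg_norm; exact: cdf.
exists `|df c| => //.
have main x y : m <= x <= M -> m <= y <= M -> x <= y ->
    `|f x - f y| <= `|df c| * `|x - y|.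
  move=> /andP[mx xM] /andP[my yM] xy.
  have inI z : z \in `[x, y]%R -> m <= z <= M.
    by rewrite in_itv /= => /andP[xz zy]; rewrite (le_trans mx)// (le_trans zy).
  have [||z zI e] := @MVT_segment R f df x y xy.
  - by move=> z zI; apply: hdf; apply: inI; exact: subset_itv_oo_cc zI.
  - apply: continuous_in_subspaceT => z; rewrite inE => zI.
    by apply: (is_derive_continuous (hdf _ _)); exact: inI.
  rewrite distrC e normrM (distrC x) ler_wpM2r// hc//.
  by rewrite in_itv /=; exact: inI.
move=> x y xI yI; have [xy|/ltW yx] := leP x y; first exact: main.
by rewrite distrC (distrC x); exact: main.
Qed.

(** On the unshifted domain the Bessel argument is nonnegative, so |b_0| <= 1, and the remaining
    integral of s exp(- s^2 / (4 t)) is explicit. *)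
Lemma heat_kernel_bound (a t x x' : R) : 0 < t -> 0 < x -> 0 < x' ->
  `|heat_kernel a t x x'| <= heat_gauss t (ln x - ln x').
Proof.
move=> t0 x0 x'0; rewrite heat_kernelE// normrM.
have c0 := heat_const_gt0 t0.
rewrite ger0_norm ?(ltW c0)// /heat_gauss ler_wpM2l ?(ltW c0)//.
have [ik _] := kernel_integrand_half_line a t0 x0 x'0.
have := @Rintegral_gauss_bound R _ 1 t `|ln x - ln x'| t0 (normr_ge0 _) ik.
rewrite mul1r real_normK ?num_real//; apply.
move=> s hs; have s0 : 0 <= s by exact: le_trans hs.
rewrite /kernel_integrand mul1r normrM ger0_norm ?mulr_ge0 ?expR_ge0//.
rewrite ler_piMr ?mulr_ge0 ?expR_ge0// bessel_clifford_le1//.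
exact: kernel_arg_ge0.
Qed.

Lemma heat_gauss_double (t y : R) : 0 < t ->
  heat_const t * (4 * t * expR (- (y ^+ 2 / (4 * (2 * t))))) <=
  4 * heat_gauss (2 * t) y.
Proof.
move=> t0; rewrite /heat_gauss.
have -> : 2 * (2 * t) = 4 * t by ring.
by rewrite [leRHS]mulrA ler_wpM2r ?heat_const_double// !mulr_ge0 ?expR_ge0// ltW.
Qed.

Variables (a m M : R) (f : R -> R).
Hypothesis m0 : 0 < m.
Hypothesis mM : m < M.
Hypothesis f0 : forall x, 0 < x -> ~ (m <= x <= M) -> f x = 0.
Hypothesis cf : forall x, 0 < x -> {for x, continuous f}.

Lemma continuous_heat_gauss_sub (t z : R) : 0 < t ->
  continuous (fun y => heat_gauss t (z - y)).
Proof.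
move=> t0 y; apply: (@continuous_comp _ _ _ (fun y => z - y) (heat_gauss t));
  last exact: continuous_heat_gauss.
by apply: cvgB; [exact: cvg_cst|exact: cvg_id].
Qed.

Lemma measurable_heat_gauss_sub (t z : R) : 0 < t ->
  measurable_fun setT (fun y : R => heat_gauss t (z - y)).
Proof.
by move=> t0; apply: continuous_measurable_fun; exact: continuous_heat_gauss_sub.
Qed.

Lemma gauss_mass_itv (t x : R) : 0 < t ->
  mu.-integrable `[m, M] (EFin \o (fun x' => heat_gauss t (ln x - ln x') / x')) /\
  \int[mu]_(x' in `[m, M]) (heat_gauss t (ln x - ln x') / x') =
  \int[mu]_(y in `[ln m, ln M]) heat_gauss t (ln x - y).
Proof.
move=> t0; have cG := continuous_heat_gauss_sub (z := ln x) t0.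
split; last exact: (Rintegral_ln_subst m0 mM cG).
apply: continuous_compact_integrable; first exact: segment_compact.
apply: continuous_in_subspaceT => z; rewrite inE /= in_itv /= => /andP[mz _].
have z0 : 0 < z by exact: lt_le_trans mz.
apply: cvgM; last by apply: cvgV; [rewrite gt_eqF|exact: cvg_id].
exact: (cvg_comp _ _ (continuous_ln z0) (cG _)).
Qed.

Lemma gauss_mass_le1 (t x : R) : 0 < t ->
  \int[mu]_(y in `[ln m, ln M]) heat_gauss t (ln x - y) <= 1.
Proof.
move=> t0; rewrite -(Rintegral_heat_gauss (ln x) t0) Rintegral_mkcond.
apply: le_Rintegral => //.
- apply: (@integrable_dominated _ _ _ mu _ _ _ _ _ (integrable_heat_gauss (ln x) t0)) => //.
    apply/(measurable_restrictT _ _).1 => //; apply: measurable_funTS.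
    exact: measurable_heat_gauss_sub.
  move=> y _; rewrite patchE; case: ifPn => _; rewrite ?normr0 ?heat_gauss_ge0//.
  by rewrite ger0_norm ?heat_gauss_ge0.
- exact: integrable_heat_gauss.
- by move=> y _; rewrite patchE; case: ifPn => _ //; exact: heat_gauss_ge0.
Qed.

Lemma heat_formula_itv (t x : R) : 0 < t -> 0 < x ->
  mu.-integrable `[m, M] (EFin \o (fun x' => heat_kernel a t x x' * (f x' / x'))) /\
  heat_formula a f t x = \int[mu]_(x' in `[m, M]) (heat_kernel a t x x' * (f x' / x')).
Proof.
move=> t0 x0; have [ih e _] := heat_formula_moment a m0 mM f0 cf t0 x0.
have E x' : heat_kernel a t x x' * log_weight m M f x' =
    ((fun x' => heat_kernel a t x x' * (f x' / x')) \_ `[m, M]) x'.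
  rewrite patchE /log_weight patchE; case: ifPn => //.
  by rewrite mulr0.
split; last by rewrite e [RHS]Rintegral_mkcond; apply: eq_Rintegral => x' _.
have ih' : mu.-integrable `[m, M]
    (EFin \o (fun x' => heat_kernel a t x x' * log_weight m M f x')).
  by apply: integrableS ih.
apply: eq_integrable ih' => // x' x'I /=.
by rewrite E patchE x'I.
Qed.

(** A maximum principle: the kernel is dominated by a Gaussian of mass at most 1. It yields the
    growth condition with exponent 0. *)
Lemma heat_formula_bound (F t x : R) : (forall x, m <= x <= M -> `|f x| <= F) ->
  0 < t -> 0 < x -> `|heat_formula a f t x| <= F.
Proof.
move=> hF t0 x0; have [ih ->] := heat_formula_itv t0 x0.
have [ig eg] := gauss_mass_itv x t0.
have F0 : 0 <= F.
  by apply: le_trans (hF m _); rewrite ?normr_ge0// lexx ltW.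
apply: le_trans (le_normr_Rintegral _ ih) _ => //.
apply: (@le_trans _ _ (F * \int[mu]_(x' in `[m, M]) (heat_gauss t (ln x - ln x') / x'))).
  rewrite -RintegralZl//; apply: le_Rintegral => //.
  - exact: (integrable_norm ih).
  - by apply: (integrableZl _ F ig); exact: measurable_itv.
  - move=> x'; rewrite /= in_itv /= => xI.
    have x'0 : 0 < x' by case/andP: xI => mx _; exact: lt_le_trans mx.
    rewrite normrM normf_div (gtr0_norm x'0) [leLHS]mulrA [leRHS]mulrA ler_wpM2r ?invr_ge0 ?(ltW x'0)//.
    by rewrite mulrC ler_pM// ?hF// heat_kernel_bound.
by rewrite eg ler_piMr// gauss_mass_le1.
Qed.

(** Off [ln m, ln M] the distance |z| to ln x is at least d > 0, so 1 <= |z| e^|z| / d. The Gaussian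
    at time t is then at most a multiple of sqrt t times the one at time 2 t, whose mass is 1. *)
Lemma gauss_mass_tail (x : R) : m < x -> x < M -> exists2 C : R, 0 <= C &
  forall t : R, 0 < t <= 1 ->
  `|1 - \int[mu]_(y in `[ln m, ln M]) heat_gauss t (ln x - y)| <= C * Num.sqrt t.
Proof.
move=> mx xM; have x0 : 0 < x by exact: lt_trans mx.
have M0 : 0 < M by exact: lt_trans mM.
pose d := Num.min (ln x - ln m) (ln M - ln x).
have d0 : 0 < d by rewrite lt_min !subr_gt0 !ltr_ln ?posrE ?mx.
exists (4 * expR 8 / d); first by rewrite divr_ge0 ?mulr_ge0 ?expR_ge0// ltW.
move=> t /andP[t0 t1]; have t20 : 0 < 2 * t by rewrite mulr_gt0.
have ig := integrable_heat_gauss (ln x) t0.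
have ig2 := integrable_heat_gauss (ln x) t20.
set I := `[ln m, ln M]%classic.
have mI : measurable I by exact: measurable_itv.
have mG := @measurable_heat_gauss_sub t (ln x) t0.
have igI : mu.-integrable setT (EFin \o ((fun z => heat_gauss t (ln x - z)) \_ I)).
  apply: (@integrable_dominated _ _ _ mu _ _ _ _ _ ig) => //.
    by apply/(measurable_restrictT _ _).1 => //; apply: measurable_funTS.
  move=> y _; rewrite patchE; case: ifPn => _; rewrite ?normr0 ?heat_gauss_ge0//.
  by rewrite ger0_norm ?heat_gauss_ge0.
have iB : mu.-integrable setT (EFin \o (fun z => heat_gauss t (ln x - z) -
    ((fun z => heat_gauss t (ln x - z)) \_ I) z)).
  exact: (integrableB measurableT ig igI).
rewrite Rintegral_mkcond -[X in `|X - _|](Rintegral_heat_gauss (ln x) t0) -RintegralB//.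
apply: le_trans (le_normr_Rintegral _ iB) _ => //.
rewrite -[leRHS]mulr1 -[X in _ <= _ * X](Rintegral_heat_gauss (ln x) t20) -RintegralZl//.
apply: le_Rintegral => //.
- exact: (integrable_norm iB).
- exact: (integrableZl measurableT _ ig2).
move=> y _; rewrite patchE; case: ifPn => yI.
  rewrite subrr normr0 mulr_ge0 ?heat_gauss_ge0// mulr_ge0 ?sqrtr_ge0//.
  by rewrite divr_ge0 ?mulr_ge0 ?expR_ge0// ltW.
rewrite subr0 ger0_norm ?heat_gauss_ge0//.
set z := ln x - y.
have dz : d <= `|z|.
  rewrite /d ge_min; move: yI; rewrite notin_setE /I /= in_itv /= => /negP.
  rewrite negb_and -!ltNge => /orP[h|h].
    by rewrite ger0_norm /z; [apply/orP; left; lra|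
      rewrite subr_ge0 (le_trans (ltW h))// ler_ln ?posrE// ltW].
  rewrite ltr0_norm /z; [apply/orP; right; lra|].
  by rewrite subr_lt0 (le_lt_trans _ h)// ler_ln ?posrE// ltW.
have tt : 0 < t <= 1 by rewrite t0.
have key := expR_linear_gauss tt (normr_ge0 z).
rewrite real_normK ?num_real// in key.
have c0 := heat_const_gt0 t0.
have hd := heat_gauss_double z t0.
have e1 : 1 <= expR `|z| by rewrite -expR0 ler_expR.
have h1 : d * expR (- (z ^+ 2 / (4 * t))) <= `|z| * expR `|z| * expR (- (z ^+ 2 / (4 * t))).
  rewrite ler_wpM2r ?expR_ge0//; apply: le_trans dz _.
  by rewrite ler_peMr.
have h2 := le_trans h1 key.
have h3 : heat_const t * (2 * t * (d * expR (- (z ^+ 2 / (4 * t))))) <=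
    heat_const t * (2 * t * (expR 8 * Num.sqrt t * expR (- (z ^+ 2 / (4 * (2 * t)))))).
  by rewrite ler_wpM2l ?(ltW c0)// ler_wpM2l// ltW.
rewrite -(ler_pM2l d0) [heat_gauss t z]/heat_gauss.
apply: (@le_trans _ _ (heat_const t * (2 * t * (d * expR (- (z ^+ 2 / (4 * t))))))).
  by rewrite le_eqVlt; apply/orP; left; apply/eqP; ring.
apply: le_trans h3 _.
have k0 : 0 <= expR 8 * Num.sqrt t by rewrite mulr_ge0 ?expR_ge0 ?sqrtr_ge0.
have h4 := ler_wpM2l k0 hd.
have h5 : 0 <= heat_const t * (2 * t * (expR 8 * Num.sqrt t * expR (- (z ^+ 2 / (4 * (2 * t)))))).
  rewrite mulr_ge0 ?(ltW c0)// mulr_ge0 ?mulr_ge0 ?expR_ge0 ?(ltW t0)//.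
have -> : d * (4 * expR 8 / d * Num.sqrt t * heat_gauss (2 * t) z) =
    expR 8 * Num.sqrt t * (4 * heat_gauss (2 * t) z).
  by move: (heat_gauss _ _) => g; field; rewrite gt_eqF.
apply: le_trans h4; rewrite -subr_ge0.
by apply: le_trans h5 _; rewrite le_eqVlt; apply/orP; left; apply/eqP; ring.
Qed.

Lemma expR_sub_expRN_le (s : R) : 0 <= s ->
  [/\ expR s - 1 <= s * expR s & expR s + expR (- s) - 2 <= s * expR s].
Proof.
move=> s0.
have h : 1 - s <= expR (- s) by exact: expR_ge1Dx.
have e0 := expR_gt0 s.
have h1 : expR s - 1 <= s * expR s.
  have : (1 - s) * expR s <= expR (- s) * expR s by rewrite ler_wpM2r// ltW.
  by rewrite -expRD addNr expR0; lra.
split => //; apply: le_trans h1.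
have : expR (- s) <= 1 by rewrite -expR0 ler_expR oppr_le0.
lra.
Qed.

Variable df : R -> R.
Hypothesis hdf : forall x : R, 0 < x -> is_derive x 1 f (df x).
Hypothesis cdf : forall x, 0 < x -> {for x, continuous df}.

(** The Bessel correction and the variation of [f] are estimated under the same s-integral. On s >=
    |ln x - ln x'| one has zeta <= a^2 x x' s e^s and |x' - x| <= x (e^s - 1) <= x s e^s. Both
    errors are thus O(s e^s), which the Gaussian turns into sqrt t at doubled time. *)
Lemma heat_formula_gauss_close (F x : R) : (forall x, m <= x <= M -> `|f x| <= F) ->
  m <= x <= M -> exists2 C : R, 0 <= C & forall t : R, 0 < t <= 1 ->
  `|heat_formula a f t x -
     f x * \int[mu]_(y in `[ln m, ln M]) heat_gauss t (ln x - y)| <= C * Num.sqrt t.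
Proof.
move=> hF xI.
have pos y : m <= y <= M -> 0 < y by case/andP => my _; exact: lt_le_trans my.
have x0 := pos x xI.
have F0 : 0 <= F by apply: le_trans (hF x xI); rewrite normr_ge0.
have [L L0 hL] := lipschitz_itv (ltW mM) (fun y yI => hdf (pos y yI))
  (fun y yI => cdf (pos y yI)).
(* The first summand pays for replacing b_0 by 1, the second for replacing f x' by f x. *)
pose D := a ^+ 2 * (x * M) * F + L * x.
have D0 : 0 <= D.
  have M0 : 0 < M by exact: lt_trans mM.
  have xM0 : 0 <= x * M by rewrite mulr_ge0 // ltW.
  have aa : 0 <= a ^+ 2 by exact: sqr_ge0.
  by rewrite /D addr_ge0 // mulr_ge0 ?(ltW x0) // mulr_ge0.
exists (D * expR 8 * 4); first by rewrite !mulr_ge0 ?expR_ge0.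
move=> t tt; have /andP[t0 t1] := tt; have t20 : 0 < 2 * t by rewrite mulr_gt0.
have c0 := heat_const_gt0 t0.
have [ih ->] := heat_formula_itv t0 x0.
have [ig <-] := gauss_mass_itv x t0.
have [ig2 eg2] := gauss_mass_itv x t20.
have igf : mu.-integrable `[m, M]
    (EFin \o (fun x' => f x * (heat_gauss t (ln x - ln x') / x'))).
  by apply: (integrableZl _ (f x) ig); exact: measurable_itv.
rewrite -RintegralZl// -RintegralB//.
set k := D * expR 8 * 4 * Num.sqrt t.
have k0 : 0 <= k by rewrite !mulr_ge0 ?expR_ge0 ?sqrtr_ge0.
have iB : mu.-integrable `[m, M] (EFin \o (fun x' =>
    heat_kernel a t x x' * (f x' / x') - f x * (heat_gauss t (ln x - ln x') / x'))).
  by apply: (integrableB _ ih igf); exact: measurable_itv.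
apply: le_trans (le_normr_Rintegral _ iB) _ => //.
apply: (@le_trans _ _ (k * \int[mu]_(x' in `[m, M]) (heat_gauss (2 * t) (ln x - ln x') / x'))); last first.
  by rewrite eg2 ler_piMr// gauss_mass_le1.
rewrite -RintegralZl//; apply: le_Rintegral => //.
- exact: (integrable_norm iB).
- by apply: (integrableZl _ k ig2); exact: measurable_itv.
move=> x'; rewrite /= in_itv /= => x'I; have x'0 := pos x' x'I.
set eta := ln x - ln x'.
have -> : heat_kernel a t x x' * (f x' / x') - f x * (heat_gauss t eta / x') =
    (heat_kernel a t x x' * f x' - f x * heat_gauss t eta) / x'.
  by move: (heat_gauss _ _) => g; ring.
rewrite normrM normfV (gtr0_norm x'0) [leRHS]mulrA.
rewrite ler_wpM2r ?invr_ge0 ?(ltW x'0)//.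
have [ik _] := kernel_integrand_half_line a t0 x0 x'0; rewrite -/eta in ik.
have il := integrable_linear_gauss t0 (normr_ge0 eta).
have ik' : mu.-integrable `[`|eta|, +oo[ (EFin \o (fun s => kernel_integrand a t x x' s * f x')).
  by apply: (integrableZr _ (f x') ik); exact: measurable_itv.
have il' : mu.-integrable `[`|eta|, +oo[
    (EFin \o (fun s => f x * (s * expR (- (s ^+ 2 / (4 * t)))))).
  by apply: (integrableZl _ (f x) il); exact: measurable_itv.
have ie : mu.-integrable `[`|eta|, +oo[ (EFin \o (fun s => kernel_integrand a t x x' s * f x'
    - f x * (s * expR (- (s ^+ 2 / (4 * t)))))).
  by apply: (integrableB _ ik' il'); exact: measurable_itv.
have -> : heat_kernel a t x x' * f x' - f x * heat_gauss t eta =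
    heat_const t * \int[mu]_(s in `[`|eta|, +oo[) (kernel_integrand a t x x' s * f x'
      - f x * (s * expR (- (s ^+ 2 / (4 * t))))).
  rewrite RintegralB// RintegralZr// RintegralZl// heat_kernelE// -/eta.
  rewrite [\int[mu]_(s in _) (s * _)]/Rintegral integral_linear_gauss//= real_normK ?num_real//.
  by rewrite /heat_gauss; ring.
rewrite normrM (gtr0_norm c0).
have bnd s : `|eta| <= s ->
    `|kernel_integrand a t x x' s * f x' - f x * (s * expR (- (s ^+ 2 / (4 * t))))| <=
    D * expR 8 * Num.sqrt t * (s * expR (- (s ^+ 2 / (4 * (2 * t))))).
  move=> es; have s0 : 0 <= s by exact: le_trans es.
  have [hs1 hs2] := expR_sub_expRN_le s0.
  have Q0 := kernel_arg_ge0 a x0 x'0 es.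
  have -> : kernel_integrand a t x x' s * f x' - f x * (s * expR (- (s ^+ 2 / (4 * t)))) =
    (s * expR (- (s ^+ 2 / (4 * t)))) *
    ((bessel_clifford 0 (kernel_arg a x x' s) - 1) * f x' + (f x' - f x)).
    by rewrite /kernel_integrand; ring.
  rewrite normrM (ger0_norm (_ : 0 <= s * _)); last by rewrite mulr_ge0 ?expR_ge0.
  have hD : `|(bessel_clifford 0 (kernel_arg a x x' s) - 1) * f x' + (f x' - f x)| <=
      D * (s * expR s).
    apply: le_trans (ler_normD _ _) _; rewrite /D [leRHS]mulrDl lerD//.
      rewrite normrM.
      apply: (@le_trans _ _ (a ^+ 2 * (x * M) * (s * expR s) * F)); last first.
        by rewrite le_eqVlt; apply/orP; left; apply/eqP; ring.
      apply: ler_pM => //; last exact: hF.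
      apply: le_trans (bessel_clifford_sub1_le Q0) _.
      rewrite /kernel_arg -[leRHS]mulrA ler_wpM2l ?sqr_ge0//.
      have xx : x * x' <= x * M by rewrite ler_pM2l//; case/andP: x'I.
      have se0 : 0 <= s * expR s by rewrite mulr_ge0 ?expR_ge0.
      have p1 : x * x' * (expR s + expR (- s) - 2) <= x * x' * (s * expR s).
        by rewrite ler_wpM2l// mulr_ge0// ltW.
      have p2 : x * x' * (s * expR s) <= x * M * (s * expR s) by rewrite ler_wpM2r.
      have := sqr_ge0 (x - x'); lra.
    apply: le_trans (hL _ _ x'I xI) _; rewrite -[leRHS]mulrA ler_wpM2l//.
    have -> : x' = x * expR (- eta).
      by rewrite /eta opprB expRB !lnK ?posrE//; field; rewrite gt_eqF.
    rewrite -{2}(mulr1 x) -mulrBr normrM (gtr0_norm x0) ler_wpM2l ?(ltW x0)//.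
    apply: le_trans hs1; rewrite ler_norml; apply/andP; split.
      have h1 : 1 - s <= 1 - eta by rewrite lerD2l lerN2 (le_trans (ler_norm _)).
      have h2 : 1 - eta <= expR (- eta) by exact: expR_ge1Dx.
      have h3 : 1 + s <= expR s by exact: expR_ge1Dx.
      lra.
    by rewrite lerD2r ler_expR; apply: le_trans es; rewrite -normrN ler_norm.
  have key := expR_linear_gauss tt s0.
  have se0 : 0 <= s * expR (- (s ^+ 2 / (4 * t))) by rewrite mulr_ge0 ?expR_ge0.
  apply: le_trans (ler_wpM2l se0 hD) _.
  have Ds0 : 0 <= D * s by rewrite mulr_ge0.
  have := ler_wpM2l Ds0 key.
  by move=> h; apply: le_trans (le_trans _ h) _; rewrite le_eqVlt; apply/orP; left; apply/eqP; ring.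
have := Rintegral_gauss_bound t20 (normr_ge0 eta) ie bnd.
rewrite real_normK ?num_real// => hb.
apply: le_trans (ler_wpM2l (ltW c0) hb) _.
have k1 : 0 <= D * expR 8 * Num.sqrt t by rewrite !mulr_ge0 ?expR_ge0 ?sqrtr_ge0.
have hd := ler_wpM2l k1 (heat_gauss_double eta t0).
by apply: le_trans (le_trans _ hd) _; rewrite le_eqVlt; apply/orP; left; apply/eqP;
  rewrite /k; ring.
Qed.

Lemma heat_formula_initial (x : R) : m < x -> x < M ->
  heat_formula a f t x @[t --> 0^'+] --> f x.
Proof.
move=> mx xM.
have xI : m <= x <= M by rewrite !ltW.
have [|c _ hc] := @EVT_max R (fun x => `|f x|) m M (ltW mM).
  apply: continuous_in_subspaceT => z; rewrite inE /= in_itv /= => /andP[mz _].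
  by apply: cvg_norm; apply: cf; exact: lt_le_trans mz.
have hF y : m <= y <= M -> `|f y| <= `|f c|.
  by move=> yI; apply: hc; rewrite in_itv.
have [C1 C10 h1] := heat_formula_gauss_close hF xI.
have [C2 C20 h2] := gauss_mass_tail mx xM.
pose C := C1 + `|f x| * C2.
have main t : 0 < t <= 1 -> `|f x - heat_formula a f t x| <= C * Num.sqrt t.
  move=> tt; set N := \int[mu]_(y in `[ln m, ln M]) heat_gauss t (ln x - y).
  have -> : f x - heat_formula a f t x =
      f x * (1 - N) - (heat_formula a f t x - f x * N) by ring.
  apply: le_trans (ler_normB _ _) _.
  rewrite /C mulrDl addrC lerD ?h1// normrM -mulrA ler_wpM2l// h2//.
have s0 : C * Num.sqrt t @[t --> 0^'+] --> (0 : R).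
  have h : Num.sqrt t @[t --> 0^'+] --> (0 : R).
    apply: cvg_at_right_filter.
    by have := @sqrt_continuous R 0; rewrite /continuous_at sqrtr0.
  by rewrite -[X in _ --> X](mulr0 C); apply: cvgM => //; exact: cvg_cst.
apply/cvgrPdist_le => e e0; near=> t.
apply: (@le_trans _ _ (C * Num.sqrt t)).
  apply: main; apply/andP; split.
    by near: t; exact: nbhs_right_gt.
  by near: t; exact: nbhs_right_le.
by near: t; exact: (cvgr_le _ s0).
Unshelve. all: by end_near. Qed.

End initial_condition.

(** * Uniqueness *)

Section weight.
Context {R : realType}.
Variables (N q c : R).
Hypothesis N0 : 0 < N.
Implicit Types (y h : R).

Let k := N ^- 2.

(** The square makes the first derivative vanish at the ends too, so integrating by parts twice
    leaves no boundary term. *)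
Definition cutoff y : R := (1 - k * y ^+ 2) ^+ 2.
Definition dcutoff y : R := - (4 * k * y * (1 - k * y ^+ 2)).
Definition ddcutoff y : R := - (4 * k) + 12 * k ^+ 2 * y ^+ 2.

Definition weight h y : R := cutoff y * expR (- (h * y ^+ 2)).
Definition weight_y h y : R :=
  (dcutoff y - 2 * h * y * cutoff y) * expR (- (h * y ^+ 2)).
Definition weight_yy h y : R :=
  (ddcutoff y - 4 * h * y * dcutoff y
   + cutoff y * (4 * h ^+ 2 * y ^+ 2 - 2 * h)) * expR (- (h * y ^+ 2)).

Lemma is_derive_expR_sqr h y :
  is_derive y 1 (fun y => expR (- (h * y ^+ 2))) (expR (- (h * y ^+ 2)) * (- (2 * h * y))).
Proof.
apply: is_derive_expR_comp; apply: is_derive_eq.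
by rewrite /GRing.scale /=; ring.
Qed.

Lemma is_derive_weight h y : is_derive y 1 (weight h) (weight_y h y).
Proof.
have hE := is_derive_expR_sqr h y.
rewrite /weight /weight_y /cutoff /dcutoff.
apply: is_derive_eq; rewrite /GRing.scale /=.
by move: (expR _) => E; ring.
Qed.

Lemma is_derive_weight_y h y : is_derive y 1 (weight_y h) (weight_yy h y).
Proof.
have hE := is_derive_expR_sqr h y.
rewrite /weight_y /weight_yy /cutoff /dcutoff /ddcutoff.
apply: is_derive_eq; rewrite /GRing.scale /=.
by move: (expR _) => E; ring.
Qed.

Lemma kN : k * N ^+ 2 = 1.
Proof. by rewrite /k mulVf// expf_neq0 ?gt_eqF. Qed.

Lemma k_gt0 : 0 < k. Proof. by rewrite invr_gt0 exprn_gt0. Qed.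

Lemma ky_le1 y : - N <= y <= N -> k * y ^+ 2 <= 1.
Proof.
move=> /andP[h1 h2]; rewrite -kN ler_pM2l ?k_gt0//.
have : 0 <= (N - y) * (N + y) by rewrite mulr_ge0; lra.
lra.
Qed.

Lemma weight_end h : [/\ weight h N = 0, weight h (- N) = 0,
  weight_y h N = 0 & weight_y h (- N) = 0].
Proof.
by split; rewrite /weight /weight_y /dcutoff /cutoff ?sqrrN kN; ring.
Qed.

Lemma weight_bound h y : - N <= y <= N -> 0 <= weight h y <= expR (- (h * y ^+ 2)).
Proof.
move=> yN; have k1 := ky_le1 yN.
have k0 : 0 <= k * y ^+ 2 by rewrite mulr_ge0 ?sqr_ge0// ltW// k_gt0.
rewrite /weight /cutoff; apply/andP; split.
  by rewrite mulr_ge0 ?expR_ge0// sqr_ge0.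
by rewrite ler_piMl ?expR_ge0// expr_le1//; lra.
Qed.

(* The weight is an approximate supersolution of the backward heat equation
   as long as its exponent grows at the rate c >= 4 h^2. *)
Lemma weight_supersolution h y : - N <= y <= N -> 0 <= h <= 2 * q ->
  4 * h ^+ 2 <= c ->
  - (c * y ^+ 2) * weight h y + weight_yy h y <=
    k * (8 + 32 * q * y ^+ 2) * expR (- (h * y ^+ 2)).
Proof.
move=> yN /andP[h0 hq] hc; have k1 := ky_le1 yN; have k0 := k_gt0.
have y2 : 0 <= y ^+ 2 by exact: sqr_ge0.
rewrite /weight /weight_yy mulrA -mulrDl ler_wpM2r ?expR_ge0//.
rewrite /dcutoff /ddcutoff.
(* Minus this quantity is the contribution in which the cutoff is not differentiated. What remains
   is - 4 k + 12 k^2 y^2 + 16 h k y^2 (1 - k y^2), estimated by k y^2 <= 1 and h <= 2 q. *)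
have ch0 : 0 <= cutoff y * ((c - 4 * h ^+ 2) * y ^+ 2 + 2 * h).
  have c0 : 0 <= cutoff y by exact: sqr_ge0.
  rewrite mulr_ge0// addr_ge0//; last by rewrite mulr_ge0.
  by rewrite mulr_ge0// subr_ge0.
have h1 : 0 <= k * (1 - k * y ^+ 2) by rewrite mulr_ge0 ?subr_ge0// ltW.
have k0' := ltW k0; have qh : 0 <= 2 * q - h by rewrite subr_ge0.
have h2 := mulr_ge0 (mulr_ge0 (mulr_ge0 k0' h0) y2) (mulr_ge0 k0' y2).
have h3 := mulr_ge0 (mulr_ge0 k0' qh) y2.
lra.
Qed.

End weight.

(** * The weighted energy estimate on one strip *)

Section strip.
Context {R : realType}.
Notation mu := (@lebesgue_measure R).
Implicit Types (t s y : R).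

Lemma rectangle_bounded (f : R * R -> R) (t1 t2 y1 y2 : R) :
  t1 <= t2 -> y1 <= y2 ->
  (forall t y, t1 <= t <= t2 -> y1 <= y <= y2 -> {for (t, y), continuous f}) ->
  exists2 C : R, 0 <= C &
    forall t y, t1 <= t <= t2 -> y1 <= y <= y2 -> `|f (t, y)| <= C.
Proof.
move=> t12 y12 cf.
have cK : compact (`[t1, t2] `*` `[y1, y2]).
  by apply: compact_setX; exact: segment_compact.
have K0 : (`[t1, t2] `*` `[y1, y2]) !=set0.
  by exists (t1, y1); split => /=; rewrite in_itv /= ?lexx.
have [|p _ hp] := @compact_EVT_max _ R (fun p => `|f p|) _ K0 cK.
  apply: continuous_in_subspaceT => -[t y]; rewrite inE => -[/=].
  rewrite !in_itv /= => tI yI.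
  by apply: cvg_norm; exact: cf.
exists `|f p| => // t y tI yI; apply: hp; rewrite inE; split => /=;
  by rewrite in_itv.
Qed.

Variables (z zt zy zyy : R -> R -> R) (V : R -> R).
Hypothesis V0 : forall y, 0 <= V y.
Hypothesis dzt : forall t y, 0 < t -> is_derive t 1 (fun t => z t y) (zt t y).
Hypothesis dzy : forall t y, 0 < t -> is_derive y 1 (z t) (zy t y).
Hypothesis dzyy : forall t y, 0 < t -> is_derive y 1 (zy t) (zyy t y).
Hypothesis zE : forall t y, 0 < t -> zt t y = zyy t y - V y * z t y.
Hypothesis cz : forall t y, 0 < t -> {for (t, y), continuous (fun p => z p.1 p.2)}.
Hypothesis czt : forall t y, 0 < t -> {for (t, y), continuous (fun p => zt p.1 p.2)}.
Hypothesis czyy : forall t y, 0 < t -> {for (t, y), continuous (fun p => zyy p.1 p.2)}.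

Lemma continuous_slice (f : R -> R -> R) t :
  (forall y, {for (t, y), continuous (fun p => f p.1 p.2)}) -> continuous (f t).
Proof.
move=> cf y; have h : (t, y') @[y' --> y] --> (t, y).
  exact: (cvg_pair (cvg_cst t) cvg_id).
exact: (cvg_comp _ _ h (cf y)).
Qed.

Lemma integrable_segment (f : R -> R) (a b : R) : continuous f ->
  mu.-integrable `[a, b] (EFin \o f).
Proof.
move=> cf; apply: continuous_compact_integrable; first exact: segment_compact.
exact: continuous_subspaceT.
Qed.

Lemma measurable_fun_continuous (f : R -> R) (D : set R) : continuous f ->
  measurable_fun D f.
Proof. by move=> cf; apply: measurable_funTS; exact: continuous_measurable_fun. Qed.

Lemma Rintegral_derive_eq0 (F f : R -> R) (a b : R) : a < b ->
  (forall y, is_derive y 1 F (f y)) -> continuous f -> F a = F b ->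
  \int[mu]_(y in `[a, b]) f y = 0.
Proof.
move=> ab dF cf Fab; rewrite /Rintegral (@continuous_FTC2 _ f F a b ab).
- by rewrite Fab subee.
- exact: continuous_subspaceT.
- split; first by move=> x _; have [] := dF x.
    by apply: cvg_at_right_filter; exact: is_derive_continuous (dF a).
  by apply: cvg_at_left_filter; exact: is_derive_continuous (dF b).
- by move=> x _; rewrite derive1E; have [_ ->] := dF x.
Qed.

Variables (t0 T A B q tau : R).
Hypothesis t00 : 0 <= t0.
Hypothesis A0 : 0 <= A.
Hypothesis B0 : 0 <= B.
Hypothesis growth : forall t y, 0 < t <= T -> `|z t y| <= A * expR (B * y ^+ 2).
Hypothesis init : forall y, z t y @[t --> t0^'+] --> (0 : R).
Hypothesis q0 : 2 * B + 1 <= q.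
Hypothesis tauE : tau = (16 * q)^-1.

(* By the choice of tau, the exponent theta runs from q to 2 q over the strip
   and its rate c equals 4 (2 q)^2. *)
Let theta t := q * (1 + (t - t0) / tau).
Let c := q / tau.

Lemma q_gt0 : 0 < q.
Proof. by move: B0 q0 => h1 h2; lra. Qed.

Lemma tau_gt0 : 0 < tau. Proof. by rewrite tauE invr_gt0 mulr_gt0// q_gt0. Qed.

Lemma theta_bounds t : t0 <= t <= t0 + tau -> q <= theta t <= 2 * q.
Proof.
move=> /andP[h1 h2]; rewrite /theta.
have p0 : 0 <= (t - t0) / tau by rewrite divr_ge0 ?subr_ge0// ltW// tau_gt0.
have p1 : (t - t0) / tau <= 1 by rewrite ler_pdivrMr ?tau_gt0// mul1r; lra.
have qg := q_gt0; apply/andP; split.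
  by rewrite ler_peMr; lra.
by rewrite (mulrC 2) ler_pM2l//; lra.
Qed.

Lemma theta_rate t : t0 <= t <= t0 + tau -> 4 * theta t ^+ 2 <= c.
Proof.
move=> /theta_bounds/andP[h1 h2]; have qg := q_gt0.
have -> : c = 4 * (2 * q) ^+ 2 by rewrite /c tauE; field; rewrite gt_eqF.
rewrite ler_pM2l// lerXn2r ?nnegrE//; lra.
Qed.

Lemma is_derive_theta t : is_derive t 1 theta c.
Proof.
rewrite /theta /c; apply: is_derive_eq; rewrite /GRing.scale /=.
by field; rewrite gt_eqF// tau_gt0.
Qed.

Section cutoff_energy.
Variable N : R.
Hypothesis N0 : 0 < N.

Let k := N ^- 2.
Let E t y := z t y ^+ 2 * weight N (theta t) y.
Let dE t y := 2 * z t y * zt t y * weight N (theta t) y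
  - z t y ^+ 2 * (c * y ^+ 2 * weight N (theta t) y).
Let energy t := \int[mu]_(y in `[- N, N]) E t y.
Let K := A ^+ 2 * (8 + 32 * q).

Lemma is_derive_energy_density t y : 0 < t -> is_derive t 1 (fun t => E t y) (dE t y).
Proof.
move=> t_gt0; have h1 := dzt y t_gt0; have h2 := is_derive_theta t.
have h3 : is_derive t 1 (fun t => - (theta t * y ^+ 2)) (- (c * y ^+ 2)).
  by apply: is_derive_eq; rewrite /GRing.scale /=; ring.
have h4 := is_derive_expR_comp h3.
rewrite /E /dE /weight; apply: is_derive_eq; rewrite /GRing.scale /=.
by move: (expR _) (cutoff _ _) => e x; ring.
Qed.

Lemma continuous_weight2 t y :
  {for (t, y), continuous (fun p : R * R => weight N (theta p.1) p.2)}.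
Proof.
have c1 : p.1 @[p --> (t, y)] --> t by exact: cvg_fst.
have c2 : p.2 ^+ 2 @[p --> (t, y)] --> y ^+ 2.
  have cs : p.2 @[p --> (t, y)] --> y by exact: cvg_snd.
  exact: (cvg_comp _ _ cs (@exprn_continuous R 2 y)).
apply: cvgM.
  have h : 1 - N ^- 2 * p.2 ^+ 2 @[p --> (t, y)] --> 1 - N ^- 2 * y ^+ 2.
    by apply: cvgB; [exact: cvg_cst|apply: cvgM; [exact: cvg_cst|exact: c2]].
  exact: (cvg_comp _ _ h (@exprn_continuous R 2 _)).
have h : - (theta p.1 * p.2 ^+ 2) @[p --> (t, y)] --> - (theta t * y ^+ 2).
  apply: cvgN; apply: cvgM => //.
  exact: (cvg_comp _ _ c1 (is_derive_continuous (is_derive_theta t))).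
exact: (cvg_comp _ _ h (@continuous_expR R _)).
Qed.

Lemma continuous_z2 t y : 0 < t ->
  {for (t, y), continuous (fun p : R * R => z p.1 p.2 ^+ 2)}.
Proof.
move=> t_gt0.
apply: (@continuous_comp _ _ _ (fun p : R * R => z p.1 p.2) (fun x => x ^+ 2)).
  exact: cz.
exact: exprn_continuous.
Qed.

Lemma continuous_E t y : 0 < t -> {for (t, y), continuous (fun p => E p.1 p.2)}.
Proof.
move=> t_gt0; apply: cvgM; last exact: continuous_weight2.
exact: continuous_z2.
Qed.

Lemma continuous_dE t y : 0 < t -> {for (t, y), continuous (fun p => dE p.1 p.2)}.
Proof.
move=> t_gt0; have cw := @continuous_weight2 t y.
have c2 : p.2 ^+ 2 @[p --> (t, y)] --> y ^+ 2.
  have cs : p.2 @[p --> (t, y)] --> y by exact: cvg_snd.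
  exact: (cvg_comp _ _ cs (@exprn_continuous R 2 y)).
apply: cvgB.
  apply: cvgM => //; apply: cvgM; last exact: czt.
  by apply: cvgM; [exact: cvg_cst|exact: cz].
apply: cvgM; first exact: continuous_z2.
by apply: cvgM => //; apply: cvgM => //; exact: cvg_cst.
Qed.

Lemma is_derive_energy t : 0 < t ->
  is_derive t 1 energy (\int[mu]_(y in `[- N, N]) dE t y).
Proof.
move=> t_gt0; have e0 : 0 < t / 2 by rewrite divr_gt0.
have NN : - N <= N by move: N0 => h; lra.
have pos s : `|s - t| < t / 2 -> t / 2 <= s <= t * 2.
  by rewrite ltr_distl => /andP[h1 h2]; apply/andP; split; lra.
have pos' s : t / 2 <= s <= t * 2 -> 0 < s by case/andP => h _; exact: lt_le_trans h.
have [|||C C0 hC] := @rectangle_bounded (fun p => dE p.1 p.2) (t / 2) (t * 2) (- N) N.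
- lra.
- exact: NN.
- by move=> s y sI _; apply: continuous_dE; exact: pos'.
have cE s : 0 < s -> continuous (E s).
  by move=> s0; apply: continuous_slice => y; exact: continuous_E.
apply: (@is_derive_under_integral R _ _ mu `[- N, N]%classic _ E dE (fun=> C) t _ e0).
- exact: measurable_itv.
- by apply: integrable_segment => y; exact: cvg_cst.
- by move=> s /pos/pos' s0; apply: integrable_segment; exact: cE.
- by move=> s y /pos/pos' s0 _; exact: is_derive_energy_density.
- move=> s y /pos sI; rewrite /= in_itv /= => yI; exact: (hC s y).
Qed.

(** Two integrations by parts move z_yy onto the weight; the terms in z_y^2 and V have the good sign
    and are dropped. As theta >= 2 B + 1, the supersolution error times z^2 is at most K / N^2,
    because y^2 exp(- y^2) <= 1. Integrating over length 2 N gives 2 K / N. *)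
Lemma energy_dissipation t : t0 < t <= t0 + tau -> t <= T ->
  \int[mu]_(y in `[- N, N]) dE t y <= 2 * K / N.
Proof.
move=> /andP[t0t ttau] tT.
have t_gt0 : 0 < t by exact: le_lt_trans t0t.
have tI : t0 <= t <= t0 + tau by rewrite ltW.
have /andP[qh h2q] := theta_bounds tI.
have rate := theta_rate tI.
have qg := q_gt0; have kg := k_gt0 N0.
set h := theta t in qh h2q rate *.
(* [Psi] is the flux of both integrations by parts and [psi] its derivative; the terms in z_y times
   [weight_y] cancel. *)
pose Psi y := 2 * z t y * zy t y * weight N h y - z t y ^+ 2 * weight_y N h y.
pose psi y := 2 * zy t y ^+ 2 * weight N h y + 2 * z t y * zyy t y * weight N h y
  - z t y ^+ 2 * weight_yy N h y.
have dPsi y : is_derive y 1 Psi (psi y).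
  have h1 := dzy y t_gt0; have h2 := dzyy y t_gt0.
  have h3 := is_derive_weight N h y; have h4 := is_derive_weight_y N h y.
  rewrite /Psi /psi; apply: is_derive_eq; rewrite /GRing.scale /=.
  by ring.
have cw : continuous (weight N h).
  by move=> y; exact: is_derive_continuous (is_derive_weight N h y).
have cwyy : continuous (weight_yy N h).
  have cx : continuous (fun y : R => y) by move=> y; exact: cvg_id.
  have cx2 : continuous (fun y : R => y ^+ 2) by move=> y; exact: exprn_continuous.
  have cK (r : R) : continuous (fun _ : R => r) by move=> y; exact: cvg_cst.
  have cD (f g : R -> R) : continuous f -> continuous g -> continuous (fun y => f y + g y).
    by move=> cf cg y; apply: cvgD; [exact: cf|exact: cg].
  have cM (f g : R -> R) : continuous f -> continuous g -> continuous (fun y => f y * g y).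
    by move=> cf cg y; apply: cvgM; [exact: cf|exact: cg].
  have cN (f : R -> R) : continuous f -> continuous (fun y => - f y).
    by move=> cf y; apply: cvgN; exact: cf.
  have c1 : continuous (fun y : R => 1 - N ^- 2 * y ^+ 2).
    by apply: (cD _ _ (cK 1)); apply: cN; exact: (cM _ _ (cK _) cx2).
  have cc : continuous (cutoff N).
    by move=> y; exact: (cvg_comp _ _ (c1 y) (@exprn_continuous R 2 _)).
  have cdc : continuous (dcutoff N).
    by apply: cN; apply: (cM _ _ _ c1); exact: (cM _ _ (cK _) cx).
  have cddc : continuous (ddcutoff N).
    by apply: (cD _ _ (cK _)); exact: (cM _ _ (cK _) cx2).
  apply: (cM _ _ _ (fun y => is_derive_continuous (is_derive_expR_sqr h y))).
  apply: (cD _ _ (cD _ _ cddc (cN _ _)) (cM _ _ cc _)).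
    by apply: (cM _ _ _ cdc); exact: (cM _ _ (cK _) cx).
  by apply: (cD _ _ (cM _ _ (cK _) cx2) (cK _)).
have czt_ : continuous (z t) by apply: continuous_slice => y; exact: cz.
have czy_ : continuous (zy t) by move=> y; exact: is_derive_continuous (dzyy y t_gt0).
have czyy_ : continuous (zyy t) by apply: continuous_slice => y; exact: czyy.
have cz2 : continuous (fun y => z t y ^+ 2).
  by move=> y; exact: (cvg_comp _ _ (czt_ y) (@exprn_continuous R 2 _)).
have czy2 : continuous (fun y => zy t y ^+ 2).
  by move=> y; exact: (cvg_comp _ _ (czy_ y) (@exprn_continuous R 2 _)).
have cpsi : continuous psi.
  move=> y; apply: cvgB; last by apply: cvgM; [exact: cz2|exact: cwyy].
  apply: cvgD.
    apply: cvgM; last exact: cw.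
    by apply: cvgM; [exact: cvg_cst|exact: czy2].
  apply: cvgM; last exact: cw.
  apply: cvgM; last exact: czyy_.
  by apply: cvgM; [exact: cvg_cst|exact: czt_].
have NN : - N < N by move: N0 => h0; lra.
have psi0 : \int[mu]_(y in `[- N, N]) psi y = 0.
  apply: (Rintegral_derive_eq0 NN dPsi cpsi).
  by rewrite /Psi; have [-> -> -> ->] := weight_end N0 h; rewrite !mulr0 !subr0.
have bound y : - N <= y <= N -> dE t y <= psi y + K * k.
  move=> yN.
  have := weight_supersolution N0 yN (_ : 0 <= h <= 2 * q) rate.
  rewrite h2q (le_trans (ltW qg) qh) => /(_ isT) ws.
  have /andP[w0 w1] := weight_bound N0 h yN.
  have zz : z t y ^+ 2 <= A ^+ 2 * expR (2 * B * y ^+ 2).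
    rewrite -(real_normK (num_real (z t y))).
    have g := growth y (_ : 0 < t <= T); rewrite t_gt0 tT in g.
    have -> : A ^+ 2 * expR (2 * B * y ^+ 2) = (A * expR (B * y ^+ 2)) ^+ 2.
      rewrite exprMn -expRM_natl; congr (_ * expR _); ring.
    by rewrite lerXn2r ?nnegrE ?mulr_ge0 ?expR_ge0// g.
  have y20 : 0 <= y ^+ 2 by exact: sqr_ge0.
  have ee : expR (2 * B * y ^+ 2) * expR (- (h * y ^+ 2)) <= expR (- y ^+ 2).
    rewrite -expRD ler_expR.
    have : (2 * B + 1) * y ^+ 2 <= h * y ^+ 2.
      by rewrite ler_wpM2r// (le_trans q0).
    lra.
  have ye : y ^+ 2 * expR (- y ^+ 2) <= 1.
    have := expR_ge1Dx (y ^+ 2) => h1.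
    rewrite expRN -[leRHS](divff (_ : expR (y ^+ 2) != 0)) ?gt_eqF ?expR_gt0//.
    rewrite ler_wpM2r ?invr_ge0 ?expR_ge0//; lra.
  have e1 : expR (- y ^+ 2) <= 1 by rewrite -expR0 ler_expR; lra.
  have z2 : 0 <= z t y ^+ 2 by exact: sqr_ge0.
  have Vzw := mulr_ge0 (V0 y) (mulr_ge0 z2 w0).
  have zyw := mulr_ge0 (sqr_ge0 (zy t y)) w0.
  have s1 := ler_wpM2l z2 ws.
  have P0 : 0 <= k * (8 + 32 * q * y ^+ 2).
    by rewrite mulr_ge0 ?(ltW kg)// addr_ge0// mulr_ge0// mulr_ge0// ltW.
  have s2 : z t y ^+ 2 * (k * (8 + 32 * q * y ^+ 2) * expR (- (h * y ^+ 2))) <=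
      k * (8 + 32 * q * y ^+ 2) * (A ^+ 2 * expR (- y ^+ 2)).
    rewrite mulrCA ler_wpM2l//.
    apply: (@le_trans _ _ (A ^+ 2 * expR (2 * B * y ^+ 2) * expR (- (h * y ^+ 2)))).
      by rewrite ler_wpM2r ?expR_ge0.
    by rewrite -mulrA ler_wpM2l ?sqr_ge0.
  have s3 : k * (8 + 32 * q * y ^+ 2) * (A ^+ 2 * expR (- y ^+ 2)) <= K * k.
    have -> : k * (8 + 32 * q * y ^+ 2) * (A ^+ 2 * expR (- y ^+ 2)) =
      k * A ^+ 2 * (8 * expR (- y ^+ 2) + 32 * q * (y ^+ 2 * expR (- y ^+ 2))) by ring.
    have -> : K * k = k * A ^+ 2 * (8 + 32 * q) by rewrite /K; ring.
    rewrite ler_wpM2l ?mulr_ge0 ?sqr_ge0 ?(ltW kg)// lerD//; first lra.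
    by rewrite ler_piMr// mulr_ge0// ltW.
  have := le_trans s1 (le_trans s2 s3).
  rewrite /dE -/h /psi zE//.
  by move: (weight _ _ _) (weight_yy _ _ _) (K * k) Vzw zyw => w wyy Kk Vzw zyw s; lra.
have cdE : continuous (dE t) by apply: continuous_slice => y; exact: continuous_dE.
have ck : continuous (fun y : R => K * k) by move=> y; exact: cvg_cst.
have cpk : continuous (fun y : R => psi y + K * k).
  by move=> y; apply: cvgD; [exact: cpsi|exact: ck].
apply: (@le_trans _ _ (\int[mu]_(y in `[- N, N]) (psi y + K * k))).
  by apply: le_Rintegral => //; exact: integrable_segment.
rewrite RintegralD//; [|exact: integrable_segment|exact: integrable_segment].
rewrite psi0 add0r Rintegral_cst//= lebesgue_measure_itv /= lte_fin NN -EFinB /=.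
by rewrite le_eqVlt; apply/orP; left; apply/eqP; rewrite /k; field; rewrite gt_eqF.
Qed.

Lemma energy_density_bound t y : t0 < t <= t0 + tau -> t <= T -> - N <= y <= N ->
  0 <= E t y <= z t y ^+ 2.
Proof.
move=> /andP[t0t ttau] tT yN.
have tI : t0 <= t <= t0 + tau by rewrite ltW.
have /andP[qh _] := theta_bounds tI.
have h0 : 0 <= theta t by apply: le_trans qh; exact: ltW q_gt0.
have /andP[w0 w1] := weight_bound N0 (theta t) yN.
have w2 : weight N (theta t) y <= 1.
  by apply: le_trans w1 _; rewrite -expR0 ler_expR oppr_le0 mulr_ge0// sqr_ge0.
have z2 : 0 <= z t y ^+ 2 by exact: sqr_ge0.
by rewrite /E mulr_ge0//= ler_piMr.
Qed.

(** [z] need not have a meaningful value at [t0]. Setting the density to 0 outside the strip turns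
    the one-sided limit into continuity at [t0] of an integral dominated by a constant. *)
Lemma energy_init : t0 < T -> energy t @[t --> t0^'+] --> (0 : R).
Proof.
move=> t0T; have tg := tau_gt0.
pose P t := (t0 < t <= t0 + tau) && (t <= T).
pose F t y := if P t then E t y else 0.
have cE s : 0 < s -> continuous (E s).
  by move=> s0; apply: continuous_slice => y; exact: continuous_E.
have Ppos s : P s -> 0 < s by case/andP => /andP[h _] _; exact: le_lt_trans h.
pose C := (A * expR (B * N ^+ 2)) ^+ 2.
have FC t y : - N <= y <= N -> `|F t y| <= C.
  move=> yN; rewrite /F; case: ifPn => [Pt|_]; last by rewrite normr0 sqr_ge0.
  have /andP[tI tT] := Pt.
  have /andP[e0 e1] := energy_density_bound tI tT yN.
  rewrite ger0_norm//; apply: le_trans e1 _.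
  have g := growth y (_ : 0 < t <= T); rewrite tT (Ppos _ Pt) in g.
  rewrite -(real_normK (num_real (z t y))) /C lerXn2r ?nnegrE ?mulr_ge0 ?expR_ge0//.
  apply: le_trans (g isT) _; rewrite ler_wpM2l// ler_expR ler_wpM2l//.
  have : 0 <= (N - y) * (N + y).
    by case/andP: yN => h1 h2; rewrite mulr_ge0; lra.
  lra.
have cF : {for t0, continuous (fun t => \int[mu]_(y in `[- N, N]) F t y)}.
  apply: (@continuous_under_integral R _ _ mu `[- N, N]%classic _ R F t0 (fun=> C)).
  - exact: measurable_itv.
  - by apply: integrable_segment => y; exact: cvg_cst.
  - move=> s; have [Ps|nPs] := boolP (P s).
      have -> : F s = E s by apply/funext => y; rewrite /F Ps.
      by apply: measurable_fun_continuous; apply: cE; exact: Ppos.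
    have -> : F s = cst 0 by apply/funext => y; rewrite /F (negbTE nPs).
    exact: measurable_cst.
  - by near=> s => y; rewrite /= in_itv; exact: FC.
  - move=> y; rewrite /= in_itv /= => yN.
    rewrite {2}/F /P ltxx /=; apply/cvgrPdist_le => e e0.
    have z2 : z t y ^+ 2 @[t --> t0^'+] --> (0 : R).
      have := cvg_comp _ _ (init y) (@exprn_continuous R 2 0).
      by rewrite expr0n.
    have zn : \forall s \near t0, t0 < s -> z s y ^+ 2 <= e.
      exact: (cvgr_le _ z2 _ e0).
    near=> s; rewrite sub0r normrN /F; case: ifPn => [Ps|_]; last first.
      by rewrite normr0 ltW.
    have /andP[sI sT] := Ps; have /andP[t0s _] := sI.
    have /andP[f0 f1] := energy_density_bound sI sT yN.
    rewrite ger0_norm//; apply: le_trans f1 _.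
    by move: t0s; near: s; exact: zn.
have F0 : \int[mu]_(y in `[- N, N]) F t0 y = 0.
  by rewrite /F /P ltxx /= Rintegral_cst// mul0r.
have := cvg_at_right_filter cF; rewrite F0; apply: cvg_trans.
apply: near_eq_cvg; near=> s; apply: eq_Rintegral => y _; rewrite /F.
have -> // : P s.
apply/andP; split; [apply/andP; split|].
- by near: s; exact: nbhs_right_gt.
- by near: s; apply: nbhs_right_le; lra.
- by near: s; exact: nbhs_right_le.
Unshelve. all: by end_near. Qed.

(** The mean value theorem is applied from a time s slightly after [t0], where the energy is at most
    an arbitrary e > 0, since [t0] may be 0 and the equation holds only at positive times. *)
Lemma energy_le t : t0 < t <= t0 + tau -> t <= T -> energy t <= 2 * K / N * tau.
Proof.
move=> /andP[t0t ttau] tT; apply/ler_addgt0Pr => e e0.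
have t0T : t0 < T by exact: lt_le_trans tT.
have K0 : 0 <= 2 * K / N.
  have qg := q_gt0.
  rewrite divr_ge0 ?(ltW N0)// mulr_ge0// mulr_ge0 ?sqr_ge0// addr_ge0// mulr_ge0//.
  exact: ltW.
have en : \forall s \near t0^'+, energy s <= e.
  exact: (cvgr_le _ (energy_init t0T) _ e0).
near t0^'+ => s.
have t0s : t0 < s by near: s; exact: nbhs_right_gt.
have st : s < t by near: s; exact: nbhs_right_lt.
have es : energy s <= e by near: s.
have pos r : s <= r -> 0 < r.
  by move=> sr; apply: lt_le_trans sr; exact: le_lt_trans t0s.
have [||r rI er] := @MVT_segment R energy
    (fun t => \int[mu]_(y in `[- N, N]) dE t y) s t (ltW st).
- move=> r; rewrite in_itv /= => /andP[sr _].
  by apply: is_derive_energy; apply: pos; exact: ltW.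
- apply: continuous_in_subspaceT => r; rewrite inE /= in_itv /= => /andP[sr _].
  by apply: (is_derive_continuous (is_derive_energy _)); exact: pos.
have /andP[sr rt] : s <= r <= t by move: rI; rewrite in_itv.
have dis : \int[mu]_(y in `[- N, N]) dE r y <= 2 * K / N.
  apply: energy_dissipation; last exact: le_trans tT.
  by rewrite (lt_le_trans t0s)//= (le_trans rt).
have h1 : (\int[mu]_(y in `[- N, N]) dE r y) * (t - s) <= 2 * K / N * (t - s).
  by rewrite ler_wpM2r// subr_ge0 ltW.
have h2 : 2 * K / N * (t - s) <= 2 * K / N * tau.
  by rewrite ler_wpM2l//; lra.
lra.
Unshelve. all: by end_near. Qed.

End cutoff_energy.

(** If z(t, y0) were nonzero, z^2 would exceed half its value on an interval of radius r around y0.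
    For N >= 2 L the cutoff is at least (3 / 4)^2 there, so the energy is at least 2 r b with b
    independent of N, against an upper bound of order 1 / N. *)
Lemma strip_vanish t y0 : t0 < t <= t0 + tau -> t <= T -> z t y0 = 0.
Proof.
move=> tI tT; have /andP[t0t ttau] := tI.
have t_gt0 : 0 < t by exact: le_lt_trans t0t.
have qg := q_gt0; have tg := tau_gt0.
apply: contrapT => /eqP zn0.
have z2 : 0 < z t y0 ^+ 2 by rewrite exprn_even_gt0.
have czt_ : continuous (fun y => z t y ^+ 2).
  apply: (continuous_slice (f := fun t y => z t y ^+ 2)) => y; exact: continuous_z2.
have c0 : z t y0 ^+ 2 / 2 < z t y0 ^+ 2 by lra.
have [d /= d0 hd] := cvgr_gt _ (czt_ y0) _ c0.
pose r := Num.min 1 (d / 2).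
have r0 : 0 < r by rewrite lt_min ltr01 divr_gt0.
have r1 : r <= 1 by rewrite ge_min lexx.
have rd : r < d.
  by apply: (@le_lt_trans _ _ (d / 2)); [rewrite ge_min lexx orbT|lra].
pose L := `|y0| + 1; have L1 : 1 <= L by rewrite lerDr.
pose b := z t y0 ^+ 2 / 2 * (9 / 16 * expR (- (2 * q * L ^+ 2))).
have b0 : 0 < b.
  rewrite /b; apply: mulr_gt0; first lra.
  by apply: mulr_gt0; [lra|exact: expR_gt0].
pose K := A ^+ 2 * (8 + 32 * q).
have K0 : 0 <= K by apply: mulr_ge0; [exact: sqr_ge0|lra].
(* The second summand forces 2 r b N > 2 K tau, contradicting the energy bound; the first keeps the
   interval inside half of [- N, N]. *)
pose N := 2 * L + (2 * K * tau + 1) / (b * (2 * r)).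
have br0 : 0 < b * (2 * r) by apply: mulr_gt0 => //; lra.
have Kt0 : 0 <= 2 * K * tau by apply: mulr_ge0; [lra|exact: ltW].
have N2L : 2 * L <= N.
  by rewrite /N lerDl divr_ge0 ?(ltW br0)// addr_ge0.
have N0 : 0 < N by lra.
have inN y : y0 - r <= y <= y0 + r -> `|y| <= L.
  move=> /andP[h1 h2]; rewrite /L.
  have -> : y = y0 + (y - y0) by ring.
  apply: (le_trans (ler_normD _ _)); rewrite lerD2l ler_norml; lra.
have low y : y0 - r <= y <= y0 + r -> b <= z t y ^+ 2 * weight N (theta t) y.
  move=> yI; have yL := inN y yI.
  have zl : z t y0 ^+ 2 / 2 <= z t y ^+ 2.
    apply/ltW/hd => /=; apply: le_lt_trans rd.
    by rewrite distrC ler_distl.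
  have y2L : y ^+ 2 <= L ^+ 2.
    by rewrite -(real_normK (num_real y)) lerXn2r// nnegrE; lra.
  have /andP[_ th2] : q <= theta t <= 2 * q by apply: theta_bounds; rewrite ltW.
  have kL : N ^- 2 * y ^+ 2 <= 1 / 4.
    rewrite mulrC ler_pdivrMr ?exprn_gt0//.
    have : (2 * L) ^+ 2 <= N ^+ 2 by rewrite lerXn2r// nnegrE; lra.
    lra.
  have k0 : 0 <= N ^- 2 * y ^+ 2 by rewrite mulr_ge0 ?sqr_ge0// invr_ge0 sqr_ge0.
  have cl : 9 / 16 <= cutoff N y.
    have -> : (9 / 16 : R) = (3 / 4) ^+ 2 by field.
    by rewrite /cutoff lerXn2r// ?nnegrE; lra.
  have el : expR (- (2 * q * L ^+ 2)) <= expR (- (theta t * y ^+ 2)).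
    rewrite ler_expR lerN2.
    apply: (@le_trans _ _ (2 * q * y ^+ 2)); first by rewrite ler_wpM2r// sqr_ge0.
    by rewrite ler_wpM2l// mulr_ge0// ltW.
  rewrite /b /weight; apply: ler_pM => //; first lra.
  by apply: ler_pM => //; exact: expR_ge0.
have cE : continuous (fun y => z t y ^+ 2 * weight N (theta t) y).
  apply: (continuous_slice (f := fun t y => z t y ^+ 2 * weight N (theta t) y)) => y.
  exact: continuous_E.
have le1 := energy_le N0 tI tT; rewrite -/K in le1.
have le2 : b * (2 * r) <= \int[mu]_(y in `[- N, N]) (z t y ^+ 2 * weight N (theta t) y).
  apply: (@le_trans _ _ (\int[mu]_(y in `[y0 - r, y0 + r])
      (z t y ^+ 2 * weight N (theta t) y))).
    have -> : b * (2 * r) = \int[mu]_(y in `[y0 - r, y0 + r]) b.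
      rewrite Rintegral_cst//= lebesgue_measure_itv /= lte_fin.
      have -> : y0 - r < y0 + r by lra.
      by rewrite -EFinB /=; ring.
    apply: le_Rintegral => //; last exact: integrable_segment.
    by apply: integrable_segment => y; exact: cvg_cst.
  have iN := integrable_segment (- N) N cE.
  have ir := integrable_segment (y0 - r) (y0 + r) cE.
  have sub : `[y0 - r, y0 + r] `<=` `[- N, N].
    move=> y; rewrite /= !in_itv /= => /inN; rewrite ler_norml => /andP[h1 h2].
    by apply/andP; split; lra.
  rewrite /Rintegral fine_le//; try exact: integrable_fin_num.
  apply: ge0_subset_integral => //.
    by case/integrableP: iN.
  move=> y; rewrite /= in_itv /= => yN; rewrite lee_fin.
  by have /andP[-> _] := energy_density_bound N0 tI tT yN.
have := le_trans le2 le1.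
have -> : 2 * K / N * tau = 2 * K * tau / N by ring.
rewrite ler_pdivlMr// => h.
have : 2 * K * tau + 1 <= b * (2 * r) * N.
  by rewrite [leRHS]mulrC -ler_pdivrMr// /N lerDr; lra.
lra.
Qed.

End strip.

(** * Logarithmic variable and stacking of strips *)

Section uniqueness.
Context {R : realType}.

(** The equation z_t = z_yy - V z. Carrying the derivatives as explicit functions makes differences
    of solutions immediate and matches the hypotheses of the strip estimate. *)
Definition log_solution (V : R -> R) (z zt zy zyy : R -> R -> R) : Prop :=
  forall t y : R, 0 < t ->
  [/\ [/\ is_derive t 1 (fun t => z t y) (zt t y), is_derive y 1 (z t) (zy t y),
          is_derive y 1 (zy t) (zyy t y) & zt t y = zyy t y - V y * z t y],
      {for (t, y), continuous (fun p => z p.1 p.2)},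
      {for (t, y), continuous (fun p => zt p.1 p.2)} &
      {for (t, y), continuous (fun p => zyy p.1 p.2)}].

Lemma log_solutionB V (z zt zy zyy w wt wy wyy : R -> R -> R) :
  log_solution V z zt zy zyy -> log_solution V w wt wy wyy ->
  log_solution V (fun t y => z t y - w t y) (fun t y => zt t y - wt t y)
    (fun t y => zy t y - wy t y) (fun t y => zyy t y - wyy t y).
Proof.
move=> hz hw t y t0.
have [[z1 z2 z3 z4] cz czt czyy] := hz t y t0.
have [[w1 w2 w3 w4] cw cwt cwyy] := hw t y t0.
split.
- split; [exact: is_deriveB|exact: is_deriveB|exact: is_deriveB|].
  by rewrite z4 w4; ring.
- by apply: cvgB; [exact: cz|exact: cw].
- by apply: cvgB; [exact: czt|exact: cwt].
- by apply: cvgB; [exact: czyy|exact: cwyy].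
Qed.

Lemma derivable_is_derive1 (f : R -> R) (x : R) :
  derivable f x 1 -> is_derive x 1 f (derive1 f x).
Proof. by move=> h; rewrite derive1E; exact: DeriveDef. Qed.

Lemma is_derive_comp_expR (f : R -> R) (y l : R) :
  is_derive (expR y) 1 f l -> is_derive y 1 (fun y => f (expR y)) (l * expR y).
Proof. by move=> h; exact: (is_derive1_comp h (is_derive_expR y)). Qed.

Lemma besselL_eq (a t x ut ux uxx : R) (u : R -> R -> R) :
  [/\ derive1 (fun t' => u t' x) t = ut, derive1 (u t) x = ux &
      derive1n 2 (u t) x = uxx] ->
  x ^+ 2 * uxx + x * ux - a ^+ 2 * x ^+ 2 * u t x = ut ->
  besselL a (u t) x = derive1 (fun t' => u t' x) t.
Proof. by case=> -> <- <-. Qed.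

Lemma log_solution_of_heat (a : R) (u0 : R -> R) (v : R -> R -> R) :
  heat_cauchy_solution a u0 v -> exists zt zy zyy,
  log_solution (fun y => a ^+ 2 * expR y ^+ 2) (fun t y => v t (expR y)) zt zy zyy.
Proof.
case=> [[dv [cv cvt cvx cvxx]] eqn _].
exists (fun t y => derive1 (fun t' => v t' (expR y)) t).
exists (fun t y => derive1 (v t) (expR y) * expR y).
exists (fun t y => derive1n 2 (v t) (expR y) * expR y ^+ 2
  + derive1 (v t) (expR y) * expR y).
move=> t y t0; have e0 := expR_gt0 y.
have [d1 d2 d3] := dv t (expR y) t0 e0.
have h2 := is_derive_comp_expR (derivable_is_derive1 d2).
have h3 := is_derive_comp_expR (derivable_is_derive1 d3).
have hc (f : R -> R -> R) : continuous_quadrant f ->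
    {for (t, y), continuous (fun p => f p.1 (expR p.2))}.
  move=> cf.
  have h : (p.1, expR p.2) @[p --> (t, y)] --> (t, expR y).
    have c2 : expR p.2 @[p --> (t, y)] --> expR y.
      have c : p.2 @[p --> (t, y)] --> y by exact: cvg_snd.
      exact: (cvg_comp _ _ c (@continuous_expR R y)).
    exact: (cvg_pair cvg_fst c2).
  exact: (cvg_comp _ _ h (cf t (expR y) t0 e0)).
have ce : {for (t, y), continuous (fun p : R * R => expR p.2)}.
  have c : p.2 @[p --> (t, y)] --> y by exact: cvg_snd.
  exact: (cvg_comp _ _ c (@continuous_expR R y)).
have ce2 : {for (t, y), continuous (fun p : R * R => expR p.2 ^+ 2)}.
  by apply: cvgM; exact: ce.
split.
- split.
  + exact: derivable_is_derive1.
  + exact: h2.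
  + have he := is_derive_expR y.
    apply: is_derive_eq; rewrite /GRing.scale /=; ring.
  + by rewrite -eqn// /besselL; ring.
- exact: hc.
- exact: (hc _ cvt).
- apply: cvgD; first by apply: cvgM; [exact: (hc _ cvxx)|exact: ce2].
  by apply: cvgM; [exact: (hc _ cvx)|exact: ce].
Qed.

(** The target time T is fixed before the growth constants are chosen, so [tau] is the same for
    every strip below T, and induction on the number of strips reaches T. *)
Lemma log_solution_vanish (V : R -> R) (z zt zy zyy : R -> R -> R) :
  (forall y, 0 <= V y) -> log_solution V z zt zy zyy ->
  (forall T : R, 0 < T -> exists A B : R, forall t y : R, 0 < t <= T ->
     `|z t y| <= A * expR (B * y ^+ 2)) ->
  (forall y : R, z t y @[t --> 0^'+] --> (0 : R)) ->
  forall t y : R, 0 < t -> z t y = 0.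
Proof.
move=> V0 hz growth init T y T0.
have [A [B hAB]] := growth T T0.
have g t x : 0 < t <= T -> `|z t x| <= `|A| * expR (`|B| * x ^+ 2).
  move=> tT; apply: le_trans (hAB t x tT) _.
  apply: (@le_trans _ _ (`|A| * expR (B * x ^+ 2))).
    by rewrite ler_wpM2r ?expR_ge0// ler_norm.
  by rewrite ler_wpM2l// ler_expR ler_wpM2r ?sqr_ge0// ler_norm.
pose q := 2 * `|B| + 1; pose tau := (16 * q)^-1.
have q0 : 0 < q by rewrite ltr_wpDl// mulr_ge0.
have tau0 : 0 < tau by rewrite invr_gt0 mulr_gt0.
have step (t0 : R) : 0 <= t0 -> (forall x, z t x @[t --> t0^'+] --> (0 : R)) ->
    forall t x, t0 < t <= t0 + tau -> t <= T -> z t x = 0.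
  move=> t00 it0 t x tI tT.
  apply: (@strip_vanish R z zt zy zyy V V0 _ _ _ _ _ _ _ t0 T `|A| `|B| q tau
    t00 _ _ g it0 _ _ t x tI tT) => //.
  - by move=> s s' s0; have [[]] := hz s s' s0.
  - by move=> s s' s0; have [[]] := hz s s' s0.
  - by move=> s s' s0; have [[]] := hz s s' s0.
  - by move=> s s' s0; have [[]] := hz s s' s0.
  - by move=> s s' s0; have [] := hz s s' s0.
  - by move=> s s' s0; have [] := hz s s' s0.
  - by move=> s s' s0; have [] := hz s s' s0.
have main n : forall t x, 0 < t <= n%:R * tau -> t <= T -> z t x = 0.
  elim: n => [t x|n IH t x /andP[t0 tn] tT].
    by rewrite mul0r => /andP[t0 t1]; have := lt_le_trans t0 t1; rewrite ltxx.
  have [tn'|tn'] := leP t (n%:R * tau); first by apply: IH; rewrite ?t0.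
  have n0 : 0 <= n%:R * tau by rewrite mulr_ge0// ltW.
  apply: (step _ n0 _ t x) => //; last first.
    by rewrite tn' /= (le_trans tn)// -natr1 mulrDl mul1r.
  (* Only the first strip starts from the initial condition. Later ones start from z = 0 at time n
     tau, which becomes a right limit by continuity in time. *)
  move=> x'; have [->|nn0] := eqVneq n 0%N; first by rewrite mul0r; exact: init.
  have np : 0 < n%:R * tau by rewrite mulr_gt0// ltr0n lt0n.
  have e : z (n%:R * tau) x' = 0.
    by apply: IH; [rewrite np lexx|exact: le_trans (ltW tn') tT].
  rewrite -e; apply: cvg_at_right_filter.
  by have [[d1 _ _ _] _ _ _] := hz _ x' np; exact: is_derive_continuous d1.
apply: (main (Num.truncn (T / tau)).+1); last exact: lexx.
by rewrite T0 /= -ler_pdivrMr// ltW// truncnS_gt.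
Qed.

End uniqueness.

Theorem theorem5p1 (R : realType) (a : R) (u0 : R -> R)
    (hu0 : smooth_compact_support u0) :
  [/\ heat_cauchy_solution a u0 (heat_formula a u0),
      tychonoff_growth (heat_formula a u0) &
      forall v : R -> R -> R,
        heat_cauchy_solution a u0 v -> tychonoff_growth v ->
        forall t x : R, 0 < t -> 0 < x -> v t x = heat_formula a u0 t x].
Proof.
have [smooth [K [cK K0 Ku0]]] := hu0.
have du0 (x : R) : 0 < x -> is_derive x 1 u0 (derive1 u0 x).
  by move=> x0; apply: derivable_is_derive1; exact: (smooth 0%N x x0).
have ddu0 (x : R) : 0 < x -> {for x, continuous (derive1 u0)}.
  move=> x0; apply: differentiable_continuous; apply/derivable1_diffP.
  exact: (smooth 1%N x x0).
have cu0 (x : R) : 0 < x -> {for x, continuous u0}.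
  by move=> x0; exact: is_derive_continuous (du0 x x0).
have supp m M : K `<=` `[m, M] -> forall x, 0 < x -> ~ (m <= x <= M) -> u0 x = 0.
  move=> KmM x x0 xI; apply: Ku0 => // Kx; apply: xI.
  by have := KmM x Kx; rewrite /= in_itv.
(* The point 1 is arbitrary; it makes the interval nondegenerate. *)
have [m [M [m0 m1 M1 KmM]]] := compact_pos_bounds cK K0 (@ltr01 R).
have mM : m < M by exact: lt_trans M1.
have u00 := supp m M KmM.
have [U hU] := log_weight_bounded m0 mM cu0.
set w := log_weight m M u0 in hU.
have mw : measurable_fun setT w by exact: measurable_log_weight.
have w0 x : ~ (m <= x <= M) -> w x = 0 by exact: log_weight0.
have uE t x : 0 < t -> 0 < x -> heat_formula a u0 t x = heat_moment a w t x.
  by move=> t0 x0; have [_ _ ->] := heat_formula_moment a m0 mM u00 cu0 t0 x0.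
have derivs (t x : R) : 0 < t -> 0 < x ->
  [/\ is_derive t 1 (fun t => heat_formula a u0 t x) (heat_moment_t a w t x),
      is_derive x 1 (heat_formula a u0 t) (heat_moment_x a w t x) &
      is_derive x 1 (heat_moment_x a w t) (heat_moment_xx a w t x)].
  move=> t0 x0; split.
  - apply: near_eq_is_derive (is_derive_heat_moment_t a m0 (ltW mM) mw hU w0 t0 x0).
    by near=> s; rewrite uE//; near: s; exact: near_gt0.
  - apply: near_eq_is_derive (is_derive_heat_moment_x a m0 (ltW mM) mw hU w0 t0 x0).
    by near=> s; rewrite uE//; near: s; exact: near_gt0.
  - exact: (is_derive_heat_moment_xx a m0 (ltW mM) mw hU w0 t0 x0).
have [c1 c2 c3 c4] := continuous_heat_moment a m0 (ltW mM) mw hU w0.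
have cu : continuous_quadrant (heat_formula a u0).
  by apply: eq_continuous_quadrant c1 => t x t0 x0; rewrite uE.
have [uC12 uD] := C12_intro derivs cu c2 c3 c4.
have usol : heat_cauchy_solution a u0 (heat_formula a u0).
  split => //.
  - move=> t x t0 x0; apply: besselL_eq (uD t x t0 x0) _.
    by rewrite uE// (heat_moment_eq a m0 (ltW mM) mw hU w0).
  (* The interval is chosen anew with x in its interior; [heat_formula] itself does not depend on
     it. *)
  - move=> x x0; have [m' [M' [m0' mx' xM' KmM']]] := compact_pos_bounds cK K0 x0.
    have mM' := lt_trans mx' xM'.
    exact: (heat_formula_initial a m0' mM' (supp _ _ KmM') cu0 du0 ddu0 mx' xM').
have [F hF] : exists F, forall x, m <= x <= M -> `|u0 x| <= F.
  have [|c _ hc] := @EVT_max R (fun x => `|u0 x|) m M (ltW mM).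
    apply: continuous_in_subspaceT => z; rewrite inE /= in_itv /= => /andP[mz _].
    by apply: cvg_norm; apply: cu0; exact: lt_le_trans mz.
  by exists `|u0 c| => x xI; apply: hc; rewrite in_itv.
have ugrowth : tychonoff_growth (heat_formula a u0).
  move=> T T0; exists F, 0 => t x /andP[t0 _] x0.
  rewrite mul0r expR0 mulr1; exact: (heat_formula_bound a m0 mM u00 cu0 hF).
split => // v vsol vgrowth t x t0 x0.
have [vt [vy [vyy hv]]] := log_solution_of_heat vsol.
have [ut [uy [uyy hu]]] := log_solution_of_heat usol.
have hd := log_solutionB hv hu.
have : v t (expR (ln x)) - heat_formula a u0 t (expR (ln x)) = 0.
  apply: (log_solution_vanish _ hd) => //.
  - by move=> y; rewrite mulr_ge0 ?sqr_ge0.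
  - move=> T T0; have [A1 [B1 h1]] := vgrowth T T0; have [A2 [B2 h2]] := ugrowth T T0.
    (* Absolute values are needed because the growth condition does not fix the signs of its
       constants. *)
    exists (`|A1| + `|A2|), (`|B1| + `|B2|) => s y sT.
    have bnd (A B B' : R) : `|B| <= B' ->
        A * expR (B * y ^+ 2) <= `|A| * expR (B' * y ^+ 2).
      move=> BB'; apply: (@le_trans _ _ (`|A| * expR (B * y ^+ 2))).
        by rewrite ler_wpM2r ?expR_ge0// ler_norm.
      rewrite ler_wpM2l// ler_expR ler_wpM2r ?sqr_ge0//.
      exact: le_trans (ler_norm _) BB'.
    apply: le_trans (ler_normB _ _) _; rewrite mulrDl lerD//.
      apply: le_trans (h1 s (expR y) sT (expR_gt0 y)) _.
      by rewrite expRK bnd// lerDl.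
    apply: le_trans (h2 s (expR y) sT (expR_gt0 y)) _.
    by rewrite expRK bnd// lerDr.
  - move=> y; have [_ _ i1] := vsol; have [_ _ i2] := usol.
    rewrite -[X in _ --> X](subrr (u0 (expR y))).
    by apply: cvgB; [exact: (i1 _ (expR_gt0 y))|exact: (i2 _ (expR_gt0 y))].
by rewrite lnK ?posrE// => /eqP; rewrite subr_eq0 => /eqP.
Unshelve. all: by end_near. Qed.
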